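(* Fix $L\in\mathbb N_0$ and real numbers $0<r_0<r_1<r_2<1$, and set $C_A:=\sqrt{639/5}\,r_0^{-1}$. There exist constants $M_0>0$ and $C_B>0$ (independent of the contrast $M$ and of the estimator $\eta$, the oscillation functional and the functions $C_{\rm rel},C_{\rm eff}$ below) such that the following holds. Let $\eta$ be an a posteriori error estimator that is locally computable with range $L$, let $\operatorname{osc}_h$ be a data-oscillation functional satisfying the consistency condition $$f\in P_0(\mathcal T_h)\ \Longrightarrow\ \operatorname{osc}_h(\alpha,f)=0,$$ and let $C_{\rm rel},C_{\rm eff}:(1,\infty)\to(0,\infty)$ be functions such that for every $M>1$ and every admissible problem $\mathcal P=(\mathcal T_h,\alpha,f,u_h)$ with contrast $M$, with exact solution $u$, $$\|u-u_h\|_\alpha\le C_{\rm rel}(M)\bigl(\eta(\mathcal P)+\operatorname{osc}_h(\alpha,f)\bigr),\qquad \eta(\mathcal P)\le C_{\rm eff}(M)\bigl(\|u-u_h\|_\alpha+\operatorname{osc}_h(\alpha,f)\bigr).$$ Then $$C_{\rm rel}(M)\,C_{\rm eff}(M)\ \ge\ \bigl(C_A\sqrt{C_B}\bigr)^{-1}M^{1/4}\qquad\text{for all } M>1 \text{ with } M\ge M_0.$$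
   Context: Let $\Omega=(-1,1)^2$. For a conforming triangulation $\mathcal T_h$ of $\Omega$, let $P_0(\mathcal T_h)$ be the space of functions that are constant on each element of $\mathcal T_h$, and let $V_h=\{v_h\in H_0^1(\Omega): v_h|_K\text{ is affine for all }K\in\mathcal T_h\}$. For a positive $\alpha\in P_0(\mathcal T_h)$ and $f\in L^2(\Omega)$ put $a_\alpha(w,v)=\int_\Omega\alpha\nabla w\cdot\nabla v\,dx$ and $\|v\|_\alpha^2=a_\alpha(v,v)$. The exact solution $u\in H_0^1(\Omega)$ satisfies $a_\alpha(u,v)=(f,v)_{L^2(\Omega)}$ for all $v\in H_0^1(\Omega)$, and the conforming $P_1$ finite element solution $u_h\in V_h$ satisfies $a_\alpha(u_h,v_h)=(f,v_h)_{L^2(\Omega)}$ for all $v_h\in V_h$. Admissible problems. For $M>1$, a pair $(\mathcal T_h,\alpha)$ is admissible with contrast $M$ if $\mathcal T_h$ is a conforming triangulation of $\Omega$ and $\alpha$ is piecewise constant on $\mathcal T_h$, satisfies $\alpha|_K\in\{1,M\}$ for every $K\in\mathcal T_h$, and attains both values $1$ and $M$. A problem $\mathcal P=(\mathcal T_h,\alpha,f,u_h)$ is admissible (with contrast $M$) if $(\mathcal T_h,\alpha)$ is admissible with contrast $M$, $f\in L^2(\Omega)$, and $u_h$ is the $P_1$ finite element solution for $(\mathcal T_h,\alpha,f)$. Local patches. For $K,T\in\mathcal T_h$, $\operatorname{dist}_{\mathcal T_h}(K,T)$ is the graph distance in the graph whose vertices are the elements of $\mathcal T_h$, two elements being adjacent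 when they share a face (edge). For $K\in\mathcal T_h$, $\omega_L(K)$ is the interior of the union of the closed elements $\overline T$ with $T\in\mathcal T_h$, $\operatorname{dist}_{\mathcal T_h}(T,K)\le L$. Estimators. An a posteriori estimator assigns to each admissible problem $\mathcal P$ numbers $\eta_K(\mathcal P)\ge0$, $K\in\mathcal T_h$, and $\eta(\mathcal P)^2=\sum_{K\in\mathcal T_h}\eta_K(\mathcal P)^2$. It is locally computable with range $L$ if for any two admissible problems $\mathcal P=(\mathcal T_h,\alpha,f,u_h)$ and $\widetilde{\mathcal P}=(\mathcal T_h,\widetilde\alpha,\widetilde f,\widetilde u_h)$ on the same mesh and any $K\in\mathcal T_h$: if $\alpha=\widetilde\alpha$, $f=\widetilde f$ and $u_h=\widetilde u_h$ almost everywhere on $\omega_L(K)$, then $\eta_K(\mathcal P)=\eta_K(\widetilde{\mathcal P})$. A data-oscillation functional assigns to each admissible pair $(\mathcal T_h,\alpha)$ and $f\in L^2(\Omega)$ a number $\operatorname{osc}_h(\alpha,f)\ge0$. *)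

(* Defs.v *)
From HB Require Import structures.
From mathcomp Require Import all_boot all_order all_algebra.
From mathcomp Require Import all_classical all_reals all_analysis.

Set Implicit Arguments.
Unset Strict Implicit.
Unset Printing Implicit Defensive.

Import Order.TTheory GRing.Theory Num.Theory.
Import numFieldNormedType.Exports.

Local Open Scope classical_set_scope.
Local Open Scope ring_scope.

(* Elements of L^2(Omega), H^1(Omega), P_0 and V_h are represented by functions
   on the whole plane; their values outside Omega are irrelevant.  Functions in
   P_0 and V_h are represented by functions that are exactly constant, resp.
   affine, on each open element, and arbitrary on the mesh skeleton. *)

Section FunctionSpaces.
Variable R : realType.
Implicit Types (u v w f g phi : R * R -> R) (i : 'I_2).

Definition plane_measure := (@lebesgue_measure R \x @lebesgue_measure R)%E.
Local Notation mu := plane_measure.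

Definition Omega : set (R * R) :=
  [set x | (-1 < x.1 < 1) /\ (-1 < x.2 < 1)].

Definition L2_Omega : set (R * R -> R) :=
  [set f | f \_ Omega \in Lfun mu 2%:E].

Definition axis i : R * R := if i == ord0 then (1, 0) else (0, 1).

Definition partial i phi : R * R -> R := 'D_(axis i) phi.

(* C^oo: all iterated partial derivatives are (Frechet) differentiable. *)
Definition smooth phi : Prop :=
  forall (s : seq 'I_2) (x : R * R), differentiable (foldr partial phi s) x.

Definition Cc_infty : set (R * R -> R) :=
  [set phi | [/\ smooth phi,
                 compact (closure [set x | phi x != 0]) &
                 closure [set x | phi x != 0] `<=` Omega]].

Definition is_weak_partial i u g : Prop :=
  forall phi, Cc_infty phi ->
    \int[mu]_(x in Omega) (u x * partial i phi x) =
    - \int[mu]_(x in Omega) (g x * phi x).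

Definition Sobolev_H1 : set (R * R -> R) :=
  [set u | L2_Omega u /\ forall i, exists2 g, L2_Omega g & is_weak_partial i u g].

(* For u in H^1(Omega), a representative of its weak derivative, which is
   determined almost everywhere on Omega. *)
Definition wpartial i u : R * R -> R :=
  xget (cst 0) [set g | L2_Omega g /\ is_weak_partial i u g].

Definition H1norm u : R :=
  Num.sqrt (\int[mu]_(x in Omega) (u x ^+ 2 + \sum_(i < 2) wpartial i u x ^+ 2)).

(* The closure of C_c^oo(Omega) in H^1(Omega). *)
Definition Sobolev_H10 : set (R * R -> R) :=
  [set u | Sobolev_H1 u /\
    forall e : R, 0 < e -> exists2 phi, Cc_infty phi & H1norm (u \- phi) < e].

Definition L2dot f v : R := \int[mu]_(x in Omega) (f x * v x).

Definition a_form (alpha w v : R * R -> R) : R :=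
  \int[mu]_(x in Omega)
    (alpha x * \sum_(i < 2) wpartial i w x * wpartial i v x).

Definition energy_norm (alpha v : R * R -> R) : R :=
  Num.sqrt (a_form alpha v v).

Definition exact_solution (alpha f u : R * R -> R) : Prop :=
  Sobolev_H10 u /\ forall v, Sobolev_H10 v -> a_form alpha u v = L2dot f v.

End FunctionSpaces.

Arguments Omega {R}.
Arguments axis {R}.

Section Meshes.
Variable R : realType.
Implicit Types (a b c : R * R) (A B K : set (R * R)) (T : set (set (R * R))).

Definition noncollinear a b c : Prop :=
  (b.1 - a.1) * (c.2 - a.2) - (b.2 - a.2) * (c.1 - a.1) != 0.

Definition open_triangle a b c : set (R * R) :=
  [set x | exists r s t : R, [/\ 0 < r, 0 < s, 0 < t, r + s + t = 1 &
    x = r *: a + s *: b + t *: c]].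

Definition closed_segment a b : set (R * R) :=
  [set x | exists r s : R, [/\ 0 <= r, 0 <= s, r + s = 1 &
    x = r *: a + s *: b]].

Definition triangle_on K a b c : Prop :=
  noncollinear a b c /\ K = open_triangle a b c.

Definition is_triangle K : Prop := exists a b c, triangle_on K a b c.

Definition is_vertex K a : Prop := exists b c, triangle_on K a b c.

Definition is_edge K (E : set (R * R)) : Prop :=
  exists a b c, triangle_on K a b c /\ E = closed_segment a b.

(* Mesh elements are open triangles, as point sets. *)
Definition conforming_triangulation T : Prop :=
  [/\ finite_set T,
      (forall K, T K -> is_triangle K),
      \bigcup_(K in T) closure K = closure Omega &
      forall A B, T A -> T B -> A <> B ->
        [\/ closure A `&` closure B = set0,
            (exists a, [/\ is_vertex A a, is_vertex B a &
               closure A `&` closure B = [set a]]) |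
            (exists E, [/\ is_edge A E, is_edge B E &
               closure A `&` closure B = E])]].

Definition adjacent T A B : Prop :=
  [/\ T A, T B, A <> B & exists E, is_edge A E /\ is_edge B E].

Definition mesh_path T A (p : seq (set (R * R))) B : Prop :=
  path (fun A B => `[< adjacent T A B >]) A p /\ last A p = B.

(* +oo when there is no path *)
Definition mesh_dist T A B : \bar R :=
  ereal_inf [set (size p)%:R%:E | p in [set p | mesh_path T A p B]].

Definition omega_patch T (L : nat) K : set (R * R) :=
  interior (\bigcup_(A in [set A | T A /\ (mesh_dist T A K <= L%:R%:E)%E])
    closure A).

Definition P0 T : set (R * R -> R) :=
  [set g | measurable_fun Omega g /\
    forall K, T K -> exists c : R, forall x, K x -> g x = c].

Definition V_h T : set (R * R -> R) :=
  [set v | Sobolev_H10 v /\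
    forall K, T K -> exists c0 c1 c2 : R, forall x, K x ->
      v x = c0 + c1 * x.1 + c2 * x.2].

Definition fem_solution T (alpha f uh : R * R -> R) : Prop :=
  V_h T uh /\ forall v, V_h T v -> a_form alpha uh v = L2dot f v.

Definition takes_value K (alpha : R * R -> R) (c : R) : Prop :=
  forall x, K x -> alpha x = c.

Definition admissible_pair (M : R) T (alpha : R * R -> R) : Prop :=
  [/\ 1 < M, conforming_triangulation T /\ P0 T alpha,
      (forall K, T K -> takes_value K alpha 1 \/ takes_value K alpha M),
      (exists2 K, T K & takes_value K alpha 1) &
      (exists2 K, T K & takes_value K alpha M)].

End Meshes.

Record problem (R : realType) := Problem {
  pmesh : set (set (R * R));
  pcoef : R * R -> R;
  pload : R * R -> R;
  pfem : R * R -> R }.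

Section Estimators.
Variable R : realType.
Implicit Types (P Q : problem R) (K : set (R * R)) (T : set (set (R * R))).

Definition admissible (M : R) P : Prop :=
  [/\ admissible_pair M (pmesh P) (pcoef P), L2_Omega (pload P) &
      fem_solution (pmesh P) (pcoef P) (pload P) (pfem P)].

(* Values outside admissible problems and their elements are junk. *)
Definition estimator := problem R -> set (R * R) -> R.

Definition estimator_nonneg (eta : estimator) : Prop :=
  forall M P K, admissible M P -> pmesh P K -> 0 <= eta P K.

Definition total_estimator (eta : estimator) P : R :=
  Num.sqrt (\sum_(K \in pmesh P) eta P K ^+ 2).

(* The two problems may have different contrasts.  Since patches are contained
   in Omega, this also makes eta depend only on the almost-everywhere classes of
   the data. *)
Definition locally_computable (L : nat) (eta : estimator) : Prop :=
  forall M N P Q K, admissible M P -> admissible N Q ->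
    pmesh P = pmesh Q -> pmesh P K ->
    ae_eq (@plane_measure R) (omega_patch (pmesh P) L K) (pcoef P) (pcoef Q) ->
    ae_eq (@plane_measure R) (omega_patch (pmesh P) L K) (pload P) (pload Q) ->
    ae_eq (@plane_measure R) (omega_patch (pmesh P) L K) (pfem P) (pfem Q) ->
    eta P K = eta Q K.

Definition oscillation :=
  set (set (R * R)) -> (R * R -> R) -> (R * R -> R) -> R.

(* The second clause says that osc is a function of the almost-everywhere
   classes of alpha and f. *)
Definition oscillation_functional (osc : oscillation) : Prop :=
  (forall M T alpha f, admissible_pair M T alpha -> L2_Omega f ->
     0 <= osc T alpha f) /\
  (forall M N T alpha beta f g,
     admissible_pair M T alpha -> admissible_pair N T beta -> L2_Omega f -> L2_Omega g ->
     ae_eq (@plane_measure R) Omega alpha beta ->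
     ae_eq (@plane_measure R) Omega f g ->
     osc T alpha f = osc T beta g).

Definition oscillation_consistent (osc : oscillation) : Prop :=
  forall M T alpha f, admissible_pair M T alpha -> L2_Omega f -> P0 T f ->
    osc T alpha f = 0.

Definition reliable (eta : estimator) (osc : oscillation) (Crel : R -> R) :=
  forall M P u, admissible M P ->
    exact_solution (pcoef P) (pload P) u ->
    energy_norm (pcoef P) (u \- pfem P) <=
    Crel M * (total_estimator eta P + osc (pmesh P) (pcoef P) (pload P)).

Definition efficient (eta : estimator) (osc : oscillation) (Ceff : R -> R) :=
  forall M P u, admissible M P ->
    exact_solution (pcoef P) (pload P) u ->
    total_estimator eta P <=
    Ceff M * (energy_norm (pcoef P) (u \- pfem P)
              + osc (pmesh P) (pcoef P) (pload P)).

End Estimators.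

(* Main.v *)
(* The load [f] is the indicator of the triangle with vertices (0, -1), (0, 1),
   (1, 0), which is an element of a fixed mesh.  As its vertices lie on the
   boundary, [f] is orthogonal to the finite element space, and the discrete
   solution is 0 for every coefficient.  Compare the coefficient equal to [M] on the diamond |x| + |y| <= 1
   and to 1 elsewhere with the one equal to [M] on x + |y| <= 1 and to 1 elsewhere.
   They differ only on two triangles at the tip (-1, 0); the mesh has so many layers
   that a patch meeting the support of [f] does not reach these.  On the other
   patches the data are those of the zero load.  So the estimator of the first
   problem is at most that of the second one, and reliability and efficiency give
   |u| <= C_rel C_eff |u'| for the energy norms of the exact solutions.
   In the second problem the phase [M] contains all segments from the left side of
   the square to the support of [f], and integration along these gives
   |u'|^2 <= 4 / M.  In the first problem the phase [M] touches the boundary only at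
   the four tips of the diamond; a cutoff there over [N] dyadic layers has energy
   O(M / N + N), which is O(M^(1/2)) for N ~ M^(1/2), whence |u|^2 >= c M^(-1/2). *)

Require Import Defs.
From HB Require Import structures.
From mathcomp Require Import all_boot all_order all_algebra.
From mathcomp Require Import all_classical all_reals all_analysis.
From mathcomp Require Import measurable_realfun ring lra.

Set Implicit Arguments.
Unset Strict Implicit.
Unset Printing Implicit Defensive.

Import Order.TTheory GRing.Theory Num.Theory.
Import numFieldNormedType.Exports.

Local Open Scope classical_set_scope.
Local Open Scope ring_scope.

(** * Square-integrable functions *)

(** Both bounds on exact solutions come from one duality: [a(u, u)] is the least [K >= 0] with
    [(f, phi)^2 <= K * a(phi, phi)] for all test functions. So the second problem needs an
    inequality for every [phi], the first one a single good [phi], and no solution is computed. The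
    cutoff exploits that a point has zero capacity in the plane. Near a tip the phase [M] is a cone.
    At distance [2^-k] the cutoff has slope about [2^k / N] in the cone, but has to fall to 0 with
    slope about [2^k] between the cone and the side of the square. A layer has area about [4^-k], so
    it costs about [M / N^2 + 1], and [N] layers cost [M / N + N]. Elements of [H^1_0] have no point
    values. The orthogonality of the load to [V_h] is therefore an energy argument: a function in
    [H^1_0] that is affine on the support of the load and does not vanish at one of its vertices
    would have infinite energy there. Reliability and efficiency speak only of given exact
    solutions, so their existence has to be proved as well. *)

Section SquareIntegrable.
Context d (T : measurableType d) (R : realType).
Variables (mu : {measure set T -> \bar R}) (D : set T).
Hypothesis mD : measurable D.
Hypothesis finD : (mu D < +oo)%E.
Implicit Types (f g b : T -> R).

Definition rint f := mu.-integrable D (EFin \o f).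

(** Measurability of [f] is a separate condition, as it does not follow from that of [f ^+ 2]. *)
Definition sqint f := measurable_fun D f /\ rint (fun x => f x ^+ 2).

Lemma rint_measurable f : rint f -> measurable_fun D f.
Proof. by move=> /integrableP[/measurable_EFinP]. Qed.

Lemma rint_le f g : measurable_fun D f ->
  (forall x, D x -> `|f x| <= g x) -> rint g -> rint f.
Proof.
move=> mf fg ig; apply: (le_integrable _ _ _ ig) => //; first exact/measurable_EFinP.
move=> x Dx /=; rewrite lee_fin (le_trans (fg x Dx))// ler_norm //.
Qed.

Lemma rintD f g : rint f -> rint g -> rint (fun x => f x + g x).
Proof. by move=> fi gi; apply: eq_integrable (integrableD mD fi gi). Qed.

Lemma rintZ (k : R) f : rint f -> rint (fun x => k * f x).
Proof. by move=> fi; apply: eq_integrable (integrableZl mD k fi). Qed.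

Lemma rint_cst (c : R) : rint (fun=> c).
Proof.
apply/integrableP; split; first exact/measurable_EFinP/measurable_cst.
by rewrite (@integral_cst _ _ _ mu D mD `|c|%:E) lte_mul_pinfty.
Qed.

Lemma rint_bounded b (C : R) : measurable_fun D b ->
  (forall x, D x -> `|b x| <= C) -> rint b.
Proof. by move=> mb bC; apply: (rint_le mb bC); exact: rint_cst. Qed.

Lemma rint_bM b f (C : R) : measurable_fun D b ->
  (forall x, D x -> `|b x| <= C) -> rint f -> rint (fun x => b x * f x).
Proof.
move=> mb bC fi; have mf := rint_measurable fi.
apply: (@rint_le _ (fun x => C * `|f x|)); first exact: measurable_funM.
- by move=> x Dx; rewrite normrM ler_wpM2r// bC.
- exact/rintZ/integrable_norm.
Qed.

Lemma sqintM f g : sqint f -> sqint g -> rint (fun x => f x * g x).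
Proof.
move=> [mf fi] [mg gi].
apply: (@rint_le _ (fun x => f x ^+ 2 + g x ^+ 2)); first exact: measurable_funM.
- move=> x Dx; rewrite normrM -(real_normK (num_real (f x))).
  rewrite -(real_normK (num_real (g x))).
  have : 0 <= (`|f x| - `|g x|) ^+ 2 by exact: sqr_ge0.
  have := normr_ge0 (f x); have := normr_ge0 (g x); nra.
- exact: rintD.
Qed.

Lemma sqintD f g : sqint f -> sqint g -> sqint (fun x => f x + g x).
Proof.
move=> sf sg; split; first by apply: measurable_funD; [case: sf|case: sg].
have fg := sqintM sf sg; have [[_ ff] [_ gg]] := (sf, sg).
apply: eq_integrable (rintD (rintD ff gg) (rintD fg fg)) => // x _ /=.
by congr EFin; ring.
Qed.

Lemma sqintZ (k : R) f : sqint f -> sqint (fun x => k * f x).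
Proof.
move=> [mf fi]; split; first exact: measurable_funM.
by apply: eq_integrable (rintZ (k ^+ 2) fi) => // x _ /=; rewrite exprMn.
Qed.

Lemma sqintB f g : sqint f -> sqint g -> sqint (fun x => f x - g x).
Proof.
move=> sf /(sqintZ (-1)) /(sqintD sf).
by congr sqint; apply/funext => x; rewrite mulN1r.
Qed.

Lemma sqint_bounded b (C : R) : measurable_fun D b ->
  (forall x, D x -> `|b x| <= C) -> sqint b.
Proof.
move=> mb bC; split => //; apply: (@rint_bounded _ (C ^+ 2)).
  exact: measurable_funX.
move=> x Dx; rewrite normrX; have := bC _ Dx; have := normr_ge0 (b x); nra.
Qed.

Lemma sqint_cst (c : R) : sqint (fun=> c).
Proof. by apply: (@sqint_bounded _ `|c|) => //; exact: measurable_cst. Qed.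

Lemma sqint_bM b f (C : R) : measurable_fun D b ->
  (forall x, D x -> `|b x| <= C) -> sqint f -> sqint (fun x => b x * f x).
Proof.
move=> mb bC [mf fi]; split; first exact: measurable_funM.
have H : rint (fun x => b x ^+ 2 * f x ^+ 2).
  apply: (@rint_bM _ _ (C ^+ 2)) fi; first exact: measurable_funX.
  move=> x Dx; rewrite normrX; have := bC _ Dx; have := normr_ge0 (b x); nra.
by apply: eq_integrable H => // x _ /=; rewrite exprMn.
Qed.

Lemma sqint_rint f : sqint f -> rint f.
Proof.
move=> sf; have := sqintM (sqint_cst 1) sf.
by apply: eq_integrable => // x _ /=; rewrite mul1r.
Qed.

Local Notation "\I f" := (\int[mu]_(x in D) f x) (at level 36, f at level 36).

Lemma ae_eq_Rintegral f g : measurable_fun D f -> measurable_fun D g ->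
  ae_eq mu D f g -> \I f = \I g.
Proof.
move=> mf mg fg; rewrite /Rintegral; congr fine; apply: ae_eq_integral => //.
- exact/measurable_EFinP.
- exact/measurable_EFinP.
- by apply: filterS fg => x fg Dx /=; rewrite fg.
Qed.

Lemma RintD f g : rint f -> rint g -> \I (fun x => f x + g x) = \I f + \I g.
Proof. by move=> fi gi; rewrite RintegralD. Qed.

Lemma RintB f g : rint f -> rint g -> \I (fun x => f x - g x) = \I f - \I g.
Proof. by move=> fi gi; rewrite RintegralB. Qed.

Lemma RintZ (k : R) f : rint f -> \I (fun x => k * f x) = k * \I f.
Proof. by move=> fi; rewrite RintegralZl. Qed.

(** The common source of the Cauchy-Schwarz inequalities below and of the approximate Euler equation
    of a minimizing sequence. *)
Lemma discriminant_le0 (p q r : R) :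
  (forall t, 0 <= p + 2 * t * q + t ^+ 2 * r) -> q ^+ 2 <= p * r.
Proof.
move=> H; have p0 : 0 <= p by have := H 0; rewrite mulr0 mul0r expr0n /= mul0r !addr0.
have r0 : 0 <= r.
  rewrite leNgt; apply/negP => r0.
  (* If [r < 0], adding the values at [t] and [- t] cancels the linear term, and this [t] is so
     large that the sum is negative. *)
  have := H ((- (p + 1) - `|q|) / r * 0); have := H ((1 + p) / (- r) + 1).
  have := H (- ((1 + p) / (- r) + 1)).
  set t := (1 + p) / (- r) + 1 => H1 H2 _.
  have t1 : 1 <= t by rewrite /t lerDr divr_ge0//; lra.
  have tr : t * - r = 1 + p - r.
    by rewrite /t mulrDl mul1r divfK// oppr_eq0 lt_eqF.
  have : t * (t * - r) >= 1 * (1 + p - r) by rewrite tr ler_wpM2r//; lra.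
  nra.
have [r00|rN0] := eqVneq r 0.
  rewrite r00 mulr0; have [->|qN0] := eqVneq q 0; first by rewrite expr0n.
  (* With [r = 0] the function is affine in [t] and equals [-1] here. *)
  have := H (- (p + 1) / (2 * q)); rewrite r00 mulr0 addr0.
  suff -> : 2 * (- (p + 1) / (2 * q)) * q = - (p + 1) by lra.
  by field.
have := H (- q / r).
suff -> : p + 2 * (- q / r) * q + (- q / r) ^+ 2 * r = (p * r - q ^+ 2) / r.
  by rewrite pmulr_lge0 ?subr_ge0// invr_gt0 lt0r rN0.
by field.
Qed.

Lemma Cauchy_Schwarz f g : sqint f -> sqint g ->
  (\I (fun x => f x * g x)) ^+ 2 <= \I (fun x => f x ^+ 2) * \I (fun x => g x ^+ 2).
Proof.
move=> sf sg; apply: discriminant_le0 => t.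
have -> : \I (fun x => f x ^+ 2) + 2 * t * \I (fun x => f x * g x) +
    t ^+ 2 * \I (fun x => g x ^+ 2) = \I (fun x => (f x + t * g x) ^+ 2).
  have [[_ ff] [_ gg]] := (sf, sg); have fg := sqintM sf sg.
  rewrite -!RintZ// -!RintD//; first last.
  - exact: rintZ.
  - exact: rintZ.
  - by apply: rintD => //; exact: rintZ.
  by apply: eq_Rintegral => x _; ring.
by apply: Rintegral_ge0 => x _; exact: sqr_ge0.
Qed.

Lemma Cauchy_Schwarz_sqrt f g : sqint f -> sqint g ->
  `|\I (fun x => f x * g x)| <=
  Num.sqrt (\I (fun x => f x ^+ 2)) * Num.sqrt (\I (fun x => g x ^+ 2)).
Proof.
move=> sf sg; rewrite -sqrtrM; last by apply: Rintegral_ge0 => x _; exact: sqr_ge0.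
by rewrite -sqrtr_sqr ler_wsqrtr// Cauchy_Schwarz.
Qed.

End SquareIntegrable.

(** * Completeness of L^2 *)

Section L2Completeness.
Context d (T : measurableType d) (R : realType).
Variables (mu : {measure set T -> \bar R}) (D : set T).
Hypothesis mD : measurable D.
Hypothesis finD : (mu D < +oo)%E.
Implicit Types (f g : T -> R).

Local Notation "\I f" := (\int[mu]_(x in D) f x) (at level 36, f at level 36).
Local Notation sqint := (sqint mu D).
Local Notation rint := (rint mu D).

Lemma limn_einf_le (u : (\bar R)^nat) (e : \bar R) (N : nat) :
  (forall n, (N <= n)%N -> (u n <= e)%E) -> (limn_einf u <= e)%E.
Proof.
move=> ue; rewrite limn_einf_lim; apply: lime_le; first exact: is_cvg_einfs.
apply: nearW => n; apply: (@le_trans _ _ (u (maxn n N))).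
  by apply: ereal_inf_lbound; exists (maxn n N) => //=; rewrite leq_maxl.
by apply: ue; rewrite leq_maxr.
Qed.

Lemma rint_fin f : rint f -> (\int[mu]_(x in D) (f x)%:E)%E = (\I f)%:E.
Proof. by move=> fi; rewrite /Rintegral fineK//; exact: integrable_fin_num. Qed.

(* The increments of a rapidly Cauchy subsequence are summable almost everywhere. *)
Lemma sqint_rapid_cvg (g : nat -> T -> R) : (forall k, sqint (g k)) ->
  (forall k, \I (fun x => (g k.+1 x - g k x) ^+ 2) <= 2^-1 ^+ k * 2^-1 ^+ k) ->
  {ae mu, forall x, D x -> cvgn (fun k => g k x)}.
Proof.
move=> sg gk; pose h k x := `|g k.+1 x - g k x|.
have sh k : sqint (fun x => g k.+1 x - g k x) by apply: sqintB.
have ih k : rint (h k) by apply/integrable_norm/(sqint_rint mD finD (sh k)).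
have mh k : measurable_fun D (EFin \o h k) by case/integrableP : (ih k).
pose c : R := 1 + fine (mu D).
have c0 : 0 <= c by rewrite addr_ge0// fine_ge0.
have hk k : (\int[mu]_(x in D) (h k x)%:E <= (c * 2^-1 ^+ k)%:E)%E.
  rewrite rint_fin// lee_fin.
  pose q : R := 2^-1 ^+ k; have q0 : 0 < q by rewrite exprn_gt0// invr_gt0.
  (* Young's inequality [y <= q^-1 * y ^+ 2 + q] turns the bound [q ^+ 2] in L^2 into the bound
     [c * q] in L^1. *)
  apply: (@le_trans _ _ (\I (fun x => q^-1 * (g k.+1 x - g k x) ^+ 2 + q))).
    have i2 : rint (fun x => q^-1 * (g k.+1 x - g k x) ^+ 2 + q).
      by apply: rintD => //; [apply: rintZ => //; case: (sh k)|exact: rint_cst].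
    apply: le_Rintegral => //; first exact: ih.
    move=> x _; rewrite /h -(real_normK (num_real (g k.+1 x - g k x))).
    set y := `|_|; have y0 : 0 <= y by exact: normr_ge0.
    rewrite -subr_ge0 -(pmulr_rge0 _ q0).
    rewrite (_ : q * _ = y ^+ 2 - q * y + q ^+ 2); last by field; rewrite gt_eqF.
    by have := sqr_ge0 (y - q); nra.
  rewrite RintD//; last first.
  - exact: rint_cst.
  - by apply: rintZ => //; case: (sh k).
  rewrite RintZ//; last by case: (sh k).
  rewrite Rintegral_cst//= /c mulrDl mul1r [fine _ * _]mulrC lerD2r.
  rewrite ler_pdivrMl//; exact: gk.
have mS : measurable_fun D (fun x => \sum_(k <oo) (h k x)%:E)%E.
  have h0 k x : D x -> xpredT k -> (0 <= (h k x)%:E)%E by rewrite lee_fin normr_ge0.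
  exact: (ge0_emeasurable_sum h0 (fun k _ => mh k)).
(* By monotone convergence the sum of the increments has a finite integral, so it is finite almost
   everywhere. *)
have iS : mu.-integrable D (fun x => \sum_(k <oo) (h k x)%:E)%E.
  apply/integrableP; split => //.
  have S0 x : (0 <= \sum_(k <oo) (h k x)%:E)%E.
    by apply: nneseries_ge0 => k _ _; rewrite lee_fin normr_ge0.
  under eq_integral do rewrite gee0_abs//.
  rewrite integral_nneseries//; last first.
    by move=> n x Dx; rewrite lee_fin normr_ge0.
  apply: (@le_lt_trans _ _ (\sum_(k <oo) (c * 2^-1 ^+ k)%:E)%E).
    apply: lee_nneseries => // k _ _; apply: integral_ge0 => x _.
    by rewrite lee_fin normr_ge0.
  have -> : (\sum_(k <oo) (c * 2^-1 ^+ k)%:E)%E =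
      (limn (series (geometric c 2^-1)))%:E :> \bar R.
    rewrite -EFin_lim; last first.
      by apply: is_cvg_geometric_series; rewrite ger0_norm ?invr_ge0// invf_lt1// ltr1n.
    by congr (limn _); apply/funext => n; rewrite sumEFin.
  exact: ltry.
apply: filterS (integrable_ae mD iS) => x fx Dx.
have {fx Dx} fx := fx Dx.
have cs : cvgn (series (fun k => g k.+1 x - g k x)).
  apply: normed_cvg; rewrite /normed_series_of /=.
  have := fx; rewrite ge0_fin_numE; last first.
    by apply: nneseries_ge0 => k _ _; rewrite lee_fin normr_ge0.
  move=> fxoo; apply: nondecreasing_is_cvgn.
    by apply: nondecreasing_series => n _ _; exact: normr_ge0.
  exists (fine (\sum_(k <oo) (h k x)%:E)%E) => _ [n _ <-].
  rewrite -lee_fin fineK// seriesEnat/= -sumEFin.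
  apply: (@nneseries_lim_ge _ (fun k => (h k x)%:E)) => k _ _.
  by rewrite lee_fin normr_ge0.
rewrite (_ : (fun k => g k x) = (fun k => series (fun k => g k.+1 x - g k x) k + g 0%N x)).
  by apply: is_cvgD => //; exact: is_cvg_cst.
by apply/funext => k; rewrite seriesEnat /= telescope_sumr// subrK.
Qed.

(** A rapidly Cauchy subsequence converges almost everywhere. Fatou's lemma along it, with [f_ n]
    fixed, turns the Cauchy bounds into convergence of the whole sequence. *)
Lemma L2_complete (f_ : nat -> T -> R) : (forall n, sqint (f_ n)) ->
  (forall e : R, 0 < e -> exists N, forall m n, (N <= m)%N -> (N <= n)%N ->
     \I (fun x => (f_ m x - f_ n x) ^+ 2) <= e) ->
  exists2 f, sqint f &
    (forall e : R, 0 < e -> exists N, forall n, (N <= n)%N ->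
     \I (fun x => (f x - f_ n x) ^+ 2) <= e).
Proof.
move=> sf cauchy.
have q0 k : 0 < (2^-1 ^+ k * 2^-1 ^+ k : R).
  by rewrite mulr_gt0// exprn_gt0// invr_gt0.
have [N NP] := choice (fun k => cauchy _ (q0 k)).
(* Partial sums give nondecreasing indices that dominate both [N k] and [k]. *)
pose n_ k := (\sum_(i < k.+1) (N i).+1)%N.
have n_ge k : (N k <= n_ k)%N by rewrite /n_ big_ord_recr/= addnS ltnW// ltnS leq_addl.
have n_gek k : (k <= n_ k)%N.
  elim: k => // k ih; rewrite /n_ big_ord_recr/= addnS ltnS.
  exact: leq_trans ih (leq_addr _ _).
have n_S k : (n_ k <= n_ k.+1)%N by rewrite /n_ [leqRHS]big_ord_recr/= leq_addr.
have n_mono j k : (j <= k)%N -> (n_ j <= n_ k)%N.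
  move=> /subnKC <-; elim: (k - j)%N => [|i ih]; first by rewrite addn0.
  by rewrite addnS (leq_trans ih).
pose g k := f_ (n_ k).
have sg k : sqint (g k) by exact: sf.
have cg : {ae mu, forall x, D x -> cvgn (fun k => g k x)}.
  apply: sqint_rapid_cvg => // k; apply: NP; last exact: n_ge.
  exact: leq_trans (n_ge k) (n_S k).
(* The upper limit is measurable without any assumption on convergence, and it is the limit wherever
   there is one. *)
pose f x := fine (limn_esup (fun k => (g k x)%:E)).
have mf : measurable_fun D f.
  apply: measurableT_comp => //; apply: measurable_fun_limn_esup => k.
  by apply/measurable_EFinP; case: (sg k).
have fE : {ae mu, forall x, D x -> (fun k => g k x) @ \oo --> f x}.
  apply: filterS cg => x cx Dx; have {cx} := cx Dx => cx.
  rewrite /f is_cvg_limn_esupE; last first.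
    by apply/cvg_ex; exists (limn (fun k => g k x))%:E; apply: cvg_EFin => //; exact: nearW.
  rewrite EFin_lim //.
have Fatou n (e : R) K : (forall k, (K <= k)%N -> \I (fun x => (g k x - f_ n x) ^+ 2) <= e) ->
    (\int[mu]_(x in D) ((f x - f_ n x) ^+ 2)%:E <= e%:E)%E.
  move=> H; pose u k x := ((g k x - f_ n x) ^+ 2)%:E.
  have mu_ k : measurable_fun D (u k).
    apply/measurable_EFinP/measurable_funX/measurable_funB.
      by case: (sg k).
    by case: (sf n).
  have u0 k x : D x -> (0 <= u k x)%E by move=> _; rewrite lee_fin sqr_ge0.
  apply: (@le_trans _ _ (\int[mu]_(x in D) limn_einf (u ^~ x))%E).
    apply: ae_ge0_le_integral => //.
    - by move=> x _; rewrite lee_fin sqr_ge0.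
    - apply/measurable_EFinP/measurable_funX/measurable_funB => //.
      by case: (sf n).
    - move=> x Dx; rewrite limn_einf_lim; apply: lime_ge; first exact: is_cvg_einfs.
      by apply: nearW => k; apply: le_ereal_inf_tmp => _ [j _ <-]; exact: u0.
    - have -> : (fun x => limn_einf (u ^~ x)) = (fun x => - limn_esup (fun k => - u k x))%E.
        by apply/funext => x; rewrite -limn_einfN; congr limn_einf; apply/funext => k; rewrite /u /= opprK.
      apply: measurableT_comp => //; apply: measurable_fun_limn_esup => k.
      exact: measurableT_comp.
    - apply: filterS fE => x fx Dx.
      have uf : u ^~ x @ \oo --> ((f x - f_ n x) ^+ 2)%:E.
        apply: cvg_EFin; first exact: nearW.
        have H1 : (fun k => g k x - f_ n x) @ \oo --> f x - f_ n x.
          by apply: cvgB; [exact: fx|exact: cvg_cst].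
        by rewrite expr2; exact: (cvgM H1 H1).
      rewrite is_cvg_limn_einfE; first by rewrite (cvg_lim _ uf).
      by apply/cvg_ex; eexists; exact: uf.
  apply: (le_trans (@fatou _ _ _ mu D mD u mu_ u0)).
  apply: (@limn_einf_le _ _ K) => k nk; rewrite rint_fin ?lee_fin; first exact: H.
  by case: (sqintB mD (sg k) (sf n)).
have key (e : R) : 0 < e -> exists N0, forall n, (N0 <= n)%N ->
    (\int[mu]_(x in D) ((f x - f_ n x) ^+ 2)%:E <= e%:E)%E.
  move=> e0; have [N0 N0P] := cauchy _ e0; exists N0 => n Nn.
  by apply: (Fatou _ _ N0) => k Kk; apply: N0P => //; exact: leq_trans Kk (n_gek k).
have sfn n : measurable_fun D (f_ n) by case: (sf n).
have sd n e : (\int[mu]_(x in D) ((f x - f_ n x) ^+ 2)%:E <= e%:E)%E ->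
    sqint (fun x => f x - f_ n x).
  move=> H; have md : measurable_fun D (fun x => f x - f_ n x).
    exact: measurable_funB.
  split => //; apply/integrableP; split.
    by apply/measurable_EFinP; exact: measurable_funX.
  under eq_integral do rewrite /= ger0_norm ?sqr_ge0//.
  by apply: le_lt_trans H _; exact: ltry.
exists f.
  have [N0 H] := key 1 ltr01.
  have := sqintD mD (sd _ _ (H _ (leqnn _))) (sf N0).
  by congr sqint; apply/funext => x; rewrite subrK.
move=> e e0; have [N0 H] := key e e0; exists N0 => n Nn.
rewrite -lee_fin -rint_fin; first exact: H.
by case: (sd _ _ (H _ Nn)).
Qed.

End L2Completeness.

(** * Smooth functions *)

Section SmoothReal.
Variable R : realType.
Implicit Types (f g h : R -> R).

Definition smooth1 h : Prop := forall n x, derivable (derive1n n h) x 1.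

(** Replaces formulas for higher derivatives: it is enough to exhibit a class that is stable under
    derivation. *)
Lemma smooth1_coind (C : set (R -> R)) :
  (forall h, C h -> (forall x, derivable h x 1) /\ C (derive1 h)) ->
  forall h, C h -> smooth1 h.
Proof.
move=> HC h Ch n; elim: n h Ch => [|n ih] h Ch x.
  by have [+ _] := HC _ Ch; exact.
by rewrite derive1Sn; apply: ih; have [] := HC _ Ch.
Qed.

Lemma smooth1_derivable h x : smooth1 h -> derivable h x 1.
Proof. by move/(_ 0%N x). Qed.

Lemma smooth1_derive1 h : smooth1 h -> smooth1 (derive1 h).
Proof. by move=> sh n x; rewrite -derive1Sn; exact: sh. Qed.

Lemma derive1_of_is_derive h h' : (forall x : R, is_derive x 1 h (h' x)) -> (derive1 h) = h'.
Proof. by move=> H; apply/funext => x; rewrite derive1E derive_val. Qed.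

(* If the derivatives of the members of [B] lie in [alg1 B], then [alg1 B] is closed
   under derivation, hence consists of smooth functions. *)
Inductive alg1 (B : set (R -> R)) : (R -> R) -> Prop :=
| alg1_base h : B h -> alg1 B h
| alg1_cst c : alg1 B (fun=> c)
| alg1_affine (a b : R) : alg1 B (fun x => a * x + b)
| alg1D f g : alg1 B f -> alg1 B g -> alg1 B (fun x => f x + g x)
| alg1M f g : alg1 B f -> alg1 B g -> alg1 B (fun x => f x * g x)
| alg1_comp f g : alg1 B f -> alg1 B g -> alg1 B (fun x => f (g x)).

Lemma alg1_mono (B B' : set (R -> R)) h : B `<=` B' -> alg1 B h -> alg1 B' h.
Proof.
move=> BB'; elim=> {h}[h /BB'|c|a b|f g _ ? _ ?|f g _ ? _ ?|f g _ ? _ ?].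
- exact: alg1_base.
- exact: alg1_cst.
- exact: alg1_affine.
- exact: alg1D.
- exact: alg1M.
- exact: alg1_comp.
Qed.

Lemma alg1_derive (B : set (R -> R)) :
  (forall h, B h -> exists2 h', (forall x : R, is_derive x 1 h (h' x)) & alg1 B h') ->
  forall h, alg1 B h -> exists2 h', (forall x : R, is_derive x 1 h (h' x)) & alg1 B h'.
Proof.
move=> HB h; elim=> {h}[h /HB//|c|a b|f g _ [f' df af] _ [g' dg ag]|
  f g Af [f' df af] Ag [g' dg ag]|f g Af [f' df af] Ag [g' dg ag]].
- by exists (fun=> 0); [move=> x; exact: is_derive_cst|exact: alg1_cst].
- exists (fun=> a); last exact: alg1_cst.
  move=> x; have -> : (fun x => a * x + b) = a \*: id + cst b by exact/funext.
  by apply: is_derive_eq; rewrite addr0 [_ *: _]mulr1.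
- exists (fun x => f' x + g' x); last exact: alg1D.
  by move=> x; apply: is_deriveD.
- exists (fun x => f x * g' x + g x * f' x); last by apply: alg1D; apply: alg1M.
  by move=> x; apply: is_deriveM.
- exists (fun x => f' (g x) * g' x); last by apply: alg1M => //; exact: alg1_comp.
  by move=> x; apply: is_derive1_comp.
Qed.

Lemma alg1_smooth (B : set (R -> R)) :
  (forall h, B h -> exists2 h', (forall x : R, is_derive x 1 h (h' x)) & alg1 B h') ->
  forall h, alg1 B h -> smooth1 h.
Proof.
move=> HB; apply: smooth1_coind => h /(alg1_derive HB) [h' dh ah]; split.
  by move=> x; have := dh x; case.
by rewrite (derive1_of_is_derive dh).
Qed.

(** The powers of [x^-1] are included because the derivative of one member is a linear combination
    of two others, so that the family generates a class stable under derivation. *)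
Definition flat_exp (n : nat) (x : R) : R :=
  if 0 < x then x^-1 ^+ n * expR (- x^-1) else 0.

Lemma flat_exp_ge0 n x : 0 <= flat_exp n x.
Proof.
rewrite /flat_exp; case: ifP => // x0.
by rewrite mulr_ge0 ?expR_ge0// exprn_ge0// invr_ge0 ltW.
Qed.

Lemma flat_exp_gt0 n x : 0 < x -> 0 < flat_exp n x.
Proof. by move=> x0; rewrite /flat_exp x0 mulr_gt0 ?expR_gt0// exprn_gt0// invr_gt0. Qed.

Lemma flat_exp_le0 n x : x <= 0 -> flat_exp n x = 0.
Proof. by rewrite /flat_exp leNgt => /negbTE ->. Qed.

(** Quadratic decay makes the difference quotients at 0 tend to 0. It follows from
    [(y / m) ^+ m <= expR y] with [y = x^-1] and [m = n.+2]. *)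
Lemma flat_exp_le_sqr n x : flat_exp n x <= n.+2%:R ^+ n.+2 * x ^+ 2.
Proof.
rewrite /flat_exp; case: ifPn => [x0|_]; last by rewrite mulr_ge0 ?sqr_ge0// exprn_ge0.
set m := n.+2; have m0 : 0 < m%:R :> R by rewrite ltr0n.
have xV0 : 0 < x^-1 by rewrite invr_gt0.
have H : (x^-1 / m%:R) ^+ m <= expR (x^-1).
  have -> : expR x^-1 = expR (x^-1 / m%:R) ^+ m.
    by rewrite -expRM_natl mulrC divfK// gt_eqF.
  apply: lerXn2r; rewrite ?nnegrE ?expR_ge0//; first by rewrite divr_ge0// ltW.
  by apply: le_trans (expR_ge1Dx _); rewrite lerDr.
rewrite expRN.
rewrite ler_pdivrMr ?expR_gt0//; apply: (@le_trans _ _ (m%:R ^+ m * x ^+ 2 * (x^-1 / m%:R) ^+ m)).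
  rewrite expr_div_n (exprSr x^-1 n.+1) (exprSr x^-1 n).
  have a0 : m%:R ^+ m != 0 :> R by rewrite expf_neq0// gt_eqF.
  have x0' : x != 0 by rewrite gt_eqF.
  move: (m%:R ^+ m) a0 (x^-1 ^+ n) => a a0 w.
  by rewrite (_ : _ * (_ / _) = w)//; field; rewrite x0' a0.
by rewrite ler_wpM2l// mulr_ge0 ?sqr_ge0// exprn_ge0// ltW.
Qed.

Lemma is_derive_flat_exp n (x : R) :
  is_derive x 1 (flat_exp n) (- n%:R * flat_exp n.+1 x + flat_exp n.+2 x).
Proof.
have [x0|x0|->] := ltgtP x 0.
- rewrite !flat_exp_le0 ?ltW// mulr0 addr0.
  apply: (near_eq_is_derive (f := cst 0)).
  by near=> y; rewrite flat_exp_le0// ltW//; near: y; exact: lt_nbhsl.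
- have xn0 : x != 0 by rewrite gt_eqF.
  have D1 : is_derive x 1 (fun y : R => y^-1) (- x ^- 2).
    apply: (is_derive_eq (is_deriveV (f := id) xn0 (is_derive_id x 1))).
    by rewrite /GRing.scale /= mulr1.
  have D2 : is_derive x 1 (fun y : R => expR (- y^-1)) (expR (- x^-1) * x ^- 2).
    rewrite -[x ^- 2]opprK.
    exact: (is_derive1_comp (is_derive_expR _) (is_deriveN D1)).
  have D3 : is_derive x 1 (fun y : R => y^-1 ^+ n) (- n%:R * x^-1 ^+ n.+1).
    have -> : (fun y : R => y^-1 ^+ n) = (fun y : R => y^-1) ^+ n by rewrite exprfctE.
    apply: (is_derive_eq (is_deriveX n D1)); rewrite /GRing.scale /=.
    case: n => [|n]; first by rewrite !mulr0n oppr0 !mul0r.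
    by rewrite /= -exprVn !exprS expr0 mulr1; ring.
  apply: (near_eq_is_derive (f := (fun y => y^-1 ^+ n) * (fun y => expR (- y^-1)))).
    by near=> y; rewrite /flat_exp ifT//; near: y; exact: lt_nbhsr.
  apply: (is_derive_eq (is_deriveM D3 D2)); rewrite /flat_exp x0 /GRing.scale /= -exprVn !exprS expr0 mulr1.
  by ring.
- rewrite !flat_exp_le0// mulr0 addr0.
  have H : (fun t : R => t^-1 *: ((flat_exp n \o shift 0) (t *: (1 : R)) - flat_exp n 0)) @ 0^' --> (0 : R).
    apply/cvgr0Pnorm_le => e e0; pose K : R := n.+2%:R ^+ n.+2.
    have K0 : 0 < K by rewrite exprn_gt0.
    near=> t.
    rewrite /= addr0 [flat_exp n 0]flat_exp_le0// subr0 [t *: 1]mulr1 normrM normfV.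
    have h0 : t != 0 by near: t; exact: nbhs_dnbhs_neq.
    rewrite ler_pdivrMl ?normr_gt0// ger0_norm ?flat_exp_ge0//.
    apply: le_trans (flat_exp_le_sqr _ _) _.
    rewrite -(real_normK (num_real t)) expr2 mulrA mulrC ler_wpM2l//.
    rewrite mulrC -ler_pdivlMr//; near: t; apply: dnbhs0_le; exact: divr_gt0.
  apply: DeriveDef; first by apply/cvg_ex; exists 0.
  exact: cvg_lim.
Unshelve. all: by end_near. Qed.

End SmoothReal.

(** * A smooth transition function on the line *)

Section SmoothStep.
Variable R : realType.
Implicit Types (f g h : R -> R).

(** The two summands vanish on the disjoint half-lines [x <= 2^-1] and [x >= 1], so the sum is
    positive and may serve as a denominator. *)
Definition step_den (x : R) : R := flat_exp 0 (x - 2^-1) + flat_exp 0 (1 - x).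

Lemma step_den_gt0 x : 0 < step_den x.
Proof.
rewrite /step_den; have [xh|hx] := leP x 2^-1.
  by rewrite ltr_wpDl ?flat_exp_ge0// flat_exp_gt0//; lra.
by rewrite ltr_pwDl ?flat_exp_ge0// flat_exp_gt0//; lra.
Qed.

Definition step (x : R) : R := flat_exp 0 (x - 2^-1) * (step_den x)^-1.

Definition flat_family : set (R -> R) := [set h | exists n, h = flat_exp n].

Lemma flat_family_derive h : flat_family h ->
  exists2 h', (forall x : R, is_derive x 1 h (h' x)) & alg1 flat_family h'.
Proof.
move=> [n ->]; exists (fun x => - n%:R * flat_exp n.+1 x + flat_exp n.+2 x).
  exact: is_derive_flat_exp.
apply: alg1D; last by apply: alg1_base; exists n.+2.
by apply: alg1M; [exact: alg1_cst|apply: alg1_base; exists n.+1].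
Qed.

Lemma alg1_flat_exp_affine n (a b : R) :
  alg1 flat_family (fun x => flat_exp n (a * x + b)).
Proof.
by apply: alg1_comp; [apply: alg1_base; exists n|exact: alg1_affine].
Qed.

Lemma alg1_step_num : alg1 flat_family (fun x => flat_exp 0 (x - 2^-1)).
Proof.
by have := alg1_flat_exp_affine 0 1 (- 2^-1); under eq_fun do rewrite mul1r.
Qed.

Lemma alg1_step_den : alg1 flat_family step_den.
Proof.
apply: alg1D; first exact: alg1_step_num.
have := alg1_flat_exp_affine 0 (-1) 1.
by under eq_fun do rewrite mulN1r addrC.
Qed.

Lemma step_smooth : smooth1 step.
Proof.
(* The reciprocal of the denominator [d] is adjoined as one more generator; its derivative
   [- d' / d^2] stays in the generated class. *)
pose B := flat_family `|` [set fun x => (step_den x)^-1].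
have BS h : alg1 flat_family h -> alg1 B h by apply: alg1_mono => g; left.
apply: (@alg1_smooth _ B); last first.
  apply: alg1M; first exact: BS alg1_step_num.
  by apply: alg1_base; right.
move=> h [/flat_family_derive[h' dh ah]|->].
  by exists h' => //; exact: BS.
have [h' dh ah] := alg1_derive flat_family_derive alg1_step_den.
exists (fun x => (-1 * ((step_den x)^-1 * (step_den x)^-1)) * h' x).
  move=> x; apply: (is_derive_eq (is_deriveV _ (dh x))).
    by rewrite gt_eqF// step_den_gt0.
  by rewrite /GRing.scale /= -exprVn expr2 mulN1r.
have aV : alg1 B (fun x => (step_den x)^-1) by apply: alg1_base; right.
by apply: alg1M; [apply: alg1M; [exact: alg1_cst|exact: alg1M]|exact: BS].
Qed.

Lemma step_ge0 x : 0 <= step x.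
Proof. by rewrite mulr_ge0 ?flat_exp_ge0// invr_ge0 ltW// step_den_gt0. Qed.

Lemma step_le1 x : step x <= 1.
Proof.
rewrite /step ler_pdivrMr ?step_den_gt0// mul1r /step_den lerDl.
exact: flat_exp_ge0.
Qed.

Lemma step0 x : x <= 2^-1 -> step x = 0.
Proof. by move=> xh; rewrite /step flat_exp_le0 ?mul0r//; lra. Qed.

Lemma step1 x : 1 <= x -> step x = 1.
Proof.
move=> xh; rewrite /step /step_den [flat_exp 0 (1 - x)]flat_exp_le0 ?addr0; last lra.
by rewrite mulfV// gt_eqF// flat_exp_gt0; lra.
Qed.

Lemma derive1_step0 x : x < 2^-1 -> derive1 step x = 0.
Proof.
move=> xh; rewrite derive1E.
rewrite (near_eq_derive (g := cst 0)) ?derive_cst ?oner_neq0//.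
by near=> y; rewrite step0// ltW//; near: y; exact: lt_nbhsl.
Unshelve. all: by end_near. Qed.

Lemma derive1_step1 x : 1 < x -> derive1 step x = 0.
Proof.
move=> xh; rewrite derive1E.
rewrite (near_eq_derive (g := cst (1 : R))) ?derive_cst ?oner_neq0//.
by near=> y; rewrite step1// ltW//; near: y; exact: lt_nbhsr.
Unshelve. all: by end_near. Qed.

Lemma smooth1_continuous h : smooth1 h -> continuous h.
Proof.
move=> sh x; apply: differentiable_continuous; apply/derivable1_diffP.
exact: smooth1_derivable.
Qed.

Lemma derive1_step_bounded : exists2 C : R, 0 < C & forall x, `|derive1 step x| <= C.
Proof.
have cs : continuous (derive1 step).
  exact/smooth1_continuous/smooth1_derive1/step_smooth.
have [c _ cP] : exists2 c, c \in `[0, 2]%R & forall t, t \in `[0, 2]%R ->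
    `|derive1 step t| <= `|derive1 step c|.
  apply: (@EVT_max _ (fun x => `|derive1 step x|)) => //.
  apply: continuous_subspaceT => x; apply: continuous_comp; first exact: cs.
  exact: norm_continuous.
exists (`|derive1 step c| + 1); first by rewrite ltr_wpDl.
move=> x; have [x0|x0] := ltP x 0.
  by rewrite derive1_step0 ?normr0 ?addr_ge0//; lra.
have [x2|x2] := ltP 2 x.
  by rewrite derive1_step1 ?normr0 ?addr_ge0//; lra.
apply: (@le_trans _ _ `|derive1 step c|); last by rewrite lerDl.
by apply: cP; rewrite in_itv /= x0 x2.
Qed.

End SmoothStep.

(** * Partial derivatives of smooth functions on the plane *)

Section SmoothPlane.
Variable R : realType.
Implicit Types (f g phi psi : R * R -> R) (h : R -> R) (i : 'I_2) (x : R * R).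

Lemma smooth_differentiable f x : smooth f -> differentiable f x.
Proof. by move/(_ [::] x). Qed.

Lemma smooth_partial i f : smooth f -> smooth (partial i f).
Proof. by move=> sf s x; have := sf (rcons s i) x; rewrite -cats1 foldr_cat. Qed.

Lemma smooth_coind (C : set (R * R -> R)) :
  (forall f, C f -> (forall x, differentiable f x) /\ forall i, C (partial i f)) ->
  forall f, C f -> smooth f.
Proof.
move=> HC f Cf s x; suff : C (foldr (@partial R) f s) by move=> /HC[].
by elim: s => [//|i s ih] /=; have [_] := HC _ ih.
Qed.

Lemma partialD i f g x : differentiable f x -> differentiable g x ->
  partial i (fun x => f x + g x) x = partial i f x + partial i g x.
Proof. by move=> df dg; rewrite /partial deriveD//; exact: diff_derivable. Qed.

Lemma partialM i f g x : differentiable f x -> differentiable g x ->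
  partial i (fun x => f x * g x) x = f x * partial i g x + g x * partial i f x.
Proof. by move=> df dg; rewrite /partial deriveM//; exact: diff_derivable. Qed.

Lemma partial_comp i h f x : derivable h (f x) 1 -> differentiable f x ->
  partial i (fun x => h (f x)) x = derive1 h (f x) * partial i f x.
Proof.
move=> /derivable1_diffP dh df; rewrite /partial deriveE; last exact: differentiable_comp.
rewrite diff_comp//= [in RHS]deriveE// diff1E//=.
by rewrite mulrC.
Qed.

Lemma partial_cst i (c : R) x : partial i (fun=> c) x = 0.
Proof. exact: derive_cst. Qed.

Lemma linear_fst : linear (fst : R * R -> R). Proof. by []. Qed.
Lemma linear_snd : linear (snd : R * R -> R). Proof. by []. Qed.

HB.instance Definition _ := GRing.isLinear.Build R _ _ _ (fst : R * R -> R) linear_fst.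
HB.instance Definition _ := GRing.isLinear.Build R _ _ _ (snd : R * R -> R) linear_snd.

Lemma continuous_fst : continuous (fst : R * R -> R).
Proof. by move=> x; exact: cvg_fst. Qed.

Lemma continuous_snd : continuous (snd : R * R -> R).
Proof. by move=> x; exact: cvg_snd. Qed.

Lemma differentiable_fst x : differentiable (fst : R * R -> R) x.
Proof. by apply: linear_differentiable; exact: continuous_fst. Qed.

Lemma differentiable_snd x : differentiable (snd : R * R -> R) x.
Proof. by apply: linear_differentiable; exact: continuous_snd. Qed.

Lemma partial_fst i x : partial i (fst : R * R -> R) x = (axis i).1.
Proof.
rewrite /partial deriveE; last exact: differentiable_fst.
by rewrite diff_lin//; exact: continuous_fst.
Qed.

Lemma partial_snd i x : partial i (snd : R * R -> R) x = (axis i).2.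
Proof.
rewrite /partial deriveE; last exact: differentiable_snd.
by rewrite diff_lin//; exact: continuous_snd.
Qed.

(** The analogue of [alg1] on the plane. Smoothness and differentiability of an explicit function
    then reduce to a syntactic derivation. *)
Inductive alg2 : (R * R -> R) -> Prop :=
| alg2_base f : smooth f -> alg2 f
| alg2_cst c : alg2 (fun=> c)
| alg2_fst : alg2 fst
| alg2_snd : alg2 snd
| alg2D f g : alg2 f -> alg2 g -> alg2 (fun x => f x + g x)
| alg2M f g : alg2 f -> alg2 g -> alg2 (fun x => f x * g x)
| alg2_comp h f : smooth1 h -> alg2 f -> alg2 (fun x => h (f x)).

Lemma alg2_derive f : alg2 f ->
  (forall x, differentiable f x) /\ forall i, alg2 (partial i f).
Proof.
elim=> {f}[f sf|c|||f g af [df pf] ag [dg pg]|f g af [df pf] ag [dg pg]|h f sh af [df pf]].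
- by split=> [x|i]; [exact: smooth_differentiable|exact/alg2_base/smooth_partial].
- split=> [x|i]; first exact: differentiable_cst.
  rewrite (_ : partial _ _ = fun=> 0); first exact: alg2_cst.
  by apply/funext => x; rewrite partial_cst.
- split=> [x|i]; first exact: differentiable_fst.
  rewrite (_ : partial _ _ = fun=> (axis i).1); first exact: alg2_cst.
  by apply/funext => x; rewrite partial_fst.
- split=> [x|i]; first exact: differentiable_snd.
  rewrite (_ : partial _ _ = fun=> (axis i).2); first exact: alg2_cst.
  by apply/funext => x; rewrite partial_snd.
- split=> [x|i]; first exact: differentiableD.
  rewrite (_ : partial _ _ = fun x => partial i f x + partial i g x); first exact: alg2D.
  by apply/funext => x; rewrite partialD.
- split=> [x|i]; first exact: differentiableM.
  rewrite (_ : partial _ _ = fun x => f x * partial i g x + g x * partial i f x).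
    by apply: alg2D; exact: alg2M.
  by apply/funext => x; rewrite partialM.
- split=> [x|i].
    by apply: differentiable_comp => //; exact/derivable1_diffP/smooth1_derivable.
  rewrite (_ : partial _ _ = fun x => derive1 h (f x) * partial i f x).
    by apply: alg2M => //; apply: alg2_comp => //; exact: smooth1_derive1.
  by apply/funext => x; rewrite partial_comp//; exact: smooth1_derivable.
Qed.

Lemma alg2_smooth f : alg2 f -> smooth f.
Proof. by move: f; apply: smooth_coind; exact: alg2_derive. Qed.

Lemma smooth_continuous f : smooth f -> continuous f.
Proof. by move=> sf x; exact/differentiable_continuous/smooth_differentiable. Qed.

Lemma smooth_slice0 f (y : R) : smooth f ->
  forall t : R, is_derive t 1 (fun t => f (t, y)) (partial ord0 f (t, y)).
Proof.
move=> sf t; have E : (fun h : R => h^-1 *: (((fun t => f (t, y)) \o shift t) (h *: (1 : R)) - f (t, y))) =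
    (fun h : R => h^-1 *: ((f \o shift (t, y)) (h *: (axis ord0 : R * R)) - f (t, y))).
  apply/funext => h /=; congr (_ *: (f _ - _)).
  by rewrite /axis/=; apply/pair_equal_spec; split=> //=; rewrite scaler0 add0r.
have d2 : derivable f (t, y) (axis ord0).
  exact/diff_derivable/smooth_differentiable.
apply: DeriveDef; first by move: d2; rewrite /derivable -E.
by rewrite /partial /derive -E.
Qed.

Lemma smooth_slice1 f (y : R) : smooth f ->
  forall t : R, is_derive t 1 (fun t => f (y, t)) (partial (lift ord0 ord0) f (y, t)).
Proof.
move=> sf t; have E : (fun h : R => h^-1 *: (((fun t => f (y, t)) \o shift t) (h *: (1 : R)) - f (y, t))) =
    (fun h : R => h^-1 *: ((f \o shift (y, t)) (h *: (axis (lift ord0 ord0) : R * R)) - f (y, t))).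
  apply/funext => h /=; congr (_ *: (f _ - _)).
  by rewrite /axis/=; apply/pair_equal_spec; split=> //=; rewrite scaler0 add0r.
have d2 : derivable f (y, t) (axis (lift ord0 ord0)).
  exact/diff_derivable/smooth_differentiable.
apply: DeriveDef; first by move: d2; rewrite /derivable -E.
by rewrite /partial /derive -E.
Qed.

Lemma near0_partial i f x : (\forall y \near x, f y = 0) -> partial i f x = 0.
Proof.
move=> H; rewrite /partial (near_eq_derive (g := cst (0 : R))) ?derive_cst//.
Qed.

End SmoothPlane.

(** * The plane measure and test functions *)

Section PlaneMeasure.
Variable R : realType.
Implicit Types (f g : R * R -> R) (U : set (R * R)).
Local Notation leb := (@lebesgue_measure R).
Local Notation mu := (@plane_measure R).
Local Notation Rm := (measurableTypeR R).
Local Notation PT := (measurableTypeR R * measurableTypeR R)%type.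

Lemma near_ball (a w z : R) : z - w < a -> a < z -> ball a w z.
Proof. by move=> ? ?; rewrite /ball/= ltr_norml; apply/andP; split; lra. Qed.

(** The plane carries the product sigma-algebra, so an open set is written as a countable union of
    rational boxes contained in it. *)
Lemma open_measurable_plane U : open U -> @measurable _ PT U.
Proof.
move=> oU.
pose box (q r : rat) (n : nat) : set (R * R) :=
  ball (ratr q : R) n.+1%:R^-1 `*` ball (ratr r : R) n.+1%:R^-1.
pose F q r n := if `[< box q r n `<=` U >] then box q r n else set0.
have mF q r n : @measurable _ PT (F q r n).
  rewrite /F; case: asboolP => _; last exact: measurable0.
  by apply: (@measurableX _ _ Rm Rm); exact: measurable_ball.
suff -> : U = \bigcup_q \bigcup_r \bigcup_n F q r n.
  apply: bigcupT_measurable_rat => q; apply: bigcupT_measurable_rat => r.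
  exact: bigcupT_measurable.
apply/seteqP; split => [[x y] Uxy|x [q _ [r _ [n _]]]]; last first.
  by rewrite /F; case: asboolP => // bU /bU.
have /nbhs_ballP[e /= e0 eU] : nbhs (x, y) U by exact: open_nbhs_nbhs.
have [n ne] : exists n : nat, n.+1%:R^-1 < e / 2.
  have e2 : 0 < e / 2 by rewrite divr_gt0.
  have [n _ /(_ _ (leqnn n))] := near_infty_natSinv_lt (PosNum e2).
  by exists n.
have nn0 : 0 < n.+1%:R^-1 :> R by rewrite invr_gt0.
have ratb (z : R) : exists q : rat, ball (ratr q : R) n.+1%:R^-1 z.
  have zlt : z - n.+1%:R^-1 < z by rewrite ltrBlDr ltrDl.
  have [q] := rat_in_itvoo zlt; rewrite in_itv/= => /andP[q1 q2]; exists q.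
  exact: near_ball q1 q2.
have [q qx] := ratb x; have [r ry] := ratb y.
exists q => //; exists r => //; exists n => //; rewrite /F; case: asboolP => // nbU.
exfalso; apply: nbU => -[x' y'] [/= qx' ry']; apply: eU; split => /=.
  exact: (ball_splitr (le_ball (ltW ne) qx) (le_ball (ltW ne) qx')).
exact: (ball_splitr (le_ball (ltW ne) ry) (le_ball (ltW ne) ry')).
Qed.

Lemma continuous_measurable_plane f : continuous f -> @measurable_fun _ _ PT R setT f.
Proof.
move=> cf; apply: (measurability _ (RGenOpens.measurableE R)) => //.
move=> _ [_ [a [b ->]] <-]; rewrite setTI.
by apply: open_measurable_plane; move/continuousP : cf; apply; exact: interval_open.
Qed.

Definition I1 : set R := `]-1, 1[%classic.

Lemma OmegaE : @Omega R = I1 `*` I1.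
Proof.
apply/seteqP; split => -[x y] [] /=; rewrite /I1/= !in_itv/=; first by move=> -> ->.
by move=> ? ?; split.
Qed.

Lemma mI1 : @measurable _ Rm I1. Proof. exact: measurable_itv. Qed.

Lemma measurable_Omega : @measurable _ PT Omega.
Proof. by rewrite OmegaE; apply: (@measurableX _ _ Rm Rm); exact: mI1. Qed.

Lemma rect_measure (A B : set R) : @measurable _ Rm A -> @measurable _ Rm B ->
  mu (A `*` B) = (leb A * leb B)%E.
Proof. by move=> mA mB; have := @product_measure1E _ _ Rm Rm R leb leb A B mA mB; rewrite /plane_measure; move=> ->. Qed.

Lemma leb_I1 : leb I1 = 2%:E.
Proof. by rewrite lebesgue_measure_itv /= lte_fin ifT ?opprK//; lra. Qed.

Lemma measure_Omega : mu (@Omega R) = 4%:E.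
Proof.
rewrite OmegaE rect_measure; [|exact: mI1..].
by rewrite leb_I1 -EFinM; congr EFin; ring.
Qed.

Lemma finite_Omega : (mu (@Omega R) < +oo)%E.
Proof. by rewrite measure_Omega ltry. Qed.

(** The line in direction [i] with transversal coordinate [t], parametrized by [s]; both orders of
    integration become one statement. *)
Definition line (i : 'I_2) (t s : R) : R * R := if i == ord0 then (s, t) else (t, s).

Lemma measurable_line i t : @measurable_fun _ _ Rm PT setT (line i t).
Proof. by rewrite /line; case: (i == ord0); apply: measurable_fun_pair. Qed.

Lemma Omega_line i t s : Omega (line i t s) <-> I1 t /\ I1 s.
Proof.
rewrite /line OmegaE; case: (i == ord0) => /=; last by [].
by split => -[].
Qed.

Lemma measurable_slice i t f : @measurable_fun _ _ PT R Omega f -> I1 t ->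
  @measurable_fun _ _ Rm R I1 (fun s => f (line i t s)).
Proof.
move=> mf It; apply: (measurable_comp measurable_Omega _ mf).
  by move=> _ [s Is <-]; apply/Omega_line.
by apply: measurable_funTS; exact: measurable_line.
Qed.

(** By Fubini's theorem with direction [i] integrated first. All integrations by parts in the plane
    are reduced to lines in this way. *)
Lemma Rintegral_slice_eq i f g : rint mu Omega f -> rint mu Omega g ->
  (forall t, I1 t -> \int[leb]_(s in I1) (f (line i t s))%:E =
     \int[leb]_(s in I1) (g (line i t s))%:E)%E ->
  \int[mu]_(x in Omega) f x = \int[mu]_(x in Omega) g x.
Proof.
move=> fi gi fg; rewrite /Rintegral; congr fine.
rewrite [LHS]integral_mkcond [RHS]integral_mkcond.
have slice h t : (\int[leb]_s ((EFin \o h) \_ Omega) (line i t s) =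
    if pselect (I1 t) then \int[leb]_(s in I1) (h (line i t s))%:E else 0)%E.
  case: pselect => It.
    rewrite [RHS]integral_mkcond; apply: eq_integral => s _.
    rewrite /patch; case: ifPn => [|/negP sO].
      by rewrite inE => /Omega_line[_ Is]; rewrite mem_set.
    by rewrite ifF//; apply/negbTE/negP => /set_mem Is; apply/sO/mem_set/Omega_line.
  apply: integral0_eq => s _; rewrite /patch ifF//; apply/negbTE/negP => /set_mem.
  by move=> /Omega_line[].
have sE (h : R * R -> R) : rint mu Omega h ->
    (\int[mu]_z ((EFin \o h) \_ Omega) z =
    \int[leb]_t \int[leb]_s ((EFin \o h) \_ Omega) (line i t s))%E.
  move=> hi; have {}hi : mu.-integrable setT ((EFin \o h) \_ Omega).
    exact: (proj1 (integrable_mkcond _ measurable_Omega) hi).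
  rewrite /line; case: (i == ord0).
    by rewrite -(integral21_prod_meas1 hi).
  by rewrite -(integral12_prod_meas1 hi).
rewrite (_ : (fun x => (f x)%:E) = EFin \o f)// (_ : (fun x => (g x)%:E) = EFin \o g)//.
rewrite (sE _ fi) (sE _ gi); apply: eq_integral => t _; rewrite !slice.
by case: pselect => // It; rewrite fg.
Qed.

End PlaneMeasure.

(** * Test functions with compact support in the square *)

Section TestFunctions.
Variable R : realType.
Implicit Types (phi psi f g : R * R -> R) (K : set (R * R)) (i : 'I_2).
Local Notation leb := (@lebesgue_measure R).
Local Notation mu := (@plane_measure R).
Local Notation Rm := (measurableTypeR R).
Local Notation PT := (measurableTypeR R * measurableTypeR R)%type.
Local Notation Om := (@Omega R).
Local Notation I1 := (@I1 R).

(** An explicit compact set around the support makes it unnecessary to determine the support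
    itself. *)
Lemma Cc_of_compact phi K : smooth phi -> compact K -> K `<=` Omega ->
  (forall x, phi x != 0 -> K x) -> Cc_infty phi.
Proof.
move=> sphi cK KO phiK.
have clK : closed K by apply: compact_closed cK; exact: norm_hausdorff.
have sub : closure [set x | phi x != 0] `<=` K.
  by apply: (subset_trans (closureS phiK)); rewrite -(proj1 (closure_id _) clK).
split => //; last exact: subset_trans sub KO.
by apply: (subclosed_compact _ cK sub); exact: closed_closure.
Qed.

Lemma Cc_smooth phi : Cc_infty phi -> smooth phi. Proof. by case. Qed.

Lemma Cc_out phi x : Cc_infty phi -> ~ Omega x -> phi x = 0.
Proof.
move=> [_ _ sO] nOx; apply/eqP; apply: contrapT => /negP px; apply/nOx/sO.
exact: subset_closure.
Qed.

Lemma Cc0 : Cc_infty (fun=> 0 : R).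
Proof.
apply: (@Cc_of_compact _ set0) => //; first exact/alg2_smooth/alg2_cst.
  exact: compact0.
by move=> x; rewrite eqxx.
Qed.

Lemma Cc_partial i phi : Cc_infty phi -> Cc_infty (partial i phi).
Proof.
move=> [sphi cphi Ophi]; apply: (Cc_of_compact _ cphi Ophi); first exact: smooth_partial.
move=> x px; apply: contrapT => nx; move/negP: px; apply; apply/eqP/near0_partial.
have : nbhs x (~` closure [set x | phi x != 0]).
  by apply: open_nbhs_nbhs; split => //; apply: closed_openC; exact: closed_closure.
apply: filterS => y ny; apply/eqP; apply: contrapT => /negP py; apply: ny.
exact: subset_closure.
Qed.

Lemma CcM phi psi : Cc_infty phi -> smooth psi -> Cc_infty (fun x => phi x * psi x).
Proof.
move=> [sphi cphi Ophi] spsi; apply: (Cc_of_compact _ cphi Ophi).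
  by apply/alg2_smooth/alg2M; exact: alg2_base.
move=> x px; apply: subset_closure => /=; apply: contra_neq px => ->.
by rewrite mul0r.
Qed.

Lemma CcZ (c : R) phi : Cc_infty phi -> Cc_infty (fun x => c * phi x).
Proof.
move=> cphi; have := CcM cphi (alg2_smooth (alg2_cst c)).
by under eq_fun do rewrite mulrC.
Qed.

Lemma CcD phi psi : Cc_infty phi -> Cc_infty psi -> Cc_infty (fun x => phi x + psi x).
Proof.
move=> [sphi cphi Ophi] [spsi cpsi Opsi].
apply: (@Cc_of_compact _ (closure [set x | phi x != 0] `|` closure [set x | psi x != 0])).
- by apply/alg2_smooth/alg2D; exact: alg2_base.
- exact: compactU.
- by move=> x [/Ophi|/Opsi].
- move=> x px; have [p0|p0] := eqVneq (phi x) 0.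
    by right; apply: subset_closure => /=; apply: contra_neq px => ->; rewrite p0 addr0.
  by left; exact: subset_closure.
Qed.

Lemma Cc_bounded phi : Cc_infty phi -> exists C : R, forall x, `|phi x| <= C.
Proof.
move=> [sphi cphi Ophi].
have cim : compact (phi @` closure [set x | phi x != 0]).
  by apply: continuous_compact => //; apply: continuous_subspaceT; exact: smooth_continuous.
have [C [_ HC]] := compact_bounded cim.
exists (`|C| + 1) => x; have [->|p0] := eqVneq (phi x) 0.
  by rewrite normr0 addr_ge0.
apply: HC; first by rewrite (le_lt_trans (ler_norm C))// ltrDl.
by exists x => //; exact: subset_closure.
Qed.

Lemma smooth_measurable phi : smooth phi -> @measurable_fun _ _ PT R Om phi.
Proof.
move=> sphi; apply: measurable_funTS; apply: continuous_measurable_plane.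
exact: smooth_continuous.
Qed.

Lemma Cc_measurable phi : Cc_infty phi -> @measurable_fun _ _ PT R Om phi.
Proof. by move/Cc_smooth; exact: smooth_measurable. Qed.

Lemma Cc_sqint phi : Cc_infty phi -> sqint mu Om phi.
Proof.
move=> cphi; have [C HC] := Cc_bounded cphi.
apply: (sqint_bounded (@measurable_Omega R) (@finite_Omega R) (Cc_measurable cphi)).
by move=> x _; exact: HC.
Qed.

Lemma L2_sqintP f : L2_Omega f <-> sqint mu Om f.
Proof.
split=> [l2f|[mf fi]].
  have := Lfun2_integrable_sqr l2f; move: l2f; rewrite /L2_Omega/= inE => /andP[].
  rewrite inE/= => mf _ sf.
  split; first exact: (proj2 (measurable_restrictT f (@measurable_Omega R)) mf).
  apply/(integrable_mkcond _ (@measurable_Omega R)).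
  apply: eq_integrable sf => // x _ /=; rewrite /patch; case: ifP => //=.
  by rewrite expr0n.
rewrite /L2_Omega/= inE; apply/andP; split; rewrite inE/=.
  exact: (proj1 (measurable_restrictT f (@measurable_Omega R)) mf).
rewrite /finite_norm unlock /=.
apply: poweR_lty.
rewrite (_ : (fun x => _) = fun x => `|((fun x => (f x ^+ 2)%:E) \_ Om) x|%E).
  by have /(integrable_mkcond _ (@measurable_Omega R))/integrableP[] := fi.
apply/funext => x; rewrite /patch; case: ifP => _ /=.
  by rewrite powR_mulrn// normrX.
by rewrite (_ : point = 0 :> R)// normr0 powR0.
Qed.

End TestFunctions.

(** * Integration by parts on a line *)

Section LineIntegrals.
Variable R : realType.
Implicit Types (g : R -> R) (a b c t : R).
Local Notation leb := (@lebesgue_measure R).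
Local Notation Rm := (measurableTypeR R).
Local Notation I1 := (@I1 R).

Lemma Rintegral_boolM d (T : measurableType d) (m : {measure set T -> \bar R})
    (D : set T) (P : pred T) (f : T -> R) :
  \int[m]_(x in D) ((P x)%:R * f x) = \int[m]_(x in [set x | D x /\ P x]) f x.
Proof.
rewrite Rintegral_mkcond [RHS]Rintegral_mkcond; apply: eq_Rintegral => x _.
rewrite /patch; case: ifPn => [/set_mem Dx|/negP nDx].
  have [Px|nPx] := boolP (P x); first by rewrite mul1r mem_set.
  by rewrite mul0r ifF//; apply/negbTE/negP => /set_mem[]; rewrite (negbTE nPx).
by rewrite ifF//; apply/negbTE/negP => /set_mem[Dx _]; apply/nDx/mem_set.
Qed.

Definition C1 g := (forall t, derivable g t 1) /\ continuous (derive1 g).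

Lemma C1_continuous g : C1 g -> continuous g.
Proof.
by move=> [dg _] t; apply: differentiable_continuous; exact/derivable1_diffP.
Qed.

Lemma continuous_rint g a b : continuous g -> rint leb `]a, b[%classic g.
Proof.
move=> cg; apply: (@integrableS _ _ _ leb `[a, b]%classic) => //.
  by apply: subset_itvW.
apply: continuous_compact_integrable; first exact: segment_compact.
exact: continuous_subspaceT.
Qed.

Lemma FTC_open g a b : C1 g -> a <= b ->
  \int[leb]_(t in `]a, b[%classic) derive1 g t = g b - g a.
Proof.
move=> Cg; have [dg cg] := Cg; rewrite le_eqVlt => /predU1P[->|ab].
  by rewrite set_itvoo0 Rintegral_set0 subrr.
rewrite /Rintegral -(@integral_itv_bndoo _ a b _ true false); last first.
  by case/integrableP : (continuous_rint a b cg).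
have cs : {within `[a, b], continuous (derive1 g)} by exact: continuous_subspaceT.
have dl : derivable_oo_LRcontinuous g a b.
  split; first by move=> t _; exact: dg.
  - by apply: cvg_at_right_filter; exact: C1_continuous.
  - by apply: cvg_at_left_filter; exact: C1_continuous.
by rewrite (continuous_FTC2 ab cs dl (fun _ _ => erefl)).
Qed.

(** The fundamental theorem of calculus for [(t - a) * g t]. *)
Lemma FTC_ramp g a b : C1 g -> a <= b ->
  \int[leb]_(t in `]a, b[%classic) g t +
  \int[leb]_(t in `]a, b[%classic) ((t - a) * derive1 g t) = (b - a) * g b.
Proof.
move=> Cg ab; have [dg cg] := Cg; have cg0 := C1_continuous Cg.
pose G := fun t => (t - a) * g t.
have GE : derive1 G = fun t => g t + (t - a) * derive1 g t.
  apply/funext => t; rewrite derive1E.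
  have D1 : is_derive t 1 (fun t : R => t - a) 1.
    by apply: is_derive_eq; rewrite subr0.
  have D2 : is_derive t 1 g (derive1 g t).
    by apply: DeriveDef; [exact: dg|rewrite derive1E].
  have D := is_deriveM D1 D2.
  by rewrite (_ : G = (fun t : R => t - a) * g)// derive_val /GRing.scale /= addrC mulr1.
have cr : continuous (fun t => (t - a) * derive1 g t).
  move=> t; apply: cvgM; last exact: cg.
  by apply: cvgB; [exact: cvg_id|exact: cvg_cst].
have CG : C1 G.
  split => [t|].
    have -> : G = (fun t : R => t - a) * g by [].
    by apply: derivableM => //; apply: derivableB.
  by rewrite GE => t; apply: cvgD; [exact: cg0|exact: cr].
rewrite -RintD//; first last.
- exact: continuous_rint.
- exact: continuous_rint.
have := FTC_open CG ab; rewrite GE => ->.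
by rewrite /G subrr mul0r subr0.
Qed.

Definition ramp a b t : R := Num.min (Num.max (t - a) 0) (b - a).

Lemma ramp_ge0 a b t : a <= b -> 0 <= ramp a b t.
Proof. by move=> ab; rewrite /ramp le_min le_max lexx orbT subr_ge0. Qed.

Lemma ramp_le a b t : ramp a b t <= b - a.
Proof. by rewrite /ramp ge_min lexx orbT. Qed.

Lemma ramp_left a b t : a <= b -> t <= a -> ramp a b t = 0.
Proof.
move=> ab ta; rewrite /ramp (max_idPr _) ?subr_le0//.
by apply/min_idPl; rewrite subr_ge0.
Qed.

Lemma ramp_right a b t : a <= b -> b <= t -> ramp a b t = b - a.
Proof.
move=> ab bt; rewrite /ramp; apply/min_idPr; rewrite le_max; apply/orP; left.
by rewrite lerD2r.
Qed.

Lemma ramp_mid a b t : a <= t -> t <= b -> ramp a b t = t - a.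
Proof.
move=> at_ tb; rewrite /ramp (max_idPl _) ?subr_ge0//.
by apply/min_idPl; rewrite lerD2r.
Qed.

Lemma continuous_ramp a b : continuous (ramp a b).
Proof.
move=> t; apply: (@continuous_min _ _ (fun t => Num.max (t - a) 0) (cst (b - a))).
  apply: (@continuous_max _ _ (fun t => t - a) (cst 0)); last exact: cvg_cst.
  by apply: cvgB; [exact: cvg_id|exact: cvg_cst].
exact: cvg_cst.
Qed.

(* [ramp a b] is a primitive of the indicator of [a, b]. *)
Lemma line_ramp g a b c : C1 g -> (forall t, ~ I1 t -> g t = 0) ->
  -1 <= a -> a <= b -> -1 < b -> b <= 1 ->
  \int[leb]_(t in I1) ((a < t < b)%R%:R * g t) =
  \int[leb]_(t in I1) ((c - ramp a b t) * derive1 g t).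
Proof.
move=> Cg g0 a1 ab b_1 b1; have [dg cg] := Cg; have cg0 := C1_continuous Cg.
have g1 : g 1 = 0 by apply: g0; rewrite /I1/= in_itv/= ltxx andbF.
have gN1 : g (-1) = 0 by apply: g0; rewrite /I1/= in_itv/= ltxx.
have mI : @measurable _ Rm I1 by exact: mI1.
have I : forall x y h, continuous h -> rint leb `]x, y[%classic h.
  by move=> x y h; exact: continuous_rint.
have cH : continuous (fun t => ramp a b t * derive1 g t).
  by move=> t; apply: cvgM; [exact: continuous_ramp|exact: cg].
(* The constant [c] contributes [c * (g 1 - g (-1)) = 0]. It is left free so that the weight
   [c - ramp a b] can be made to vanish on either side of the interval. *)
have E1 : \int[leb]_(t in I1) ((c - ramp a b t) * derive1 g t) =
    - \int[leb]_(t in I1) (ramp a b t * derive1 g t).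
  under eq_Rintegral do rewrite mulrBl.
  rewrite RintB//; first last.
  - exact: I.
  - by apply: rintZ => //; exact: I.
  rewrite RintZ//; last exact: I.
  rewrite FTC_open// ?g1 ?gN1 ?subrr ?mulr0 ?sub0r//; lra.
have mP (P : pred R) : @measurable _ Rm [set t | I1 t /\ P t] ->
    @measurable_fun _ _ Rm R I1 (fun t => (P t)%:R).
  move=> mP; pose A : set Rm := [set t | I1 t /\ P t].
  have mA : @measurable_fun _ _ Rm R I1 (\1_A : Rm -> R) by exact: measurable_indic.
  apply: eq_measurable_fun mA => t /set_mem It; rewrite indicE; congr (nat_of_bool _)%:R.
  by apply/idP/idP => [/set_mem[]//|Pt]; exact: mem_set.
have abE : [set t | I1 t /\ a < t < b] = `]a, b[%classic.
  apply/seteqP; split => t /=; rewrite /I1/= !in_itv/=; first by case.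
  by move=> /andP[at_ tb]; split; apply/andP; split; lra.
have b1E : [set t | I1 t /\ b <= t] = `[b, 1[%classic.
  apply/seteqP; split => t /=; rewrite /I1/= !in_itv/=.
    by move=> [/andP[_ ->] ->].
  by move=> /andP[bt t1]; split => //; apply/andP; split; lra.
have mab : @measurable_fun _ _ Rm R I1 (fun t => (a < t < b)%R%:R).
  by apply: (mP (fun t => a < t < b)); rewrite abE; exact: measurable_itv.
have mb1 : @measurable_fun _ _ Rm R I1 (fun t => (b <= t)%R%:R).
  by apply: (mP (fun t => b <= t)); rewrite b1E; exact: measurable_itv.
have bool1 (P : bool) : `|P%:R| <= 1 :> R by case: P; rewrite ?normr1 ?normr0.
have cr : continuous (fun t => (t - a) * derive1 g t).
  move=> t; apply: cvgM; last exact: cg.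
  by apply: cvgB; [exact: cvg_id|exact: cvg_cst].
(* The ramp is [t - a] on the interval and the constant [b - a] to its right, where [derive1 g]
   integrates to [- g b]. *)
rewrite E1 (_ : \int[leb]_(t in I1) (ramp a b t * derive1 g t) =
   \int[leb]_(t in I1) ((a < t < b)%R%:R * ((t - a) * derive1 g t)) +
   (b - a) * \int[leb]_(t in I1) ((b <= t)%R%:R * derive1 g t)); last first.
  have i1 : rint leb I1 (fun t => (b <= t)%R%:R * derive1 g t).
    exact: (rint_bM mI mb1 (fun t _ => bool1 _) (I _ _ _ cg)).
  have i2 : rint leb I1 (fun t => (a < t < b)%R%:R * ((t - a) * derive1 g t)).
    exact: (rint_bM mI mab (fun t _ => bool1 _) (I _ _ _ cr)).
  rewrite -RintZ// -RintD//; last exact: rintZ.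
  apply: eq_Rintegral => t _.
  have [ta|at_] := leP t a.
    rewrite ramp_left//= !mul0r add0r.
    have [tb|bt] := ltP t b; first by rewrite !mul0r mulr0.
    by rewrite mul1r (_ : b - a = 0) ?mul0r//; lra.
  have [tb|bt] := ltP t b.
    by rewrite ramp_mid ?ltW//= mul1r mul0r mulr0 addr0.
  by rewrite ramp_right//= mul0r add0r mul1r.
rewrite !(Rintegral_boolM leb I1 (fun t => a < t < b)).
rewrite (Rintegral_boolM leb I1 (fun t => b <= t)) abE b1E.
rewrite -Rintegral_itv_obnd_cbnd ?FTC_open//; last exact: I.
have := FTC_ramp Cg ab; rewrite g1.
by set x := \int[leb]_(_ in _) _; set y := \int[leb]_(_ in _) _; lra.
Qed.

End LineIntegrals.

(** * Weak derivatives *)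

Section VanishingIntegrals.
Context d (T : measurableType d) (R : realType) (m : {measure set T -> \bar R}).

(** The sets with vanishing integral form a Dynkin system; the hypothesis on all of [D] gives
    complements. The map [h] allows the argument to be run on one coordinate at a time. *)
Lemma dynkin_integral0 d' (T' : measurableType d') (h : T -> T') (G : set (set T'))
    (D : set T) (g : T -> R) :
  measurable D -> rint m D g -> measurable_fun setT h ->
  @measurable _ T' = <<s G >> -> setI_closed G ->
  (\int[m]_(x in D) (g x)%:E = 0)%E ->
  (forall A, G A -> \int[m]_(x in D `&` h @^-1` A) (g x)%:E = 0)%E ->
  forall A, measurable A -> (\int[m]_(x in D `&` h @^-1` A) (g x)%:E = 0)%E.
Proof.
move=> mD gi mh GE GI g0 gG A mA.
have mhA B : measurable B -> measurable (D `&` h @^-1` B).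
  move=> mB; apply: measurableI => //; rewrite -[_ @^-1` _]setTI; exact: mh.
pose P B := (\int[m]_(x in D `&` h @^-1` B) (g x)%:E = 0)%E.
apply: (@dynkin_induction _ T' G P) => //; last by rewrite -GE.
- by rewrite /P preimage_setT setIT.
- move=> S mS PS; rewrite /P.
  have DE : D = (D `&` h @^-1` S) `|` (D `&` h @^-1` (~` S)).
    by rewrite -setIUr -preimage_setU setUv preimage_setT setIT.
  have := g0; rewrite {1}DE integral_setU; first by rewrite [X in (X + _)%E]PS add0e.
  + exact: mhA.
  + exact/mhA/measurableC.
  + by rewrite -DE; case/integrableP : gi.
  + apply/disj_setPS => x [[_ Sx] [_ nSx]]; exact: nSx.
- move=> F mF tF PF; rewrite /P preimage_bigcup setI_bigcupr.
  rewrite integral_bigcup.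
  + by apply: eseries0 => n _ _; exact: PF.
  + apply/trivIsetP => i j _ _ ij; rewrite setIACA setIid -preimage_setI.
    by move/trivIsetP : tF => ->//; rewrite preimage_set0 setI0.
  + by move=> k; exact: mhA.
  + apply: (integrableS mD) => //; last by move=> x [k _ []].
    by apply: bigcup_measurable => k _; exact: mhA.
Qed.

End VanishingIntegrals.

Section WeakDerivatives.
Variable R : realType.
Implicit Types (phi psi f g u v : R * R -> R) (i : 'I_2).
Local Notation leb := (@lebesgue_measure R).
Local Notation mu := (@plane_measure R).
Local Notation Rm := (measurableTypeR R).
Local Notation PT := (measurableTypeR R * measurableTypeR R)%type.
Local Notation Om := (@Omega R).
Local Notation I1 := (@I1 R).
Local Notation mO := (@measurable_Omega R).
Local Notation fO := (@finite_Omega R).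

Lemma is_derive_line i phi t : smooth phi ->
  forall s : R, is_derive s 1 (fun s => phi (line i t s)) (partial i phi (line i t s)).
Proof.
move=> sphi s; rewrite /line; have [->|i0] := eqVneq i ord0; first exact: smooth_slice0.
have -> : i = lift ord0 ord0.
  by apply/val_inj; case: i i0 => -[|[|//]] //= ? /negP[]; exact/eqP/val_inj.
exact: smooth_slice1.
Qed.

Lemma derive1_line i phi t : smooth phi ->
  derive1 (fun s => phi (line i t s)) = fun s => partial i phi (line i t s).
Proof.
by move=> sphi; apply: derive1_of_is_derive => s; exact: is_derive_line.
Qed.

Lemma continuous_line i (t : R) : continuous (line i t).
Proof.
rewrite /line; case: (i == ord0) => s; apply: differentiable_continuous.
  by apply: differentiable_pair; [exact/derivable1_diffP/derivable_id|exact: differentiable_cst].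
by apply: differentiable_pair; [exact: differentiable_cst|exact/derivable1_diffP/derivable_id].
Qed.

Lemma C1_line i phi t : smooth phi -> C1 (fun s => phi (line i t s)).
Proof.
move=> sphi; split => [s|]; first by have [] := is_derive_line i t sphi s.
rewrite derive1_line// => s.
apply: (@continuous_comp _ _ _ (line i t) (partial i phi)); first exact: continuous_line.
exact/smooth_continuous/smooth_partial.
Qed.

Lemma Cc_line_out i phi t s : Cc_infty phi -> ~ I1 s -> phi (line i t s) = 0.
Proof. by move=> cphi nIs; apply: Cc_out => // /Omega_line[]. Qed.

Lemma Cc_int_partial i phi : Cc_infty phi ->
  \int[mu]_(x in Om) partial i phi x = 0.
Proof.
move=> cphi; have sphi := Cc_smooth cphi.
have -> : 0 = \int[mu]_(x in Om) (0 : R).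
  by rewrite /Rintegral integral0.
apply: (@Rintegral_slice_eq _ i).
- exact/(sqint_rint mO fO)/Cc_sqint/Cc_partial.
- exact: (rint_cst mO fO).
move=> t It; rewrite integral0.
have CL := C1_line i t sphi.
have := FTC_open CL (_ : -1 <= 1); rewrite !(Cc_line_out _ _ cphi); first last.
- by rewrite /I1/= in_itv/= ltxx andbF.
- by rewrite /I1/= in_itv/= ltxx.
rewrite subrr derive1_line// => H.
have ri := continuous_rint (-1) 1 (proj2 CL); rewrite derive1_line// in ri.
by rewrite (rint_fin (@mI1 R) ri) H//; lra.
Qed.

Lemma Cc_weak_partial i phi : Cc_infty phi -> is_weak_partial i phi (partial i phi).
Proof.
move=> cphi psi cpsi; have sphi := Cc_smooth cphi; have spsi := Cc_smooth cpsi.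
have := Cc_int_partial i (CcM cphi spsi).
rewrite (@eq_Rintegral _ _ _ mu Om (fun x => phi x * partial i psi x + psi x * partial i phi x)); last first.
  by move=> x _; rewrite partialM//; exact: smooth_differentiable.
rewrite (RintD mO); first last.
- exact: (sqintM mO (Cc_sqint cpsi) (Cc_sqint (Cc_partial i cphi))).
- exact: (sqintM mO (Cc_sqint cphi) (Cc_sqint (Cc_partial i cpsi))).
move/eqP; rewrite addr_eq0 => /eqP ->; congr (- _).
by apply: eq_Rintegral => x _; rewrite mulrC.
Qed.

(** Lifts an integration by parts against discontinuous weights from lines to the plane. The weights
    only have to be bounded and measurable. *)
Lemma slice_identity i (k H : R * R -> R) (C : R) phi :
  @measurable_fun _ _ PT R Om k -> @measurable_fun _ _ PT R Om H ->
  (forall x, Om x -> `|k x| <= C) -> (forall x, Om x -> `|H x| <= C) ->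
  (forall t, I1 t -> forall g : R -> R, C1 g -> (forall s, ~ I1 s -> g s = 0) ->
    \int[leb]_(s in I1) (k (line i t s) * g s) =
    \int[leb]_(s in I1) (H (line i t s) * derive1 g s)) ->
  Cc_infty phi ->
  \int[mu]_(x in Om) (k x * phi x) = \int[mu]_(x in Om) (H x * partial i phi x).
Proof.
move=> mk mH kC HC line_id cphi; have sphi := Cc_smooth cphi.
have mI := @mI1 R.
apply: (@Rintegral_slice_eq _ i).
- by apply: (rint_bM mO mk kC); apply: (sqint_rint mO fO); exact: Cc_sqint.
- by apply: (rint_bM mO mH HC); apply: (sqint_rint mO fO); exact/Cc_sqint/Cc_partial.
move=> t It; have CL := C1_line i t sphi.
have rL := continuous_rint (-1) 1 (C1_continuous CL).
have rD := continuous_rint (-1) 1 (proj2 CL).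
have bL (f : R * R -> R) : (forall x, Om x -> `|f x| <= C) ->
    forall s, I1 s -> `|f (line i t s)| <= C.
  by move=> fC s Is; apply: fC; exact/Omega_line.
rewrite (rint_fin mI (rint_bM mI (measurable_slice i mk It) (bL _ kC) rL)).
rewrite (line_id t It _ CL); last by move=> s; exact: Cc_line_out.
rewrite -(rint_fin mI (rint_bM mI (measurable_slice i mH It) (bL _ HC) rD)).
by rewrite derive1_line.
Qed.

End WeakDerivatives.

Lemma measurable_fun_boolR d (T : measurableType d) (R : realType) (D : set T)
    (P : pred T) : measurable D -> measurable [set x | P x] ->
  measurable_fun D (fun x => (P x)%:R : R).
Proof.
move=> mD mP.
have mA : measurable_fun D (\1_[set x | P x] : T -> R) by exact: measurable_indic.
apply: eq_measurable_fun mA => t _; rewrite indicE; congr (nat_of_bool _)%:R.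
by apply/idP/idP => [/set_mem//|Pt]; exact: mem_set.
Qed.

(** * The fundamental lemma and uniqueness of weak derivatives *)

Section FundamentalLemma.
Variable R : realType.
Implicit Types (phi psi f g u v : R * R -> R) (i : 'I_2).
Local Notation mu := (@plane_measure R).
Local Notation Rm := (measurableTypeR R).
Local Notation PT := (measurableTypeR R * measurableTypeR R)%type.
Local Notation Om := (@Omega R).
Local Notation I1 := (@I1 R).
Local Notation mO := (@measurable_Omega R).
Local Notation fO := (@finite_Omega R).

(** A smooth approximation of the indicator of []p, 1[] from inside; at every point [x < 1] it
    equals the indicator for all large [n]. *)
Definition ray_cut (n : nat) (p : R) (x : R) : R :=
  step (n%:R * (x + - p)) * step (n%:R * (1 + (-1) * x)).

Lemma ray_cut_ge0 n p x : 0 <= ray_cut n p x.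
Proof. by rewrite mulr_ge0 ?step_ge0. Qed.

Lemma ray_cut_le1 n p x : ray_cut n p x <= 1.
Proof. by rewrite mulr_ile1 ?step_ge0 ?step_le1. Qed.

(** The margin uses [n.+1] in order to be a positive number also for [n = 0], where the cutoff is
    identically 0. *)
Lemma ray_cut_out n p x : ray_cut n p x != 0 ->
  p + (2 * n.+1%:R)^-1 <= x <= 1 - (2 * n.+1%:R)^-1.
Proof.
have n1 : 0 < n.+1%:R :> R by rewrite ltr0n.
have nn : n%:R < n.+1%:R :> R by rewrite ltr_nat.
have n0 : 0 <= n%:R :> R by rewrite ler0n.
have key (t : R) : step (n%:R * t) != 0 -> (2 * n.+1%:R)^-1 <= t.
  move=> st; have h : 2^-1 < n%:R * t.
    by rewrite ltNge; apply/negP => h; move: st; rewrite step0// eqxx.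
  have t0 : 0 < t by rewrite ltNge; apply/negP => t0; nra.
  rewrite invfM ler_pdivrMr// mulrC; nra.
rewrite /ray_cut mulf_eq0 negb_or => /andP[/key + /key].
move: (_^-1) => d h1 h2; by apply/andP; split; lra.
Qed.

Lemma ray_cut_cvg (p x : R) : x < 1 ->
  \forall n \near \oo, ray_cut n p x = (p < x)%R%:R.
Proof.
move=> x1; have [px|xp] := ltP p x; last first.
  apply: nearW => n; rewrite /ray_cut step0 ?mul0r//.
  have : n%:R * (x + - p) <= 0 by rewrite mulr_ge0_le0 ?ler0n//; lra.
  lra.
have key (t : R) : 0 < t -> \forall n \near \oo, step (n%:R * t) = 1.
  move=> t0; near=> n; rewrite step1// -ler_pdivrMr// mul1r.
  by near: n; exact: nbhs_infty_ger.
near=> n; rewrite /ray_cut.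
have -> : step (n%:R * (x + - p)) = 1 by near: n; apply: key; lra.
have -> : step (n%:R * (1 + -1 * x)) = 1 by near: n; apply: key; lra.
by rewrite mulr1.
Unshelve. all: by end_near. Qed.

Lemma smooth_ray_cut n p :
  smooth (fun x : R * R => ray_cut n p x.1) /\ smooth (fun x : R * R => ray_cut n p x.2).
Proof.
split; apply: alg2_smooth; rewrite /ray_cut; apply: alg2M;
  (apply: alg2_comp; [exact: step_smooth|]); apply: alg2M;
  repeat first [exact: alg2_cst|exact: alg2_fst|exact: alg2_snd|apply: alg2D|apply: alg2M].
Qed.

Lemma Cc_ray_cut n p q : -1 <= p -> -1 <= q ->
  Cc_infty (fun x : R * R => ray_cut n p x.1 * ray_cut n q x.2).
Proof.
move=> p1 q1; pose d : R := (2 * n.+1%:R)^-1.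
have d0 : 0 < d by rewrite invr_gt0 mulr_gt0.
apply: (@Cc_of_compact _ _ (`[p + d, 1 - d]%classic `*` `[q + d, 1 - d]%classic)).
- by apply/alg2_smooth/alg2M; apply: alg2_base; have [] := smooth_ray_cut n p;
    have [] := smooth_ray_cut n q.
- by apply: compact_setX; exact: segment_compact.
- move=> [x y] /= [/=]; rewrite !in_itv/= => /andP[x1 x2] /andP[y1 y2].
  by split; apply/andP; split => /=; lra.
- move=> [x y] /=; rewrite mulf_eq0 negb_or => /andP[/ray_cut_out hx /ray_cut_out hy].
  by split; rewrite /= in_itv.
Qed.

Lemma measurable_gt_fst (p : R) : @measurable _ PT [set x | p < x.1].
Proof.
have -> : [set x : PT | p < x.1] = `]p, +oo[%classic `*` setT.
  by apply/seteqP; split => -[x y] /=; rewrite in_itv/= andbT // => -[].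
by apply: (@measurableX _ _ Rm Rm) => //; exact: measurable_itv.
Qed.

Lemma measurable_gt_snd (p : R) : @measurable _ PT [set x | p < x.2].
Proof.
have -> : [set x : PT | p < x.2] = setT `*` `]p, +oo[%classic.
  by apply/seteqP; split => -[x y] /=; rewrite in_itv/= andbT // => -[].
by apply: (@measurableX _ _ Rm Rm) => //; exact: measurable_itv.
Qed.

(** Products of the cutoffs are test functions, and dominated convergence carries their integrals to
    a quadrant. Quadrants are stable under intersection and generate the measurable sets. *)
Lemma ray_integral0 g : sqint mu Om g ->
  (forall phi, Cc_infty phi -> \int[mu]_(x in Om) (g x * phi x) = 0) ->
  forall p q : R, -1 <= p -> -1 <= q ->
  (\int[mu]_(x in Om `&` [set x : R * R | (p < x.1)%R /\ (q < x.2)%R]) (g x)%:E = 0)%E.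
Proof.
move=> sg g0 p q p1 q1.
have gi := sqint_rint mO fO sg; have mg : @measurable_fun _ _ PT R Om g by case: sg.
pose F n (x : PT) := (g x * (ray_cut n p x.1 * ray_cut n q x.2))%:E.
pose h (x : PT) := ((g x)%:E * ((p < x.1)%R%:R * (q < x.2)%R%:R)%:E)%E.
have mF n : measurable_fun Om (F n).
  apply/measurable_EFinP; exact: (measurable_funM mg (Cc_measurable (Cc_ray_cut n p1 q1))).
have Fh : {ae mu, forall x, Om x -> F ^~ x @ \oo --> h x}.
  apply: aeW => x [/andP[_ x1] /andP[_ y1]].
  apply: cvg_near_cst; near=> n; rewrite /F /h -EFinM.
  have -> : ray_cut n p x.1 = (p < x.1)%R%:R by near: n; exact: ray_cut_cvg.
  by have -> : ray_cut n q x.2 = (q < x.2)%R%:R by near: n; exact: ray_cut_cvg.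
have mh : measurable_fun Om h.
  have m1 : @measurable_fun _ _ PT R Om (fun x => (p < x.1)%R%:R).
    apply: measurable_fun_boolR => //; first exact: mO.
    exact: measurable_gt_fst.
  have m2 : @measurable_fun _ _ PT R Om (fun x => (q < x.2)%R%:R).
    apply: measurable_fun_boolR => //; first exact: mO.
    exact: measurable_gt_snd.
  apply/measurable_EFinP; exact: (measurable_funM mg (measurable_funM m1 m2)).
pose ng (x : PT) : R := `|g x|.
have dom : {ae mu, forall x n, Om x -> (`|F n x| <= (EFin \o ng) x)%E}.
  apply: aeW => x n _; rewrite /F lee_fin/= normrM ler_piMr// ger0_norm.
    by rewrite mulr_ile1 ?ray_cut_ge0 ?ray_cut_le1.
  by rewrite mulr_ge0 ?ray_cut_ge0.
have [_ _ C] := @dominated_convergence _ _ _ mu Om mO F h _ mF mh Fh (integrable_norm gi) dom.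
have F0 n : (\int[mu]_(x in Om) F n x = 0)%E.
  rewrite /F (rint_fin mO); first by rewrite g0//; exact: Cc_ray_cut.
  by apply: (sqintM mO sg); exact/Cc_sqint/Cc_ray_cut.
have h0 : (\int[mu]_(x in Om) h x = 0)%E.
  rewrite -(cvg_lim _ C)//= (_ : (fun n => _) = fun=> 0%E) ?lim_cst//.
  exact/funext.
rewrite -[RHS]h0 [LHS]integral_mkcond [RHS]integral_mkcond; apply: eq_integral => x _.
rewrite /patch in_setI; case: ifPn => [/andP[-> /set_mem/=[px qx]]|].
  by rewrite /h px qx/= !mul1r mule1.
case: ifPn => //= _ /negP nx; rewrite /h.
have [px|px] := ltP p x.1; last by rewrite mul0r mule0.
have [qx|qx] := ltP q x.2; last by rewrite mulr0 mule0.
by exfalso; apply: nx; rewrite inE.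
Unshelve. all: by end_near. Qed.

(** No mollification is used: from quadrants, Dynkin's argument leads to vanishing integrals over
    all measurable subsets of [Omega]. *)
Lemma fundamental_lemma g : sqint mu Om g ->
  (forall phi, Cc_infty phi -> \int[mu]_(x in Om) (g x * phi x) = 0) ->
  ae_eq mu Om g (fun=> 0).
Proof.
move=> sg g0; have gi := sqint_rint mO fO sg.
have ray p q : (\int[mu]_(x in Om `&` [set x : R * R | (p < x.1)%R /\ (q < x.2)%R]) (g x)%:E = 0)%E.
  (* Raising [p] and [q] to at least [-1] does not change the part of the quadrant in [Omega]. *)
  rewrite -(ray_integral0 sg g0 (p := Num.max p (-1)) (q := Num.max q (-1))); last 2 first.
  - by rewrite le_max lexx orbT.
  - by rewrite le_max lexx orbT.
  congr (integral _ _ _); apply/seteqP; split => x [Ox [px qx]]; split => //; split => /=.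
  - by rewrite gt_max px; case: Ox => /andP[->].
  - by rewrite gt_max qx; case: Ox => _ /andP[->].
  - by move: px; rewrite gt_max => /andP[].
  - by move: qx; rewrite gt_max => /andP[].
have mfst : @measurable_fun _ _ PT Rm setT fst by exact: measurable_fst.
have msnd : @measurable_fun _ _ PT Rm setT snd by exact: measurable_snd.
have rayI : setI_closed (@RGenOInfty.G R).
  move=> _ _ [x ->] [y ->]; exists (Num.max x y).
  apply/seteqP; split => z /=; rewrite !in_itv/= !andbT gt_max.
    by move=> [-> ->].
  by move=> /andP[].
have all0 : (\int[mu]_(x in Om) (g x)%:E = 0)%E.
  rewrite -(ray (-1) (-1)); congr (integral _ _ _).
  apply/seteqP; split => [x Ox|x []//]; split => //.
  by case: Ox => /andP[? _] /andP[? _].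
pose half q : set PT := Om `&` [set x : R * R | (q < x.2)%R].
have mhalf q : @measurable _ PT (half q).
  apply: measurableI; first exact: mO.
  exact: measurable_gt_snd.
(* Rays are replaced by measurable sets in one factor at a time, the other factor being absorbed
   into the domain of integration. *)
have S1 q (A : set Rm) : measurable A ->
    (\int[mu]_(x in half q `&` fst @^-1` A) (g x)%:E = 0)%E.
  apply: (dynkin_integral0 _ _ mfst (RGenOInfty.measurableE R) rayI).
  - exact: mhalf.
  - by apply: (integrableS mO) => // x [].
  - rewrite -(ray (-1) q); congr (integral _ _ _).
    apply/seteqP; split => [x [Ox qx]|x [Ox [_ qx]]]; split => //.
    by split => //; case: Ox => /andP[].
  - move=> _ [p ->]; rewrite -(ray p q); congr (integral _ _ _).
    apply/seteqP; split => [x [[Ox qx]] /=|x [Ox [px qx]]].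
      by rewrite in_itv/= andbT.
    by split => //=; rewrite in_itv/= andbT.
pose vert (A : set Rm) : set PT := Om `&` fst @^-1` A.
have mvert A : measurable A -> @measurable _ PT (vert A).
  by move=> mA; apply: measurableI; [exact: mO|rewrite -[X in measurable X]setTI; exact: mfst].
have S2 (A B : set Rm) : measurable A -> measurable B ->
    (\int[mu]_(x in vert A `&` snd @^-1` B) (g x)%:E = 0)%E.
  move=> mA; apply: (dynkin_integral0 _ _ msnd (RGenOInfty.measurableE R) rayI).
  - exact: mvert.
  - by apply: (integrableS mO) => //; [exact: mvert|move=> x []].
  - rewrite -(S1 (-1) A mA); congr (integral _ _ _).
    apply/seteqP; split => [x [Ox Ax]|x [[Ox _] Ax]]; split => //; split => //.
    by case: Ox => _ /andP[].
  - move=> _ [q ->]; rewrite -(S1 q A mA); congr (integral _ _ _).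
    apply/seteqP; split => [x [[Ox Ax]] /=|x [[Ox qx] Ax]].
      by rewrite in_itv/= andbT.
    by split => //=; rewrite in_itv/= andbT.
have S3 (E : set PT) : measurable E -> (\int[mu]_(x in Om `&` E) (g x)%:E = 0)%E.
  have mid : @measurable_fun _ _ PT PT setT id by exact: measurable_id.
  apply: (dynkin_integral0 mO gi mid (@measurable_prod_measurableType _ _ Rm Rm) _ all0).
    move=> _ _ [A mA [B mB <-]] [A' mA' [B' mB' <-]].
    by rewrite -setXI; exists (A `&` A'); [exact: measurableI|
      exists (B `&` B') => //; exact: measurableI].
  move=> _ [A mA [B mB <-]]; rewrite -(S2 A B mA mB); congr (integral _ _ _).
  by apply/seteqP; split => [x [Ox [Ax Bx]]|x [[Ox Ax] Bx]].
have := @integral_ae_eq _ _ _ mu Om mO (cst 0%E) (EFin \o g) gi (@measurable_cst _ _ _ _ _ _).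
have E0 E : E `<=` Om -> @measurable _ PT E ->
    (\int[mu]_(x in E) (EFin \o g) x = \int[mu]_(x in E) (cst 0) x)%E.
  move=> EO mE; rewrite integral0; have := S3 _ mE.
  by rewrite (setIidr EO).
move=> /(_ E0); apply: filterS => x H Ox.
by have := H Ox; case.
Qed.

Lemma weak_partial_unique i u g h : L2_Omega g -> L2_Omega h ->
  is_weak_partial i u g -> is_weak_partial i u h -> ae_eq mu Om g h.
Proof.
move=> /L2_sqintP sg /L2_sqintP sh wg wh.
have : ae_eq mu Om (fun x => g x - h x) (fun=> 0).
  apply: fundamental_lemma; first exact: (sqintB mO).
  move=> phi cphi; have := wg _ cphi; rewrite wh// => /oppr_inj/esym H.
  rewrite (@eq_Rintegral _ _ _ mu Om (fun x => g x * phi x - h x * phi x)); last first.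
    by move=> x _; rewrite mulrBl.
  rewrite (RintB mO) ?H ?subrr//.
    exact: (sqintM mO sg (Cc_sqint cphi)).
  exact: (sqintM mO sh (Cc_sqint cphi)).
by apply: filterS => x H Ox; apply/eqP; rewrite -subr_eq0 H.
Qed.

Lemma wpartialP i u : (exists2 g, L2_Omega g & is_weak_partial i u g) ->
  L2_Omega (wpartial i u) /\ is_weak_partial i u (wpartial i u).
Proof.
move=> [g lg wg].
by have := @xgetPex _ (cst 0) [set g | L2_Omega g /\ is_weak_partial i u g]; apply; exists g.
Qed.

Lemma wpartial_ae i u g : L2_Omega g -> is_weak_partial i u g ->
  ae_eq mu Om (wpartial i u) g.
Proof.
move=> lg wg; have [l w] : L2_Omega (wpartial i u) /\ is_weak_partial i u (wpartial i u).
  by apply: wpartialP; exists g.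
exact: (weak_partial_unique l lg w wg).
Qed.

End FundamentalLemma.

(** * The spaces H^1 and H^1_0 *)

Section SobolevSpace.
Variable R : realType.
Implicit Types (phi psi f g u v : R * R -> R) (i : 'I_2).
Local Notation mu := (@plane_measure R).
Local Notation PT := (measurableTypeR R * measurableTypeR R)%type.
Local Notation Om := (@Omega R).
Local Notation mO := (@measurable_Omega R).
Local Notation fO := (@finite_Omega R).
Local Notation "\I f" := (\int[mu]_(x in Om) f x) (at level 36, f at level 36).
Local Notation sq := (sqint mu Om).

Lemma sum_ord2 (F : 'I_2 -> R) : \sum_(i < 2) F i = F ord0 + F (lift ord0 ord0).
Proof. by rewrite big_ord_recl big_ord1. Qed.

Lemma wpartial_sqint i u : Sobolev_H1 u -> sq (wpartial i u).
Proof. by move=> [_ /(_ i)/wpartialP[/L2_sqintP]]. Qed.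

Lemma wpartial_weak i u : Sobolev_H1 u -> is_weak_partial i u (wpartial i u).
Proof. by move=> [_ /(_ i)/wpartialP[]]. Qed.

Lemma Cc_L2 phi : Cc_infty phi -> L2_Omega phi.
Proof. by move/Cc_sqint/L2_sqintP. Qed.

Lemma Cc_H1 phi : Cc_infty phi -> Sobolev_H1 phi.
Proof.
move=> cphi; split; first exact: Cc_L2.
by move=> i; exists (partial i phi); [exact/Cc_L2/Cc_partial|exact: Cc_weak_partial].
Qed.

Lemma weak_partialB i u v g h : sq u -> sq v -> sq g -> sq h ->
  is_weak_partial i u g -> is_weak_partial i v h ->
  is_weak_partial i (u \- v) (fun x => g x - h x).
Proof.
move=> su sv sg sh wu wv phi cphi.
have sp := Cc_sqint cphi; have sdp := Cc_sqint (Cc_partial i cphi).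
transitivity (\I (fun x => u x * partial i phi x - v x * partial i phi x)).
  by apply: eq_Rintegral => x _ /=; rewrite mulrBl.
rewrite (RintB mO (sqintM mO su sdp) (sqintM mO sv sdp)) wu// wv//.
rewrite -opprD; congr (- _).
rewrite -(RintB mO (sqintM mO sg sp) (sqintM mO sh sp)).
by apply: eq_Rintegral => x _ /=; rewrite mulrBl.
Qed.

(** [H1norm (u \- v)] involves the representative chosen for the weak derivative of the difference.
    It is related to those of [u] and [v] only almost everywhere, by uniqueness. *)
Lemma H1_sqnorm_ae u v (g : 'I_2 -> R * R -> R) : sq u -> sq v ->
  (forall i, sq (g i)) -> (forall i, is_weak_partial i u (g i)) -> Cc_infty v ->
  H1norm (u \- v) ^+ 2 = \I (fun x => (u x - v x) ^+ 2) +
    (\I (fun x => (g ord0 x - partial ord0 v x) ^+ 2) +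
     \I (fun x => (g (lift ord0 ord0) x - partial (lift ord0 ord0) v x) ^+ 2)).
Proof.
move=> su sv sg wg cv; rewrite /H1norm sqr_sqrtr; last first.
  apply: Rintegral_ge0 => x _; rewrite addr_ge0 ?sqr_ge0// sumr_ge0// => i _.
  exact: sqr_ge0.
have sd i : sq (fun x => g i x - partial i v x).
  exact: (sqintB mO (sg i) (Cc_sqint (Cc_partial i cv))).
have wd i : ae_eq mu Om (wpartial i (u \- v)) (fun x => g i x - partial i v x).
  apply: wpartial_ae; first exact/L2_sqintP.
  exact: (weak_partialB su sv (sg i) (Cc_sqint (Cc_partial i cv)) (wg i) (Cc_weak_partial i cv)).
have swd i : sq (wpartial i (u \- v)).
  suff [] : L2_Omega (wpartial i (u \- v)) /\ is_weak_partial i (u \- v) (wpartial i (u \- v)).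
    by move/L2_sqintP.
  apply: wpartialP; exists (fun x => g i x - partial i v x); first exact/L2_sqintP.
  exact: (weak_partialB su sv (sg i) (Cc_sqint (Cc_partial i cv)) (wg i) (Cc_weak_partial i cv)).
have suv := sqintB mO su sv.
have aeq i : \I (fun x => wpartial i (u \- v) x ^+ 2) = \I (fun x => (g i x - partial i v x) ^+ 2).
  apply: (ae_eq_Rintegral mO).
  - by apply: measurable_funX; case: (swd i).
  - by apply: measurable_funX; case: (sd i).
  - by move: (wd i); apply: filterS => x H Ox; rewrite H.
have [_ i0] := suv; have [_ i1] := swd ord0; have [_ i2] := swd (lift ord0 ord0).
rewrite -!aeq -(RintD mO i1 i2) -(RintD mO i0 (rintD mO i1 i2)).
by apply: eq_Rintegral => x _; rewrite sum_ord2.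
Qed.

Lemma H10_H1 u : Sobolev_H10 u -> Sobolev_H1 u. Proof. by case. Qed.

Lemma H10_sqint u : Sobolev_H10 u -> sq u. Proof. by case=> -[/L2_sqintP]. Qed.

Lemma sum3_le (a b c e : R) : 0 <= a -> 0 <= b -> 0 <= c -> a + (b + c) <= e ->
  [/\ a <= e, b <= e & c <= e].
Proof. by move=> *; split; lra. Qed.

Lemma H10_approx u (e : R) : Sobolev_H10 u -> 0 < e -> exists2 phi, Cc_infty phi &
  \I (fun x => (u x - phi x) ^+ 2) <= e /\
  forall i, \I (fun x => (wpartial i u x - partial i phi x) ^+ 2) <= e.
Proof.
move=> Hu e0; have [H1u] := Hu; have se : 0 < Num.sqrt e by rewrite sqrtr_gt0.
move=> /(_ _ se)[phi cphi He]; exists phi => //.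
have : H1norm (u \- phi) ^+ 2 <= e.
  by rewrite -(sqr_sqrtr (ltW e0)) lerXn2r ?nnegrE ?sqrtr_ge0// ltW.
rewrite (H1_sqnorm_ae (H10_sqint Hu) (Cc_sqint cphi) (fun i => wpartial_sqint i H1u)
  (fun i => wpartial_weak i H1u) cphi).
have I0 (f : R * R -> R) : 0 <= \I (fun x => f x ^+ 2).
  by apply: Rintegral_ge0 => x _; exact: sqr_ge0.
move=> h; have [h0 h1 h2] := sum3_le (I0 _) (I0 _) (I0 _) h.
split; first exact: h0.
move=> i; have [E|E] : i = ord0 \/ i = lift ord0 ord0.
- by case: i => -[|[|//]] ?; [left|right]; exact/val_inj.
- by rewrite E; exact: h1.
- by rewrite E; exact: h2.
Qed.

Lemma H10_intro u (g : 'I_2 -> R * R -> R) : sq u -> (forall i, sq (g i)) ->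
  (forall i, is_weak_partial i u (g i)) ->
  (forall e : R, 0 < e -> exists2 phi, Cc_infty phi &
    \I (fun x => (u x - phi x) ^+ 2) <= e /\
    forall i, \I (fun x => (g i x - partial i phi x) ^+ 2) <= e) ->
  Sobolev_H10 u.
Proof.
move=> su sg wg ap; split.
  split; first exact/L2_sqintP.
  by move=> i; exists (g i); [exact/L2_sqintP|exact: wg].
(* The squared norm is a sum of three terms, each at most [e ^+ 2 / 4]. *)
move=> e e0; have [phi cphi [h0 hi]] := ap (e ^+ 2 / 4) ltac:(by rewrite divr_gt0// exprn_gt0).
exists phi => //; have := H1_sqnorm_ae su (Cc_sqint cphi) sg wg cphi.
move=> E; have : H1norm (u \- phi) ^+ 2 < e ^+ 2.
  rewrite E; apply: le_lt_trans (lerD h0 (lerD (hi _) (hi _))) _.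
  have e20 : 0 < e ^+ 2 by rewrite exprn_gt0.
  by clear -e20; lra.
by rewrite ltr_pXn2r ?nnegrE ?sqrtr_ge0// ltW.
Qed.

Lemma Cc_H10 phi : Cc_infty phi -> Sobolev_H10 phi.
Proof.
move=> cphi; apply: (@H10_intro _ (fun i => partial i phi)).
- exact: Cc_sqint.
- by move=> i; exact/Cc_sqint/Cc_partial.
- by move=> i; exact: Cc_weak_partial.
move=> e e0; exists phi => //.
have Z (f : R * R -> R) : \I (fun x => (f x - f x) ^+ 2) = 0.
  rewrite (@eq_Rintegral _ _ _ mu Om (fun=> 0)) /Rintegral ?integral0//.
  by move=> x _; rewrite subrr expr0n.
by split=> [|i]; rewrite Z ltW.
Qed.

Lemma sqint_small (k f : R * R -> R) (e : R) : sq k -> sq f -> 0 <= e ->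
  \I (fun x => f x ^+ 2) <= e ^+ 2 ->
  `|\I (fun x => k x * f x)| <= Num.sqrt (\I (fun x => k x ^+ 2)) * e.
Proof.
move=> sk sf e0 fe; apply: le_trans (Cauchy_Schwarz_sqrt mO sk sf) _.
by rewrite ler_wpM2l ?sqrtr_ge0// -(ger0_norm e0) -sqrtr_sqr ler_wsqrtr.
Qed.

Lemma small_eq0 (a C : R) : (forall e, 0 < e -> `|a| <= C * e) -> a = 0.
Proof.
move=> H; apply/eqP; rewrite -normr_le0 leNgt; apply/negP => a0.
have C0 : 0 < C by have := H 1 ltr01; rewrite mulr1; exact: lt_le_trans.
have := H (`|a| / (2 * C)) ltac:(by rewrite divr_gt0// mulr_gt0).
rewrite (_ : C * _ = `|a| / 2); last by field; rewrite gt_eqF.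
by move=> h; lra.
Qed.

Lemma RintBr (k f g : R * R -> R) : sq k -> sq f -> sq g ->
  \I (fun x => k x * (f x - g x)) = \I (fun x => k x * f x) - \I (fun x => k x * g x).
Proof.
move=> sk sf sg; rewrite -(RintB mO (sqintM mO sk sf) (sqintM mO sk sg)).
by apply: eq_Rintegral => x _; rewrite mulrBr.
Qed.

Lemma subr_cross (a b c a' b' c' : R) : a' = b' + c' ->
  a - (b + c) = a - a' - (b - b' + (c - c')).
Proof. by move=> ->; lra. Qed.

Lemma norm_sub_add_le (a b c A B C : R) : `|a| <= A -> `|b| <= B -> `|c| <= C ->
  `|a - (b + c)| <= A + (B + C).
Proof.
move=> aA bB cC; apply: le_trans (ler_normB _ _) _; rewrite lerD//.
by apply: le_trans (ler_normD _ _) _; rewrite lerD.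
Qed.

(* Identities that are linear in (v, grad v) extend from test functions to H^1_0. *)
Lemma H10_identity k (H : 'I_2 -> R * R -> R) v : sq k -> (forall i, sq (H i)) ->
  (forall phi, Cc_infty phi -> \I (fun x => k x * phi x) =
    \I (fun x => H ord0 x * partial ord0 phi x) +
    \I (fun x => H (lift ord0 ord0) x * partial (lift ord0 ord0) phi x)) ->
  Sobolev_H10 v -> \I (fun x => k x * v x) =
    \I (fun x => H ord0 x * wpartial ord0 v x) +
    \I (fun x => H (lift ord0 ord0) x * wpartial (lift ord0 ord0) v x).
Proof.
move=> sk sH id Hv; apply/eqP; rewrite -subr_eq0; apply/eqP.
pose N f := Num.sqrt (\I (fun x => f x ^+ 2)).
apply: (@small_eq0 _ (N k + (N (H ord0) + N (H (lift ord0 ord0))))) => e e0.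
have e20 : 0 < e ^+ 2 by rewrite exprn_gt0.
have [phi cphi [h0 hi]] := H10_approx Hv e20.
have sv := H10_sqint Hv; have sw i := wpartial_sqint i (H10_H1 Hv).
have sp := Cc_sqint cphi; have sdp i := Cc_sqint (Cc_partial i cphi).
have e_ge0 := ltW e0.
have bk : `|\I (fun x => k x * v x) - \I (fun x => k x * phi x)| <= N k * e.
  rewrite -(RintBr sk sv sp); exact: (sqint_small sk (sqintB mO sv sp) e_ge0 h0).
have bH i : `|\I (fun x => H i x * wpartial i v x) -
    \I (fun x => H i x * partial i phi x)| <= N (H i) * e.
  rewrite -(RintBr (sH i) (sw i) (sdp i)).
  exact: (sqint_small (sH i) (sqintB mO (sw i) (sdp i)) e_ge0 (hi i)).
rewrite (subr_cross _ _ _ (id _ cphi)) !mulrDl.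
exact: (norm_sub_add_le bk (bH _) (bH _)).
Qed.

End SobolevSpace.

(** * Existence of exact solutions *)

Section EnergyMinimization.
Variables (R : realType) (V : Type) (add : V -> V -> V) (scale : R -> V -> V).
Variables (C : set V) (B : V -> V -> R) (l : V -> R) (K : R).
Hypothesis C_ne : exists f, C f.
Hypothesis CD : forall f g, C f -> C g -> C (add f g).
Hypothesis CZ : forall a f, C f -> C (scale a f).
Hypothesis BD : forall f g h, C f -> C g -> C h -> B (add f g) h = B f h + B g h.
Hypothesis BZ : forall a f h, C f -> C h -> B (scale a f) h = a * B f h.
Hypothesis BC : forall f g, C f -> C g -> B f g = B g f.
Hypothesis B0 : forall f, C f -> 0 <= B f f.
Hypothesis lD : forall f g, C f -> C g -> l (add f g) = l f + l g.
Hypothesis lZ : forall a f, C f -> l (scale a f) = a * l f.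
Hypothesis lB : forall f, C f -> l f ^+ 2 <= K * B f f.

Let BDr f g h : C f -> C g -> C h -> B h (add f g) = B h f + B h g.
Proof. by move=> Cf Cg Ch; rewrite BC ?BD// ?[B f h]BC ?[B g h]BC//; exact: CD. Qed.

Let BZr a f h : C f -> C h -> B h (scale a f) = a * B h f.
Proof. by move=> Cf Ch; rewrite BC ?BZ// ?[B f h]BC//; exact: CZ. Qed.

Let J f := B f f - 2 * l f.

Lemma energy_expand f g (t : R) : C f -> C g ->
  J (add f (scale t g)) = J f + 2 * t * (B f g - l g) + t ^+ 2 * B g g.
Proof.
move=> Cf Cg; have Cs := CZ t Cg; have Ca := CD Cf Cs.
rewrite /J !(BD, BDr, BZ, BZr, lD, lZ)// [B g f]BC//.
by ring.
Qed.

(** Take [phi n] with energy within [n.+1%:R^-1] of the infimum. Midpoints show that the sequence is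
    Cauchy, and variations [phi n + t psi] over all [t] give the Euler equation up to a small
    error. *)
Lemma energy_minimizing : exists phi : nat -> V, [/\ forall n, C (phi n),
  forall n k, B (add (phi n) (scale (-1) (phi k))) (add (phi n) (scale (-1) (phi k))) <=
    2 * (n.+1%:R^-1 + k.+1%:R^-1) &
  forall n psi, C psi -> (B (phi n) psi - l psi) ^+ 2 <= n.+1%:R^-1 * B psi psi].
Proof.
pose E := [set J f | f in C].
have Jlow f : C f -> - `|K| <= J f.
  move=> Cf; rewrite /J; have := lB Cf; have := B0 Cf; have := ler_norm K.
  move: (B f f) (l f) `|K| (normr_ge0 K) => b lf k k0 Kk b0 lb.
  have lkb : lf ^+ 2 <= k * b by apply: le_trans lb _; rewrite ler_wpM2r.
  have [k00|kN0] := eqVneq k 0; first by move: lkb; rewrite k00; nra.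
  have kp : 0 < k by rewrite lt0r kN0.
  (* As [lf ^+ 2 <= k * b], this product is at least [(lf - k) ^+ 2]. *)
  have : 0 <= k * (b - 2 * lf + k); last by rewrite pmulr_rge0//; lra.
  by have := sqr_ge0 (lf - k); nra.
have Einf : has_inf E.
  split; first by have [f Cf] := C_ne; exists (J f); exists f.
  by exists (- `|K|) => _ [f Cf <-]; exact: Jlow.
pose m := inf E.
have mJ f : C f -> m <= J f.
  by move=> Cf; apply: ge_inf; [case: Einf|exists f].
have ex n : exists f, C f /\ J f < m + n.+1%:R^-1.
  have n0 : 0 < n.+1%:R^-1 :> R by rewrite invr_gt0.
  have [_ [f Cf <-] Jf] := inf_adherent n0 Einf.
  by exists f.
have [phi phiP] := choice ex; exists phi; split => [n|n k|n psi Cpsi].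
- by have [] := phiP n.
- have [Cn Jn] := phiP n; have [Ck Jk] := phiP k.
  (* The energy of the midpoint lies below the mean of the two energies by a quarter of the squared
     distance. *)
  have Cm := CZ 2^-1 (CD Cn Ck); have := mJ _ Cm.
  have Cs := CZ (-1) Ck; have Cd := CD Cn Cs; have Ca := CD Cn Ck.
  move: Jn Jk; rewrite /J !(BD, BDr, BZ, BZr, lD, lZ)// [B (phi k) (phi n)]BC//.
  move: (B (phi n) (phi n)) (B (phi n) (phi k)) (B (phi k) (phi k)) (l (phi n)) (l (phi k)).
  by move: n.+1%:R^-1 k.+1%:R^-1 => p q *; lra.
- have [Cn Jn] := phiP n; apply: discriminant_le0 => t.
  have := mJ _ (CD Cn (CZ t Cpsi)); rewrite energy_expand//.
  move: Jn; move: (J (phi n)) (2 * t * _) (t ^+ 2 * _) n.+1%:R^-1 => *; lra.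
Qed.

End EnergyMinimization.

(** * The Poincare inequality and the weak limit of a minimizing sequence *)

Section ExactSolution.
Variable R : realType.
Implicit Types (phi psi f u v : R * R -> R) (i : 'I_2).
Local Notation mu := (@plane_measure R).
Local Notation PT := (measurableTypeR R * measurableTypeR R)%type.
Local Notation Om := (@Omega R).
Local Notation mO := (@measurable_Omega R).
Local Notation fO := (@finite_Omega R).
Local Notation "\I f" := (\int[mu]_(x in Om) f x) (at level 36, f at level 36).
Local Notation sq := (sqint mu Om).
Local Notation i0 := (@ord0 1).
Local Notation i1 := (lift (@ord0 1) (@ord0 0)).

Lemma sqint_sqr_ge0 f : 0 <= \I (fun x => f x ^+ 2).
Proof. by apply: Rintegral_ge0 => x _; exact: sqr_ge0. Qed.

Lemma poincare_bound (a b d : R) : 0 <= a -> 0 <= b -> 0 <= d -> b <= a ->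
  a ^+ 2 <= 2 * (b * d) -> a ^+ 2 <= 4 * d ^+ 2.
Proof.
move=> a0 b0 d0 ba H; have [->|aN0] := eqVneq a 0; first by nra.
have ap : 0 < a by rewrite lt0r aN0.
have : a * a <= a * (2 * d) by nra.
by rewrite ler_pM2l// => ?; nra.
Qed.

(** [P], [X] and [D] stand for the integrals of [phi^2], of [(x phi)^2] and of the squared
    derivative of [phi], and [S] for that of [x phi] times this derivative. *)
Lemma poincare_scalar (P X D S : R) : 0 <= P -> 0 <= D ->
  `|S| <= Num.sqrt X * Num.sqrt D -> X <= P -> P + 2 * S = 0 -> P <= 4 * D.
Proof.
move=> P0 D0 SXD XP PS; have := ler_wsqrtr XP => sXP.
rewrite -(sqr_sqrtr P0) -(sqr_sqrtr D0).
apply: (@poincare_bound _ (Num.sqrt X)); rewrite ?sqrtr_ge0// sqr_sqrtr//.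
have -> : P = 2 * - S by rewrite mulrN; apply/eqP; rewrite -addr_eq0 PS.
by rewrite ler_pM2l//; apply: le_trans SXD; rewrite -normrN; exact: ler_norm.
Qed.

Lemma sqr_le1 (t : R) : -1 < t -> t < 1 -> t ^+ 2 <= 1.
Proof. by move=> *; nra. Qed.

(* Integrating the derivative of [x phi^2] gives the Poincare inequality. *)
Lemma poincare phi : Cc_infty phi ->
  \I (fun x => phi x ^+ 2) <= 4 * \I (fun x => partial i0 phi x ^+ 2).
Proof.
move=> cphi; have sphi := Cc_smooth cphi; have sdphi := Cc_sqint (Cc_partial i0 cphi).
have sfst : smooth (fst : R * R -> R) by exact/alg2_smooth/alg2_fst.
have cxp : Cc_infty (fun x => phi x * x.1) := CcM cphi sfst.
have sxp := Cc_smooth cxp.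
have E := Cc_int_partial i0 (CcM cphi sxp).
have E2 : \I (fun x => phi x ^+ 2) + \I (fun x => 2 * ((phi x * x.1) * partial i0 phi x)) = 0.
  rewrite -E -(RintD mO (proj2 (Cc_sqint cphi)) (rintZ mO 2 (sqintM mO (Cc_sqint cxp) sdphi))).
  apply: eq_Rintegral => x _.
  rewrite partialM; [|exact: smooth_differentiable..].
  rewrite partialM; [|exact: smooth_differentiable..].
  by rewrite partial_fst /=; ring.
move: E2; rewrite (RintZ mO 2 (sqintM mO (Cc_sqint cxp) sdphi)).
have CS := Cauchy_Schwarz_sqrt mO (Cc_sqint cxp) sdphi.
have le1 : \I (fun x => (phi x * x.1) ^+ 2) <= \I (fun x => phi x ^+ 2).
  apply: (le_Rintegral mO (proj2 (Cc_sqint cxp)) (proj2 (Cc_sqint cphi))).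
  move=> x [/andP[x1 x2] _]; rewrite exprMn ler_piMr ?sqr_ge0//.
  exact: sqr_le1.
exact: (poincare_scalar (sqint_sqr_ge0 _) (sqint_sqr_ge0 _) CS le1).
Qed.

Variables (alpha : R * R -> R) (M : R).
Hypothesis malpha : @measurable_fun _ _ PT R Om alpha.
Hypothesis alpha1 : forall x, Om x -> 1 <= alpha x.
Hypothesis alphaM : forall x, Om x -> alpha x <= M.

Lemma alpha_bound x : Om x -> `|alpha x| <= M.
Proof. by move=> Ox; rewrite ger0_norm ?alphaM// (le_trans ler01)// alpha1. Qed.

Lemma sq_alphaM g : sq g -> sq (fun x => alpha x * g x).
Proof. exact: (sqint_bM mO malpha alpha_bound). Qed.

(** The energy form on test functions, with classical derivatives in place of chosen
    representatives. *)
Definition gform phi psi : R :=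
  \I (fun x => alpha x * (partial i0 phi x * partial i0 psi x +
                          partial i1 phi x * partial i1 psi x)).

Lemma gform_rint phi psi : Cc_infty phi -> Cc_infty psi ->
  rint mu Om (fun x => alpha x * (partial i0 phi x * partial i0 psi x +
                          partial i1 phi x * partial i1 psi x)).
Proof.
move=> cphi cpsi; apply: (rint_bM mO malpha alpha_bound); apply: (rintD mO);
  exact: (sqintM mO (Cc_sqint (Cc_partial _ cphi)) (Cc_sqint (Cc_partial _ cpsi))).
Qed.

Lemma gformC phi psi : gform phi psi = gform psi phi.
Proof. by apply: eq_Rintegral => x _; congr (_ * (_ + _)); exact: mulrC. Qed.

Lemma partial_Cc_add i phi psi x : Cc_infty phi -> Cc_infty psi ->
  partial i (fun x => phi x + psi x) x = partial i phi x + partial i psi x.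
Proof.
by move=> cphi cpsi; rewrite partialD//; exact/smooth_differentiable/Cc_smooth.
Qed.

Lemma partial_Cc_scale i (a : R) phi x : Cc_infty phi ->
  partial i (fun x => a * phi x) x = a * partial i phi x.
Proof.
move=> cphi; rewrite (@partialM _ _ (fun=> a)) ?partial_cst ?mulr0 ?addr0//.
exact/smooth_differentiable/Cc_smooth.
Qed.

Lemma gformD phi psi chi : Cc_infty phi -> Cc_infty psi -> Cc_infty chi ->
  gform (fun x => phi x + psi x) chi = gform phi chi + gform psi chi.
Proof.
move=> cphi cpsi cchi; rewrite -(RintD mO (gform_rint cphi cchi) (gform_rint cpsi cchi)).
by apply: eq_Rintegral => x _; rewrite !partial_Cc_add//; ring.
Qed.

Lemma gformZ (a : R) phi chi : Cc_infty phi -> Cc_infty chi ->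
  gform (fun x => a * phi x) chi = a * gform phi chi.
Proof.
move=> cphi cchi; rewrite -(RintZ mO _ (gform_rint cphi cchi)).
by apply: eq_Rintegral => x _; rewrite !partial_Cc_scale//; ring.
Qed.

Lemma gform_ge0 phi : 0 <= gform phi phi.
Proof.
apply: Rintegral_ge0 => x Ox; rewrite mulr_ge0//.
  by rewrite (le_trans ler01)// alpha1.
by rewrite -!expr2 addr_ge0// sqr_ge0.
Qed.

Lemma partial_le_gform i phi : Cc_infty phi ->
  \I (fun x => partial i phi x ^+ 2) <= gform phi phi.
Proof.
move=> cphi; apply: (le_Rintegral mO _ (gform_rint cphi cphi)).
  exact: (proj2 (Cc_sqint (Cc_partial i cphi))).
move=> x Ox; rewrite -!expr2.
have a1 := alpha1 Ox; have p0 := sqr_ge0 (partial i0 phi x).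
have p1 := sqr_ge0 (partial i1 phi x).
have [E|E] : i = i0 \/ i = i1.
- by case: i => -[|[|//]] ?; [left|right]; exact/val_inj.
- by rewrite E; move: (partial _ _ _ ^+ 2) (partial _ _ _ ^+ 2) p0 p1 => *; nra.
- rewrite E; move: (partial i0 phi x ^+ 2) (partial i1 phi x ^+ 2) p0 p1 => *; nra.
Qed.

Variable f : R * R -> R.
Hypothesis sf : sq f.

Lemma load_bound phi : Cc_infty phi ->
  (\I (fun x => f x * phi x)) ^+ 2 <= (4 * \I (fun x => f x ^+ 2)) * gform phi phi.
Proof.
move=> cphi; apply: le_trans (Cauchy_Schwarz mO sf (Cc_sqint cphi)) _.
rewrite [4 * _]mulrC -mulrA ler_wpM2l ?sqint_sqr_ge0//.
apply: le_trans (poincare cphi) _; rewrite ler_wpM2l//.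
exact: partial_le_gform.
Qed.

Lemma CcB phi psi : Cc_infty phi -> Cc_infty psi -> Cc_infty (fun x => phi x + -1 * psi x).
Proof. by move=> cphi cpsi; apply: CcD => //; exact: CcZ. Qed.

Lemma minimizing_sequence : exists phi : nat -> R * R -> R,
  [/\ forall n, Cc_infty (phi n),
  forall n k, gform (fun x => phi n x + -1 * phi k x) (fun x => phi n x + -1 * phi k x) <=
    2 * (n.+1%:R^-1 + k.+1%:R^-1) &
  forall n psi, Cc_infty psi ->
    (gform (phi n) psi - \I (fun x => f x * psi x)) ^+ 2 <= n.+1%:R^-1 * gform psi psi].
Proof.
apply: (@energy_minimizing R (R * R -> R) (fun g h x => g x + h x) (fun a g x => a * g x)
  (@Cc_infty R) gform (fun g => \I (fun x => f x * g x)) (4 * \I (fun x => f x ^+ 2))).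
- by exists (fun=> 0); exact: Cc0.
- by move=> *; exact: CcD.
- by move=> *; exact: CcZ.
- by move=> *; exact: gformD.
- by move=> *; exact: gformZ.
- by move=> *; exact: gformC.
- by move=> *; exact: gform_ge0.
- move=> g h cg ch.
  rewrite -(RintD mO (sqintM mO sf (Cc_sqint cg)) (sqintM mO sf (Cc_sqint ch))).
  by apply: eq_Rintegral => x _; rewrite mulrDr.
- move=> a g cg; rewrite -(RintZ mO _ (sqintM mO sf (Cc_sqint cg))).
  by apply: eq_Rintegral => x _; rewrite mulrCA.
- exact: load_bound.
Qed.

Lemma partial_CcB i phi psi x : Cc_infty phi -> Cc_infty psi ->
  partial i (fun x => phi x + -1 * psi x) x = partial i phi x - partial i psi x.
Proof.
move=> cphi cpsi; rewrite partial_Cc_add//; last exact: CcZ.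
by rewrite partial_Cc_scale// mulN1r.
Qed.

Lemma four_ge (n k : nat) : 2 * (n.+1%:R^-1 + k.+1%:R^-1) <= 4 * (2 * (n.+1%:R^-1 + k.+1%:R^-1)) :> R.
Proof.
have : 0 <= n.+1%:R^-1 + k.+1%:R^-1 :> R by rewrite addr_ge0// invr_ge0.
by move: (_ + _) => z z0; lra.
Qed.

Lemma weak_close (a a' b b' A B : R) : a' = - b' -> `|a - a'| <= A -> `|b - b'| <= B ->
  `|a + b| <= A + B.
Proof.
move=> -> h1 h2; rewrite (_ : a + b = (a - - b') + (b - b')); last by lra.
by apply: le_trans (ler_normD _ _) _; rewrite lerD.
Qed.

(* [u] is the L^2 limit of a minimizing sequence of test functions, [G] the
   limit of the gradients. *)
Lemma weak_limit : exists u, exists G : 'I_2 -> R * R -> R,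
  [/\ sq u, forall i, sq (G i), forall i, is_weak_partial i u (G i),
   forall e : R, 0 < e -> exists2 phi, Cc_infty phi &
    \I (fun x => (u x - phi x) ^+ 2) <= e /\
    forall i, \I (fun x => (G i x - partial i phi x) ^+ 2) <= e &
   forall psi, Cc_infty psi -> \I (fun x => f x * psi x) =
    \I (fun x => (alpha x * G i0 x) * partial i0 psi x) +
    \I (fun x => (alpha x * G i1 x) * partial i1 psi x)].
Proof.
have [phi [cphi cauchy limit]] := minimizing_sequence.
have inv_small (e : R) : 0 < e -> exists N, forall n, (N <= n)%N -> n.+1%:R^-1 <= e.
  move=> e0; have [N _ NP] := near_infty_natSinv_lt (PosNum e0).
  by exists N => n Nn; apply/ltW/NP.
have dphi i n k : \I (fun x => (partial i (phi n) x - partial i (phi k) x) ^+ 2) <=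
    2 * (n.+1%:R^-1 + k.+1%:R^-1).
  apply: le_trans (cauchy n k); apply: le_trans (partial_le_gform i (CcB (cphi n) (cphi k))).
  rewrite le_eqVlt; apply/orP; left; apply/eqP.
  by apply: eq_Rintegral => x _; rewrite partial_CcB.
have pphi n k : \I (fun x => (phi n x - phi k x) ^+ 2) <= 4 * (2 * (n.+1%:R^-1 + k.+1%:R^-1)).
  apply: le_trans (_ : _ <= \I (fun x => (phi n x + -1 * phi k x) ^+ 2)) _.
    rewrite le_eqVlt; apply/orP; left; apply/eqP.
    by apply: eq_Rintegral => x _; rewrite mulN1r.
  apply: le_trans (poincare (CcB (cphi n) (cphi k))) _; rewrite ler_wpM2l//.
  exact: le_trans (partial_le_gform _ (CcB (cphi n) (cphi k))) (cauchy n k).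
have small (e : R) : 0 < e -> exists N, forall n k, (N <= n)%N -> (N <= k)%N ->
    4 * (2 * (n.+1%:R^-1 + k.+1%:R^-1)) <= e.
  move=> e0; have e16 : 0 < e / 16 by rewrite divr_gt0.
  have [N NP] := inv_small _ e16; exists N => n k /NP + /NP.
  by move: n.+1%:R^-1 k.+1%:R^-1; clear -e0 => p q *; lra.
have [u su ulim] := L2_complete mO fO (fun n => Cc_sqint (cphi n))
  (fun e e0 => let: ex_intro N NP := small e e0 in
    ex_intro _ N (fun m n Nm Nn => le_trans (pphi m n) (NP m n Nm Nn))).
have ex i : exists g : R * R -> R, sq g /\
    (forall e : R, 0 < e -> exists N, forall n, (N <= n)%N ->
     \I (fun x => (g x - partial i (phi n) x) ^+ 2) <= e).
  have [g sg glim] := L2_complete mO fO (fun n => Cc_sqint (Cc_partial i (cphi n)))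
    (fun e e0 => let: ex_intro N NP := small e e0 in
      ex_intro _ N (fun m n Nm Nn => le_trans (dphi i m n)
        (le_trans (four_ge _ _) (NP m n Nm Nn)))).
  by exists g.
have [G GP] := choice ex.
(* One index has to serve for the function and for both derivatives at once. *)
have common (e : R) : 0 < e -> exists n, [/\ n.+1%:R^-1 <= e,
    \I (fun x => (u x - phi n x) ^+ 2) <= e &
    forall i, \I (fun x => (G i x - partial i (phi n) x) ^+ 2) <= e].
  move=> e0; have [N1 H1] := inv_small e e0; have [N2 H2] := ulim e e0.
  have [N3 H3] := (GP i0).2 e e0; have [N4 H4] := (GP i1).2 e e0.
  exists (maxn (maxn N1 N2) (maxn N3 N4)); split.
  - by apply: H1; rewrite !leq_max leqnn.
  - by apply: H2; rewrite !leq_max leqnn orbT.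
  move=> i; have [E|E] : i = i0 \/ i = i1.
  - by case: i => -[|[|//]] ?; [left|right]; exact/val_inj.
  - by rewrite E; apply: H3; rewrite !leq_max leqnn !orbT.
  - by rewrite E; apply: H4; rewrite !leq_max leqnn !orbT.
have sG i : sq (G i) by have [] := GP i.
exists u, G; split => //.
- move=> i psi cpsi; have sp := Cc_sqint cpsi; have sdp := Cc_sqint (Cc_partial i cpsi).
  apply/eqP; rewrite -subr_eq0 opprK; apply/eqP.
  pose N g := Num.sqrt (\I (fun x => g x ^+ 2)).
  apply: (@small_eq0 _ _ (N (partial i psi) + N psi)) => e e0.
  have e20 : 0 < e ^+ 2 by rewrite exprn_gt0.
  have [n [_ un Gn]] := common _ e20.
  have W := Cc_weak_partial i (cphi n) cpsi.
  have b1 := sqint_small sdp (sqintB mO su (Cc_sqint (cphi n))) (ltW e0) un.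
  have b2 := sqint_small sp (sqintB mO (sG i) (Cc_sqint (Cc_partial i (cphi n)))) (ltW e0) (Gn i).
  rewrite (RintBr sdp su (Cc_sqint (cphi n))) in b1.
  rewrite (RintBr sp (sG i) (Cc_sqint (Cc_partial i (cphi n)))) in b2.
  have comm (g h : R * R -> R) : \I (fun x => g x * h x) = \I (fun x => h x * g x).
    by apply: eq_Rintegral => x _; rewrite mulrC.
  rewrite mulrDl (comm u) (comm (G i)).
  exact: (weak_close (etrans (comm _ _) (etrans W (congr1 (fun z => - z) (comm _ _)))) b1 b2).
- move=> e e0; have [n [_ un Gn]] := common e e0; exists (phi n) => //.
- move=> psi cpsi; apply/eqP; rewrite -subr_eq0; apply/eqP.
  pose N g := Num.sqrt (\I (fun x => g x ^+ 2)).
  have sa i : sq (fun x => alpha x * partial i psi x) by exact/sq_alphaM/Cc_sqint/Cc_partial.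
  apply: (@small_eq0 _ _ (Num.sqrt (gform psi psi) +
    (N (fun x => alpha x * partial i0 psi x) + N (fun x => alpha x * partial i1 psi x)))) => e e0.
  have e20 : 0 < e ^+ 2 by rewrite exprn_gt0.
  have [n [en _ Gn]] := common _ e20.
  have b i := sqint_small (sa i) (sqintB mO (sG i) (Cc_sqint (Cc_partial i (cphi n)))) (ltW e0) (Gn i).
  have bi i : `|\I (fun x => (alpha x * G i x) * partial i psi x) -
      \I (fun x => (alpha x * partial i psi x) * partial i (phi n) x)| <=
      N (fun x => alpha x * partial i psi x) * e.
    move: (b i); rewrite (RintBr (sa i) (sG i) (Cc_sqint (Cc_partial i (cphi n)))).
    rewrite [\I (fun x => alpha x * G i x * partial i psi x)](_ : _ =
      \I (fun x => alpha x * partial i psi x * G i x))//.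
    by apply: eq_Rintegral => x _; rewrite mulrAC.
  have b3 : `|\I (fun x => f x * psi x) - gform (phi n) psi| <= Num.sqrt (gform psi psi) * e.
    rewrite distrC -sqrtr_sqr -(ger0_norm (ltW e0)) -sqrtr_sqr -sqrtrM ?gform_ge0//.
    rewrite ler_wsqrtr// (le_trans (limit n psi cpsi))// mulrC ler_wpM2l//.
    exact: gform_ge0.
  have E : gform (phi n) psi =
      \I (fun x => (alpha x * partial i0 psi x) * partial i0 (phi n) x) +
      \I (fun x => (alpha x * partial i1 psi x) * partial i1 (phi n) x).
    rewrite -(RintD mO (sqintM mO (sa i0) (Cc_sqint (Cc_partial i0 (cphi n))))
       (sqintM mO (sa i1) (Cc_sqint (Cc_partial i1 (cphi n))))).
    by apply: eq_Rintegral => x _; ring.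
  rewrite (subr_cross _ _ _ E) !mulrDl.
  exact: (norm_sub_add_le b3 (bi _) (bi _)).
Qed.

End ExactSolution.

(** * Existence of exact solutions and the duality for their energy *)

Section EnergyOfExactSolution.
Variable R : realType.
Implicit Types (phi psi u v : R * R -> R) (i : 'I_2).
Local Notation mu := (@plane_measure R).
Local Notation PT := (measurableTypeR R * measurableTypeR R)%type.
Local Notation Om := (@Omega R).
Local Notation mO := (@measurable_Omega R).
Local Notation fO := (@finite_Omega R).
Local Notation "\I f" := (\int[mu]_(x in Om) f x) (at level 36, f at level 36).
Local Notation sq := (sqint mu Om).
Local Notation i0 := (@ord0 1).
Local Notation i1 := (lift (@ord0 1) (@ord0 0)).
Variables (alpha : R * R -> R) (M : R).
Hypothesis malpha : @measurable_fun _ _ PT R Om alpha.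
Hypothesis alpha1 : forall x, Om x -> 1 <= alpha x.
Hypothesis alphaM : forall x, Om x -> alpha x <= M.
Variable f : R * R -> R.
Hypothesis sf : sq f.

(** The energy form on vector fields that need not be gradients, so that derivatives may be
    exchanged for almost everywhere equal ones. *)
Definition wint (U P : 'I_2 -> R * R -> R) : R :=
  \I (fun x => alpha x * (U i0 x * P i0 x + U i1 x * P i1 x)).

Lemma wint_rint U P : (forall i, sq (U i)) -> (forall i, sq (P i)) ->
  rint mu Om (fun x => alpha x * (U i0 x * P i0 x + U i1 x * P i1 x)).
Proof.
move=> sU sP; apply: (rint_bM mO malpha (alpha_bound alpha1 alphaM)).
by apply: (rintD mO); exact: (sqintM mO (sU _) (sP _)).
Qed.

Lemma a_formE u v (U P : 'I_2 -> R * R -> R) :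
  Sobolev_H1 u -> Sobolev_H1 v -> (forall i, sq (U i)) -> (forall i, sq (P i)) ->
  (forall i, ae_eq mu Om (wpartial i u) (U i)) ->
  (forall i, ae_eq mu Om (wpartial i v) (P i)) -> a_form alpha u v = wint U P.
Proof.
move=> Hu Hv sU sP uU vP; rewrite /a_form.
have -> : \I (fun x => alpha x * \sum_(i < 2) wpartial i u x * wpartial i v x) =
    wint (fun i => wpartial i u) (fun i => wpartial i v).
  by apply: eq_Rintegral => x _; rewrite sum_ord2.
apply: (ae_eq_Rintegral mO).
- exact: (rint_measurable (wint_rint (fun i => wpartial_sqint i Hu) (fun i => wpartial_sqint i Hv))).
- exact: (rint_measurable (wint_rint sU sP)).
have both (w : R * R -> R) W : (forall i, ae_eq mu Om (wpartial i w) (W i)) ->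
    {ae mu, forall x, Om x -> wpartial i0 w x = W i0 x /\ wpartial i1 w x = W i1 x}.
  move=> wW; apply: filterS2 (wW i0) (wW i1) => x h1 h2 Ox.
  by split; [exact: h1|exact: h2].
have [bu bv] := (both _ _ uU, both _ _ vP).
have F : Filter (nbhs (almost_everywhere mu)) by exact: ae_filter_ringOfSetsType.
have C : {ae mu, forall x, Om x ->
    alpha x * (wpartial i0 u x * wpartial i0 v x + wpartial i1 u x * wpartial i1 v x) =
    alpha x * (U i0 x * P i0 x + U i1 x * P i1 x)}.
  apply: filterS2 bu bv => x h h' Ox.
  by have [-> ->] := h Ox; have [-> ->] := h' Ox.
exact: C.
Qed.

Lemma H1_refl_ae i u : ae_eq mu Om (wpartial i u) (wpartial i u).
Proof. exact: aeW. Qed.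

Lemma Cc_wpartial_ae i phi : Cc_infty phi -> ae_eq mu Om (wpartial i phi) (partial i phi).
Proof.
by move=> cphi; apply: wpartial_ae; [exact/Cc_L2/Cc_partial|exact: Cc_weak_partial].
Qed.

Lemma distribute_coef (a u p v q : R) : a * (u * p + v * q) = a * u * p + a * v * q.
Proof. ring. Qed.

Theorem exact_exists : exists u, exact_solution alpha f u.
Proof.
have [u [G [su sG wG ap id]]] := weak_limit malpha alpha1 alphaM sf.
have Hu : Sobolev_H10 u by apply: (@H10_intro _ _ G).
exists u; split => // v Hv; rewrite /L2dot.
have sw i : sq (wpartial i v) := wpartial_sqint i (H10_H1 Hv).
have uG i : ae_eq mu Om (wpartial i u) (G i).
  by apply: wpartial_ae => //; exact/L2_sqintP.
rewrite (a_formE (H10_H1 Hu) (H10_H1 Hv) sG sw uG (fun i => H1_refl_ae i v)).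
have sH i : sq (fun x => alpha x * G i x) := sq_alphaM malpha alpha1 alphaM (sG i).
rewrite (@H10_identity _ f (fun i x => alpha x * G i x) v sf sH id Hv).
rewrite -(RintD mO (sqintM mO (sH i0) (sw i0)) (sqintM mO (sH i1) (sw i1))).
by apply: eq_Rintegral => x _; exact: distribute_coef.
Qed.

Lemma wint_ge0 U : 0 <= wint U U.
Proof.
apply: Rintegral_ge0 => x Ox; rewrite mulr_ge0//.
  by rewrite (le_trans ler01)// alpha1.
by rewrite -!expr2 addr_ge0// sqr_ge0.
Qed.

Lemma quadratic_expand (a u v p q t : R) :
  a * (u * u + v * v) + 2 * t * (a * (u * p + v * q)) + t ^+ 2 * (a * (p * p + q * q)) =
  a * ((u + t * p) * (u + t * p) + (v + t * q) * (v + t * q)).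
Proof. ring. Qed.

Lemma wint_expand U P (t : R) : (forall i, sq (U i)) -> (forall i, sq (P i)) ->
  wint U U + 2 * t * wint U P + t ^+ 2 * wint P P =
  wint (fun i x => U i x + t * P i x) (fun i x => U i x + t * P i x).
Proof.
move=> sU sP; have UU := wint_rint sU sU; have UP := wint_rint sU sP.
have PP := wint_rint sP sP.
rewrite /wint -(RintZ mO (2 * t) UP) -(RintZ mO (t ^+ 2) PP).
rewrite -(RintD mO UU (rintZ mO (2 * t) UP)).
rewrite -(RintD mO (rintD mO UU (rintZ mO (2 * t) UP)) (rintZ mO (t ^+ 2) PP)).
by apply: eq_Rintegral => x _; exact: quadratic_expand.
Qed.

Lemma wint_Cauchy_Schwarz U P : (forall i, sq (U i)) -> (forall i, sq (P i)) ->
  wint U P ^+ 2 <= wint U U * wint P P.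
Proof.
move=> sU sP; apply: discriminant_le0 => t.
by rewrite (wint_expand t sU sP); exact: wint_ge0.
Qed.

(** Lower half of the duality: the equation is tested with [phi] and the Cauchy-Schwarz inequality
    for the energy is applied. *)
Lemma exact_lower u phi : exact_solution alpha f u -> Cc_infty phi ->
  (\I (fun x => f x * phi x)) ^+ 2 <= a_form alpha u u * gform alpha phi phi.
Proof.
move=> [Hu eq] cphi; have := eq _ (Cc_H10 cphi); rewrite /L2dot => <-.
have H := H10_H1 Hu; have Hphi := Cc_H1 cphi.
have sU i := wpartial_sqint i H; have sP i := Cc_sqint (Cc_partial i cphi).
rewrite (a_formE H Hphi sU sP (fun i => H1_refl_ae i u) (fun i => Cc_wpartial_ae i cphi)).
rewrite (a_formE H H sU sU (fun i => H1_refl_ae i u) (fun i => H1_refl_ae i u)).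
exact: wint_Cauchy_Schwarz.
Qed.

Lemma two_mul_le (l k g : R) : 0 <= k -> 0 <= g -> l ^+ 2 <= k * g -> 2 * l <= k + g.
Proof.
move=> k0 g0 lkg; rewrite leNgt; apply/negP => h.
have := sqr_ge0 (k - g); nra.
Qed.

Lemma le_of_small (a b c : R) : (forall e, 0 < e -> a <= b + c * e) -> a <= b.
Proof.
move=> H; rewrite leNgt; apply/negP => ba.
pose d := `|c| + 1; have d0 : 0 < d by rewrite ltr_wpDl.
have := H ((a - b) / (2 * d)) ltac:(by rewrite divr_gt0 ?subr_gt0// mulr_gt0).
have cd : c <= d by rewrite (le_trans (ler_norm c))// lerDl.
have : c * ((a - b) / (2 * d)) <= d * ((a - b) / (2 * d)).
  by rewrite ler_wpM2r// divr_ge0 ?subr_ge0 ?mulr_ge0 ?ltW.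
rewrite [X in _ <= X -> _](_ : _ = (a - b) / 2); last by field; rewrite gt_eqF.
by move: (c * _) => z; lra.
Qed.

(** Upper half of the duality. For a test function [phi] close to [u], the expansion of
    [a(u - phi, u - phi)] bounds [a(u, u)] by [2 (f, phi) - a(phi, phi)] up to a small error, and
    the hypothesis bounds this by [K]. *)
Lemma exact_upper u (K : R) : 0 <= K -> exact_solution alpha f u ->
  (forall phi, Cc_infty phi ->
    (\I (fun x => f x * phi x)) ^+ 2 <= K * gform alpha phi phi) ->
  a_form alpha u u <= K.
Proof.
move=> K0 [Hu eq] HK; have H := H10_H1 Hu; have sU i := wpartial_sqint i H.
rewrite (a_formE H H sU sU (fun i => H1_refl_ae i u) (fun i => H1_refl_ae i u)).
apply: (@le_of_small _ _ (M * 2)) => e e0.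
have [phi cphi [_ ap]] := H10_approx Hu e0.
have Hphi := Cc_H1 cphi; have sP i := Cc_sqint (Cc_partial i cphi).
have El := eq _ (Cc_H10 cphi); rewrite /L2dot in El.
rewrite (a_formE H Hphi sU sP (fun i => H1_refl_ae i u) (fun i => Cc_wpartial_ae i cphi)) in El.
have Kl := two_mul_le K0 (gform_ge0 alpha1 phi) (HK _ cphi).
have sD i := sqintB mO (sU i) (sP i).
have D : wint (fun i x => wpartial i u x + -1 * partial i phi x)
    (fun i x => wpartial i u x + -1 * partial i phi x) <= M * 2 * e.
  apply: (@le_trans _ _ (M * (\I (fun x => (wpartial i0 u x - partial i0 phi x) ^+ 2) +
     \I (fun x => (wpartial i1 u x - partial i1 phi x) ^+ 2)))); last first.
    have O0 : Om (0, 0) by rewrite /Omega/=; split; apply/andP; split; lra.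
    have M0 : 0 <= M := le_trans ler01 (le_trans (alpha1 O0) (alphaM O0)).
    rewrite -mulrA ler_wpM2l// mulr_natl mulr2n lerD//.
  have r2 := rintD mO (proj2 (sD i0)) (proj2 (sD i1)).
  rewrite -(RintD mO (proj2 (sD i0)) (proj2 (sD i1))) -(RintZ mO M r2).
  have sD' i : sq (fun x => wpartial i u x + -1 * partial i phi x).
    by move: (sD i); congr sqint; apply/funext => x; rewrite mulN1r.
  apply: (le_Rintegral mO (wint_rint sD' sD') (rintZ mO M r2)).
  move=> x Ox; rewrite !mulN1r -!expr2 ler_wpM2r ?alphaM//.
  by rewrite addr_ge0// sqr_ge0.
move: D; rewrite -(wint_expand (-1) sU sP).
have -> : wint (fun i => partial i phi) (fun i => partial i phi) = gform alpha phi phi by [].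
move: Kl; rewrite -El.
move: (wint _ _) (wint _ _) (gform _ _ _) => a b c; lra.
Qed.

End EnergyOfExactSolution.

(** * Logarithmic cutoffs at the tips of the diamond *)

Section TipCutoff.
Variable R : realType.
Variables (s t : R * R -> R) (a b : 'I_2 -> R).
Hypothesis ss : smooth s.
Hypothesis st : smooth t.
Hypothesis partial_s : forall i x, partial i s x = a i.
Hypothesis partial_t : forall i x, partial i t x = b i.
Hypothesis a4 : forall i, `|a i| <= 4.
Hypothesis b4 : forall i, `|b i| <= 4.
Hypothesis ab0 : forall i, a i * b i = 0.
Variable S : R.
Hypothesis S0 : 0 < S.
Hypothesis step'S : forall x : R, `|derive1 (@step R) x| <= S.
Variable N : nat.
Hypothesis N0 : (0 < N)%N.
Implicit Types (i : 'I_2) (x : R * R) (j k : nat).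

Definition r2 x : R := s x * s x + t x * t x.
(** With [r2] as squared radius, [ecut k] is 1 outside radius [2^-k] and 0 inside [2^-k / sqrt 2];
    [mcut k] is 0 for [s <= 2^-k / 8] and 1 for [s >= 2^-k / 4]. *)
Definition ecut k x : R := step (4 ^+ k * r2 x).
Definition mcut k x : R := step (4 * 2 ^+ k * s x).

(* A logarithmic cutoff at [s = t = 0]: in the cone [|t| <= s], at distance about
   [2 ^- k], its value is about [(N - k) / N]; the factor [mcut] makes it vanish
   near the line [s = 0]. *)
Fixpoint tip j x : R := if j is j'.+1 then
  let k := (N - j'.+1)%N in
  (1 + -1 * ecut k x) * tip j' x + (j'.+1)%:R / N%:R * (ecut k x * mcut k x) else 0.

(** Up to a constant, a majorant of the squared slope, which is about [4^k] at distance [2^-k]. Full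
    discs replace annuli, since only areas of order [4^-k] matter. *)
Fixpoint layers j x : R := if j is j'.+1 then
  let k := (N - j'.+1)%N in
  layers j' x + 4 ^+ k * (4 ^+ k * r2 x <= 1)%R%:R else 0.

Lemma r2_ge0 x : 0 <= r2 x.
Proof. by rewrite /r2 -!expr2 addr_ge0// sqr_ge0. Qed.

Lemma alg2_r2 : alg2 r2.
Proof. by apply: alg2D; apply: alg2M; exact: alg2_base. Qed.

Lemma alg2_ecut k : alg2 (ecut k).
Proof.
apply: alg2_comp; first exact: step_smooth.
by apply: alg2M; [exact: alg2_cst|exact: alg2_r2].
Qed.

Lemma alg2_mcut k : alg2 (mcut k).
Proof.
apply: alg2_comp; first exact: step_smooth.
by apply: alg2M; [exact: alg2_cst|exact: alg2_base].
Qed.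

Lemma alg2_tip j : alg2 (tip j).
Proof.
elim: j => [|j ih] /=; first exact: alg2_cst.
apply: alg2D; apply: alg2M.
- apply: alg2D; first exact: alg2_cst.
  by apply: alg2M; [exact: alg2_cst|exact: alg2_ecut].
- exact: ih.
- exact: alg2_cst.
- by apply: alg2M; [exact: alg2_ecut|exact: alg2_mcut].
Qed.

Lemma alg2_differentiable (f : R * R -> R) x : alg2 f -> differentiable f x.
Proof. by move/alg2_smooth/smooth_differentiable; exact. Qed.

Lemma partial_scale i (c : R) (f : R * R -> R) x : differentiable f x ->
  partial i (fun x => c * f x) x = c * partial i f x.
Proof.
move=> df; rewrite (@partialM _ _ (fun=> c)) ?partial_cst ?mulr0 ?addr0//.
Qed.

Lemma partial_r2 i x : partial i r2 x = 2 * (s x * a i + t x * b i).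
Proof.
have ds := smooth_differentiable x ss; have dt := smooth_differentiable x st.
rewrite /r2 partialD ?partialM ?partial_s ?partial_t//; first by ring.
- exact: differentiableM.
- exact: differentiableM.
Qed.

Lemma partial_ecut i k x :
  partial i (ecut k) x = derive1 (@step R) (4 ^+ k * r2 x) *
    (4 ^+ k * (2 * (s x * a i + t x * b i))).
Proof.
have dr := alg2_differentiable x alg2_r2.
rewrite partial_comp ?partial_scale ?partial_r2//.
- exact/smooth1_derivable/step_smooth.
- by apply: alg2_differentiable; apply: alg2M; [exact: alg2_cst|exact: alg2_r2].
Qed.

Lemma partial_mcut i k x :
  partial i (mcut k) x = derive1 (@step R) (4 * 2 ^+ k * s x) * (4 * 2 ^+ k * a i).
Proof.
have ds := smooth_differentiable x ss.
rewrite partial_comp ?partial_scale ?partial_s//.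
- exact/smooth1_derivable/step_smooth.
- by apply: alg2_differentiable; apply: alg2M; [exact: alg2_cst|exact: alg2_base].
Qed.

(** The product rule is grouped so that the derivative of [ecut] multiplies the difference between
    the new and the old value, which in the cone is only [1 / N]. *)
Lemma partial_tipS i j x : let k := (N - j.+1)%N in
  partial i (tip j.+1) x = (1 - ecut k x) * partial i (tip j) x +
    partial i (ecut k) x * (j.+1%:R / N%:R * mcut k x - tip j x) +
    j.+1%:R / N%:R * (ecut k x * partial i (mcut k) x).
Proof.
move=> k; have de := alg2_differentiable x (alg2_ecut k).
have dm := alg2_differentiable x (alg2_mcut k).
have dp := alg2_differentiable x (alg2_tip j).
have d1 : differentiable (fun x => 1 + -1 * ecut k x) x.
  apply: alg2_differentiable; apply: alg2D; first exact: alg2_cst.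
  by apply: alg2M; [exact: alg2_cst|exact: alg2_ecut].
have d1' : differentiable (fun x => -1 * ecut k x) x.
  by apply: alg2_differentiable; apply: alg2M; [exact: alg2_cst|exact: alg2_ecut].
have d2 : differentiable (fun x => ecut k x * mcut k x) x.
  by apply: alg2_differentiable; apply: alg2M; [exact: alg2_ecut|exact: alg2_mcut].
have d3 : differentiable (fun x => j.+1%:R / N%:R * (ecut k x * mcut k x)) x.
  by apply: alg2_differentiable; apply: alg2M; [exact: alg2_cst|
    apply: alg2M; [exact: alg2_ecut|exact: alg2_mcut]].
have d4 : differentiable (fun x => (1 + -1 * ecut k x) * tip j x) x.
  exact: differentiableM.
rewrite [tip j.+1]/= -/k (partialD i d4 d3) (partialM i d1 dp).
rewrite (@partialD _ i (fun=> 1) _ x _ d1') ?partial_cst; last exact: differentiable_cst.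
rewrite (partial_scale i _ d2) (partialM i de dm) (partial_scale i _ de).
by ring.
Qed.

Lemma ecut_ge0 k x : 0 <= ecut k x. Proof. exact: step_ge0. Qed.
Lemma ecut_le1 k x : ecut k x <= 1. Proof. exact: step_le1. Qed.
Lemma mcut_ge0 k x : 0 <= mcut k x. Proof. exact: step_ge0. Qed.
Lemma mcut_le1 k x : mcut k x <= 1. Proof. exact: step_le1. Qed.

Lemma weight_ge0 j : 0 <= j%:R / N%:R :> R. Proof. by rewrite divr_ge0. Qed.

Lemma weight_le1 j : (j <= N)%N -> j%:R / N%:R <= 1 :> R.
Proof. by move=> jN; rewrite ler_pdivrMr ?ltr0n// mul1r ler_nat. Qed.

Lemma tip_bound j x : (j <= N)%N -> 0 <= tip j x <= 1.
Proof.
elim: j => [|j ih] jN /=; first by rewrite lexx ler01.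
have /andP[p0 p1] := ih (ltnW jN); set k := (N - j.+1)%N.
have := ecut_ge0 k x; have := ecut_le1 k x; have := mcut_ge0 k x; have := mcut_le1 k x.
have := weight_ge0 j.+1; have := weight_le1 jN.
move: (_ / _) (ecut k x) (mcut k x) (tip j x) p0 p1 => c e m p p0 p1 c1 c0 m1 m0 e1 e0.
have cm0 : 0 <= c * m by rewrite mulr_ge0.
have cm1 : c * m <= 1 by rewrite mulr_ile1.
rewrite mulN1r mulrCA.
by apply/andP; split; [rewrite addr_ge0// mulr_ge0//; lra|nra].
Qed.

Lemma tip_outer j x : (j <= N)%N -> 1 <= 4 ^+ (N - j) * r2 x ->
  tip j x = j%:R / N%:R * mcut (N - j) x.
Proof.
case: j => [|j] jN H /=; first by rewrite !mul0r.
have E : ecut (N - j.+1) x = 1 by rewrite /ecut step1.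
by rewrite E mulr1 subrr mul0r add0r mul1r.
Qed.

Lemma partial_tip_outer i j x : (j <= N)%N -> 1 < 4 ^+ (N - j) * r2 x ->
  partial i (tip j) x = j%:R / N%:R * partial i (mcut (N - j)) x.
Proof.
case: j => [|j] jN H; first by rewrite /= partial_cst !mul0r.
rewrite partial_tipS partial_ecut derive1_step1// mul0r mul0r addr0.
by rewrite /ecut step1 ?ltW// subrr mul0r add0r mul1r.
Qed.

(** All factors [mcut k] that occur vanish there; this keeps the support away from the side [s = 0]
    of the square. *)
Lemma tip_support j x : (j <= N)%N -> 8 * 2 ^+ N * s x <= 1 -> tip j x = 0.
Proof.
move=> jN H; elim: j jN => [//|j ih] jN /=; rewrite ih ?(ltnW jN)// mulr0 add0r.
rewrite /mcut step0 ?mulr0//.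
have [s0|s0] := leP (s x) 0.
  by rewrite (@le_trans _ _ 0)// mulr_ge0_le0// mulr_ge0// exprn_ge0.
have H2 : (2 : R) ^+ (N - j.+1) <= 2 ^+ N.
  by rewrite ler_eXn2l ?leq_subr// ltr1n.
have : 2 ^+ (N - j.+1) * s x <= 2 ^+ N * s x by rewrite ler_wpM2r// ltW.
rewrite -!mulrA in H *; move: H; move: (2 ^+ N * s x) (2 ^+ (N - j.+1) * s x) => p q *.
by lra.
Qed.

Definition cone x := `|t x| <= s x.
(** The slope in units of the inverse distance: small in the cone, where the coefficient may be [M],
    and of order 1 elsewhere. *)
Definition slope_weight x : R := if cone x then N%:R^-1 else 1.

Lemma slope_weight_ge0 x : 0 <= slope_weight x.
Proof. by rewrite /slope_weight; case: ifP. Qed.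

Lemma step'_le (c d y : R) : `|c| <= d -> `|derive1 (@step R) y * c| <= S * d.
Proof. by move=> cd; rewrite normrM ler_pM. Qed.

Lemma partial_mcut_le i k x : `|partial i (mcut k) x| <= S * (16 * 2 ^+ k).
Proof.
rewrite partial_mcut; apply: step'_le.
rewrite normrM ger0_norm ?mulr_ge0 ?exprn_ge0//.
have : 0 <= (2 : R) ^+ k by rewrite exprn_ge0.
by have := a4 i; move: `|a i| (2 ^+ k) => u v *; nra.
Qed.

Lemma partial_ecut_le i k x : 4 ^+ k * r2 x <= 1 ->
  `|partial i (ecut k) x| <= S * (8 * 2 ^+ k).
Proof.
move=> H; rewrite partial_ecut; apply: step'_le.
rewrite -(@ler_pXn2r _ 2) ?nnegrE ?mulr_ge0 ?exprn_ge0// real_normK ?num_real//.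
have k4 : (4 : R) ^+ k = 2 ^+ k * 2 ^+ k.
  by rewrite -exprMn; congr (_ ^+ _); ring.
rewrite k4 in H *; have k0 : 0 <= (2 : R) ^+ k by rewrite exprn_ge0.
move: H k0; move: (2 ^+ k) => c H c0.
have A : (s x * a i + t x * b i) ^+ 2 <= 16 * r2 x.
  have [/ler_normlP[a1 a2] /ler_normlP[b1 b2]] := (a4 i, b4 i).
  have a16 : a i ^+ 2 <= 16 by nra.
  have b16 : b i ^+ 2 <= 16 by nra.
  have := ab0 i; rewrite /r2.
  have -> : (s x * a i + t x * b i) ^+ 2 =
    s x ^+ 2 * a i ^+ 2 + t x ^+ 2 * b i ^+ 2 + 2 * (s x * t x) * (a i * b i) by ring.
  by move=> ->; have := sqr_ge0 (s x); have := sqr_ge0 (t x); nra.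
move: A H; move: (s x * _ + _) (r2 x) (r2_ge0 x) => u r r0 A H.
have -> : (c * c * (2 * u)) ^+ 2 = 4 * (c * c) * ((c * c) * u ^+ 2) by ring.
have -> : (8 * c) ^+ 2 = 4 * (c * c) * 16 by ring.
rewrite ler_wpM2l ?mulr_ge0//.
apply: le_trans (_ : c * c * (16 * r) <= _); first by rewrite ler_wpM2l// mulr_ge0.
by lra.
Qed.

(** In the cone [r2 <= 2 s^2], so that [r2 > 4^-(k+1)] forces [s > 2^-k / 4], where [mcut l] is
    locally constant for all [l >= k]. *)
Lemma mcut_cone k l x : cone x -> (k <= l)%N -> 1 < 4 ^+ k.+1 * r2 x ->
  mcut l x = 1 /\ forall i, partial i (mcut l) x = 0.
Proof.
rewrite /cone => tc kl H.
have s0 : 0 <= s x by apply: le_trans tc.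
suff H1 : 1 < 4 * 2 ^+ l * s x.
  by split=> [|i]; [rewrite /mcut step1// ltW|rewrite partial_mcut derive1_step1// mul0r].
apply: (@lt_le_trans _ _ (4 * 2 ^+ k * s x)); last first.
  by rewrite ler_wpM2r// ler_wpM2l// ler_eXn2l// ltr1n.
have r2s : r2 x <= 2 * (s x * s x).
  rewrite /r2; move/ler_normlP : tc => [t1 t2].
  by move: (s x) (t x) t1 t2 s0 => u v *; nra.
have k4 : (4 : R) ^+ k.+1 = 4 * (2 ^+ k * 2 ^+ k).
  by rewrite exprS -exprMn; congr (_ * _ ^+ _); ring.
rewrite k4 in H; have k0 : 0 <= (2 : R) ^+ k by rewrite exprn_ge0.
move: H k0; move: (2 ^+ k) => c H c0.
have : 1 < 8 * ((c * s x) * (c * s x)).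
  apply: lt_le_trans H _.
  apply: (@le_trans _ _ (4 * (c * c) * (2 * (s x * s x)))).
    by rewrite ler_wpM2l// mulr_ge0// mulr_ge0.
  by rewrite le_eqVlt; apply/orP; left; apply/eqP; ring.
have : 0 <= c * s x by rewrite mulr_ge0.
have -> : 4 * c * s x = 4 * (c * s x) by rewrite mulrA.
by move: (c * s x) => z z0 hz; rewrite ltNge; apply/negP => h; nra.
Qed.

Lemma tip_layer i j x : (j < N)%N -> let k := (N - j.+1)%N in
  1 < 4 ^+ k.+1 * r2 x -> 4 ^+ k * r2 x <= 1 ->
  `|partial i (tip j.+1) x| <= 56 * S * slope_weight x * 2 ^+ k.
Proof.
move=> jN k H1 H2; have kS : (N - j)%N = k.+1 by rewrite /k subnSK.
have H1' : 1 < 4 ^+ (N - j) * r2 x by rewrite kS.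
have pE := partial_tip_outer i (ltnW jN) H1'.
have vE := tip_outer (ltnW jN) (ltW H1').
have eb := partial_ecut_le i H2.
have k0 : 0 <= (2 : R) ^+ k by rewrite exprn_ge0.
rewrite partial_tipS -/k pE vE kS /slope_weight; case: ifPn => [xc|_].
  have [m1 dm1] := mcut_cone xc (leqnn k) H1.
  have [m2 dm2] := mcut_cone xc (leqnSn k) H1.
  rewrite m1 m2 dm1 dm2 !mulr0 addr0 add0r !mulr1 -mulrBl.
  have -> : j.+1%:R - j%:R = 1 :> R by rewrite -natr1 addrAC subrr add0r.
  rewrite mul1r normrM [`|N%:R^-1|]ger0_norm//.
  rewrite [56 * S * _]mulrC -mulrA [leLHS]mulrC ler_wpM2l//.
  by apply: le_trans eb _; move: (2 ^+ k) k0 S0 => c *; nra.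
have := ecut_ge0 k x; have := ecut_le1 k x; have := mcut_ge0 k x; have := mcut_le1 k x.
have := mcut_ge0 k.+1 x; have := mcut_le1 k.+1 x.
have := weight_ge0 j.+1; have := weight_le1 jN.
have := weight_ge0 j; have := weight_le1 (ltnW jN).
have := partial_mcut_le i k x; have := partial_mcut_le i k.+1 x.
rewrite exprS; move: eb.
move: (partial i (ecut k) x) (partial i (mcut k.+1) x) (partial i (mcut k) x).
move: (j.+1%:R / N%:R) (j%:R / N%:R) (mcut k.+1 x) (mcut k x) (ecut k x) (2 ^+ k) k0.
move=> c1 c0 m1 m0 e q q0 de dm1 dm0 hde hdm1 hdm0 c01 c00 c11 c10 m11 m10 m01 m00 e1 e0.
have cm1 : 0 <= c1 * m0 <= 1 by rewrite mulr_ge0//= mulr_ile1.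
have cm0 : 0 <= c0 * m1 <= 1 by rewrite mulr_ge0//= mulr_ile1.
(* The three terms are bounded by [32], [8] and [16] times [S * q], which explains the constant
   [56]. *)
have T1 : `|(1 - e) * (c0 * dm1)| <= S * (16 * (2 * q)).
  rewrite (mulrA (1 - e)) normrM; apply: le_trans hdm1; rewrite ler_piMl//.
  by rewrite ger0_norm ?mulr_ge0 ?mulr_ile1//; lra.
have T2 : `|de * (c1 * m0 - c0 * m1)| <= S * (8 * q).
  rewrite normrM; apply: le_trans hde; rewrite ler_piMr//.
  by rewrite ler_norml; apply/andP; split; lra.
have T3 : `|c1 * (e * dm0)| <= S * (16 * q).
  rewrite (mulrA c1) normrM; apply: le_trans hdm0; rewrite ler_piMl//.
  by rewrite ger0_norm ?mulr_ge0 ?mulr_ile1//; lra.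
apply: le_trans (ler_normD _ _) _; apply: le_trans (lerD (ler_normD _ _) T3) _.
apply: le_trans (lerD (lerD T1 T2) (lexx _)) _.
rewrite le_eqVlt; apply/orP; left; apply/eqP; ring.
Qed.

Definition slope_const : R := (56 * S) ^+ 2.

(** Only one layer contributes at a given point: for [4 ^+ k.+1 * r2 x <= 1] the new cut [ecut k]
    vanishes near [x], and the gradient is that of [tip j]. *)
Lemma tip_gradient i j x : (j <= N)%N -> 4 ^+ (N - j) * r2 x <= 1 ->
  partial i (tip j) x ^+ 2 <= slope_const * slope_weight x ^+ 2 * layers j x.
Proof.
elim: j => [|j ih] jN H; first by rewrite /= partial_cst expr0n mulr0.
set k := (N - j.+1)%N in H *; have kS : (N - j)%N = k.+1 by rewrite /k subnSK.
have w0 : 0 <= slope_const * slope_weight x ^+ 2.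
  by rewrite mulr_ge0 ?sqr_ge0// exprn_ge0// mulr_ge0// ltW.
have layers0 l : 0 <= layers l x.
  by elim: l => //= l hl; rewrite addr_ge0// mulr_ge0// exprn_ge0.
rewrite [layers _ _]/= -/k H mulr1.
have [H1|H1] := leP (4 ^+ k.+1 * r2 x) 1.
  have H4 : 4 ^+ k * r2 x < 2^-1.
    by move: H1; rewrite exprS -mulrA; move: (_ * r2 x) => z; lra.
  rewrite partial_tipS -/k partial_ecut derive1_step0// /ecut step0; last exact: ltW.
  rewrite subr0 mul1r !mul0r mulr0 !addr0.
  apply: le_trans (ih (ltnW jN) _) _; first by rewrite kS.
  by rewrite ler_wpM2l// lerDl exprn_ge0.
have L := tip_layer i jN H1 H; rewrite -/k in L.
rewrite -real_normK ?num_real//.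
apply: le_trans (_ : (56 * S * slope_weight x * 2 ^+ k) ^+ 2 <= _).
  by rewrite lerXn2r ?nnegrE// !mulr_ge0 ?slope_weight_ge0 ?exprn_ge0// ltW.
have -> : (56 * S * slope_weight x * 2 ^+ k) ^+ 2 =
    slope_const * slope_weight x ^+ 2 * (2 ^+ k) ^+ 2 by rewrite -!exprMn.
rewrite ler_wpM2l//.
have -> : ((2 : R) ^+ k) ^+ 2 = 4 ^+ k.
  by rewrite -exprM mulnC exprM; congr (_ ^+ _); ring.
by rewrite lerDr.
Qed.

(** The summand 1 covers the exterior of the unit disc, where the cutoff is [mcut 0]. *)
Lemma tip_gradient_all i x :
  partial i (tip N) x ^+ 2 <= slope_const * slope_weight x ^+ 2 * (layers N x + 1).
Proof.
have w0 : 0 <= slope_const * slope_weight x ^+ 2.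
  by rewrite mulr_ge0 ?sqr_ge0// exprn_ge0// mulr_ge0// ltW.
have layers0 l : 0 <= layers l x.
  by elim: l => //= l hl; rewrite addr_ge0// mulr_ge0// exprn_ge0.
have [H|H] := leP (4 ^+ (N - N) * r2 x) 1.
  apply: le_trans (tip_gradient i (leqnn N) H) _.
  by rewrite ler_wpM2l// lerDl.
rewrite (partial_tip_outer i (leqnn N) H) divff ?mul1r ?pnatr_eq0 -?lt0n// subnn.
rewrite subnn mul1r in H.
rewrite /slope_weight; case: ifPn => [xc|_].
  have [_ ->] : mcut 0 x = 1 /\ forall i, partial i (mcut 0) x = 0.
    apply: (mcut_cone xc (leqnn 0)); rewrite expr1.
    by move: (r2 x) H => z; lra.
  by rewrite expr0n mulr_ge0// ?addr_ge0// mulr_ge0 ?sqr_ge0// exprn_ge0// mulr_ge0// ltW.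
rewrite expr1n mulr1.
apply: (@le_trans _ _ slope_const).
  rewrite -real_normK ?num_real// lerXn2r ?nnegrE//.
    by rewrite mulr_ge0// ltW.
  apply: le_trans (partial_mcut_le i 0 x) _.
  by rewrite expr0 mulr1 mulrC ler_wpM2r ?ler_nat// ltW.
by rewrite ler_peMr ?lerDr// sqr_ge0.
Qed.

End TipCutoff.

(** * The product of the four cutoffs and its energy *)

Section TestFunction.
Variable R : realType.
Implicit Types (x : R * R) (i : 'I_2) (h p : bool).
Local Notation leb := (@lebesgue_measure R).
Local Notation mu := (@plane_measure R).
Local Notation Rm := (measurableTypeR R).
Local Notation PT := (measurableTypeR R * measurableTypeR R)%type.
Local Notation Om := (@Omega R).
Local Notation mO := (@measurable_Omega R).
Local Notation fO := (@finite_Omega R).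
Local Notation "\I f" := (\int[mu]_(x in Om) f x) (at level 36, f at level 36).

(* Scaled coordinates at the four tips [(+-1, 0)], [(0, +-1)] of the diamond
   [|x| + |y| <= 1]: [tip_s] is normal and [tip_t] tangential to the
   boundary of the square. *)
Definition tip_sign p : R := if p then -4 else 4.
Definition tip_s h p x : R := 4 + tip_sign p * (if h then x.1 else x.2).
Definition tip_t h x : R := 4 * (if h then x.2 else x.1).
Definition tip_a h p i : R := tip_sign p * (if h then (axis i).1 else (axis i).2).
Definition tip_b h i : R := 4 * (if h then (axis i).2 else (axis i).1).

Lemma alg2_coord h : alg2 (fun x => if h then x.1 else x.2).
Proof. by case: h; [exact: alg2_fst|exact: alg2_snd]. Qed.

Lemma smooth_tip_s h p : smooth (tip_s h p).
Proof.
apply: alg2_smooth; apply: alg2D; first exact: alg2_cst.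
by apply: alg2M; [exact: alg2_cst|exact: alg2_coord].
Qed.

Lemma smooth_tip_t h : smooth (tip_t h).
Proof.
apply: alg2_smooth; apply: alg2M; first exact: alg2_cst.
by case: h; [exact: alg2_snd|exact: alg2_fst].
Qed.

Lemma partial_tip_s h p i x : partial i (tip_s h p) x = tip_a h p i.
Proof.
have dc : differentiable (fun x : R * R => if h then x.1 else x.2) x.
  exact/alg2_differentiable/alg2_coord.
have ds : differentiable (fun x : R * R => tip_sign p * (if h then x.1 else x.2)) x.
  apply: alg2_differentiable; apply: alg2M; [exact: alg2_cst|exact: alg2_coord].
rewrite (@partialD _ i (fun=> 4) _ x _ ds); last exact: differentiable_cst.
rewrite partial_cst add0r partial_scale// /tip_a.
by case: h {dc ds}; rewrite ?partial_fst ?partial_snd.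
Qed.

Lemma partial_tip_t h i x : partial i (tip_t h) x = tip_b h i.
Proof.
have dc : differentiable (fun x : R * R => if h then x.2 else x.1) x.
  by apply: alg2_differentiable; case: h; [exact: alg2_snd|exact: alg2_fst].
rewrite partial_scale// /tip_b.
by case: h {dc}; rewrite ?partial_fst ?partial_snd.
Qed.

Lemma axis_le1 i : `|(@axis R i).1| <= 1 /\ `|(@axis R i).2| <= 1.
Proof. by rewrite /axis; case: ifP => _ /=; rewrite normr0 normr1 lexx ler01. Qed.

Lemma tip_a4 h p i : `|tip_a h p i| <= 4.
Proof.
have [a1 a2] := axis_le1 i; rewrite normrM.
have -> : `|tip_sign p| = 4 by rewrite /tip_sign; case: p; rewrite ?normrN ger0_norm.
by case: h; rewrite ler_piMr.
Qed.

Lemma tip_b4 h i : `|tip_b h i| <= 4.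
Proof.
have [a1 a2] := axis_le1 i; rewrite normrM [`|4|]ger0_norm//.
by case: h; rewrite ler_piMr.
Qed.

Lemma tip_ab0 h p i : tip_a h p i * tip_b h i = 0.
Proof.
rewrite /tip_a /tip_b mulrACA (_ : _ * _ = 0 :> R) ?mulr0//.
have : (@axis R i).1 * (axis i).2 = 0 by rewrite /axis; case: ifP; rewrite /= ?mulr0 ?mul0r.
by case: h => /= E; last rewrite [_.2 * _.1]mulrC; rewrite E mulr0.
Qed.

Section FixedScale.
Variables (S : R) (N : nat).
Hypothesis S0 : 0 < S.
Hypothesis step'S : forall x : R, `|derive1 (@step R) x| <= S.
Hypothesis N0 : (0 < N)%N.

Definition tipf h p : R * R -> R := tip (tip_s h p) (tip_t h) N N.
Definition tipl h p j : R * R -> R := layers (tip_s h p) (tip_t h) N j.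

Lemma tipf_alg2 h p : alg2 (tipf h p).
Proof. exact: (alg2_tip (smooth_tip_s h p) (smooth_tip_t h)). Qed.

Lemma tipf_bound h p x : 0 <= tipf h p x <= 1.
Proof. exact: tip_bound. Qed.

Lemma tipf_gradient h p i x : partial i (tipf h p) x ^+ 2 <=
  slope_const S * slope_weight (tip_s h p) (tip_t h) N x ^+ 2 * (tipl h p N x + 1).
Proof.
exact: (tip_gradient_all (smooth_tip_s h p) (smooth_tip_t h) (partial_tip_s h p)
  (partial_tip_t h) (tip_a4 h p) (tip_b4 h) (tip_ab0 h p) S0 step'S N0 i x).
Qed.

(** The scaling by 4 gives [tip_s >= 3] on this central square, beyond all layers. *)
Lemma tipf1 h p x : `|x.1| <= 4^-1 -> `|x.2| <= 4^-1 -> tipf h p x = 1.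
Proof.
move=> /ler_normlP[x1 x2] /ler_normlP[y1 y2].
have s3 : 3 <= tip_s h p x by rewrite /tip_s /tip_sign; case: h; case: p; lra.
rewrite /tipf tip_outer// ?subnn ?mul1r.
  by rewrite divff ?pnatr_eq0 -?lt0n// mul1r /mcut step1// mulr1; lra.
by rewrite /r2; have := sqr_ge0 (tip_t h x); rewrite expr2; nra.
Qed.

Definition quad_tip x : R :=
  (tipf true true x * tipf true false x) * (tipf false true x * tipf false false x).

Lemma Cc_quad_tip : Cc_infty quad_tip.
Proof.
(* Each factor vanishes where [tip_s <= d], and the scaling by 4 makes this a strip of width [d / 4]
   along a side of the square. *)
pose d : R := (8 * 2 ^+ N)^-1; have q0 : 0 < 8 * 2 ^+ N :> R by rewrite mulr_gt0// exprn_gt0.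
have d0 : 0 < d by rewrite invr_gt0.
have supp h p x : tipf h p x != 0 -> d < tip_s h p x.
  move=> nz; rewrite ltNge; apply/negP => sd; move/negP: nz; apply; apply/eqP.
  apply: (tip_support _ (leqnn N)).
  have := ler_wpM2l (ltW q0) sd; rewrite mulfV// gt_eqF//.
apply: (@Cc_of_compact _ _ (`[-1 + d / 4, 1 - d / 4]%classic `*` `[-1 + d / 4, 1 - d / 4]%classic)).
- by apply: alg2_smooth; do 2![apply: alg2M]; exact: tipf_alg2.
- by apply: compact_setX; exact: segment_compact.
- move=> [x y] /= [/=]; rewrite !in_itv/= => /andP[x1 x2] /andP[y1 y2].
  by split; apply/andP; split => /=; move: d d0 x1 x2 y1 y2 {supp} => e *; lra.
- move=> [x y]; rewrite /quad_tip !mulf_eq0 !negb_or => /andP[/andP[/supp h1 /supp h2]] /andP[/supp h3 /supp h4].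
  move: h1 h2 h3 h4; rewrite /tip_s /tip_sign /=.
  by move: d d0 {supp} => e *; split; rewrite /= in_itv/=; apply/andP; split; lra.
Qed.

Lemma quad_tip_ge0 x : 0 <= quad_tip x.
Proof.
have H h p : 0 <= tipf h p x by have /andP[] := tipf_bound h p x.
by rewrite /quad_tip !mulr_ge0.
Qed.

Lemma quad_tip1 x : `|x.1| <= 4^-1 -> `|x.2| <= 4^-1 -> quad_tip x = 1.
Proof. by move=> h1 h2; rewrite /quad_tip !tipf1// !mulr1. Qed.

Lemma sqr_product_rule (f g df dg : R) : 0 <= f <= 1 -> 0 <= g <= 1 ->
  (f * dg + g * df) ^+ 2 <= 2 * (df ^+ 2 + dg ^+ 2).
Proof.
move=> /andP[f0 f1] /andP[g0 g1].
apply: (@le_trans _ _ (2 * ((f * dg) ^+ 2 + (g * df) ^+ 2))).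
  by have := sqr_ge0 (f * dg - g * df); move: (f * dg) (g * df) => u v; nra.
rewrite ler_wpM2l// addrC !exprMn.
have f2 : f ^+ 2 <= 1 by nra.
have g2 : g ^+ 2 <= 1 by nra.
by rewrite lerD// ler_piMl ?sqr_ge0.
Qed.

Lemma double_le (u v a b : R) : u <= 2 * a -> v <= 2 * b -> 2 * (u + v) <= 4 * (a + b).
Proof. by move=> *; lra. Qed.

Lemma quad_tip_gradient i x : partial i quad_tip x ^+ 2 <=
  4 * ((partial i (tipf true true) x ^+ 2 + partial i (tipf true false) x ^+ 2) +
       (partial i (tipf false true) x ^+ 2 + partial i (tipf false false) x ^+ 2)).
Proof.
have d h p : differentiable (tipf h p) x by exact/alg2_differentiable/tipf_alg2.
have d2 h : differentiable (fun x => tipf h true x * tipf h false x) x.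
  exact: differentiableM.
have b h : 0 <= tipf h true x * tipf h false x <= 1.
  have /andP[? ?] := tipf_bound h true x; have /andP[? ?] := tipf_bound h false x.
  by rewrite mulr_ge0//= mulr_ile1.
rewrite (partialM i (d2 true) (d2 false)).
apply: le_trans (sqr_product_rule _ _ (b true) (b false)) _.
have P h : partial i (fun x => tipf h true x * tipf h false x) x ^+ 2 <=
    2 * (partial i (tipf h true) x ^+ 2 + partial i (tipf h false) x ^+ 2).
  rewrite (partialM i (d h true) (d h false)).
  exact: sqr_product_rule (tipf_bound h true x) (tipf_bound h false x).
exact: double_le (P true) (P false).
Qed.

Lemma Rintegral_bool_box (P : pred (R * R)) (A B : set R) (c : R) :
  @measurable _ PT [set x | P x] -> @measurable _ Rm A -> @measurable _ Rm B ->
  (forall x, P x -> A x.1 /\ B x.2) -> (leb A * leb B)%E = c%:E ->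
  rint mu Om (fun x => (P x)%:R) /\ \I (fun x => (P x)%:R) <= c.
Proof.
move=> mP mA mB PAB ABc.
have mb : @measurable_fun _ _ PT R Om (fun x => (P x)%:R).
  by apply: measurable_fun_boolR => //; exact: mO.
split.
  apply: (rint_bounded mO fO mb (C := 1)) => x _.
  by case: (P x); rewrite ?normr1 ?normr0.
have -> : \I (fun x => (P x)%:R) = \I (fun x => (P x)%:R * 1).
  by apply: eq_Rintegral => x _; rewrite mulr1.
rewrite Rintegral_boolM.
have mOP : @measurable _ PT [set x | Om x /\ P x].
  exact: (@measurableI _ PT _ _ mO mP).
have mAB : @measurable _ PT (A `*` B) by exact: (@measurableX _ _ Rm Rm).
have le : (mu [set x | Om x /\ P x] <= c%:E)%E.
  rewrite -ABc -(rect_measure mA mB); apply: le_measure; rewrite ?inE//.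
  by move=> x [_ /PAB].
rewrite Rintegral_cst// mul1r -lee_fin fineK//.
by rewrite ge0_fin_numE// (le_lt_trans le)// ltry.
Qed.

(** By the scaling, the disc lies in a square of side [2 * e] with [e = 2^-k / 4], of area
    [4^-k / 4]. So the bound is the same for every layer. *)
Lemma layer_term_integral h p k :
  let P x := (4 ^+ k * r2 (tip_s h p) (tip_t h) x <= 1)%R in
  rint mu Om (fun x => 4 ^+ k * (P x)%:R) /\ \I (fun x => 4 ^+ k * (P x)%:R) <= 1.
Proof.
move=> P.
have mP : @measurable _ PT [set x | P x].
  have cf : continuous (fun x => 4 ^+ k * r2 (tip_s h p) (tip_t h) x).
    apply: smooth_continuous; apply: alg2_smooth; apply: alg2M; first exact: alg2_cst.
    exact: (alg2_r2 (smooth_tip_s h p) (smooth_tip_t h)).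
  have := @continuous_measurable_plane R _ cf.
  move=> /(_ (@measurableT _ PT) _ (@measurable_itv R `]-oo, 1]%R)).
  by rewrite setTI (_ : _ @^-1` _ = [set x | P x])//; apply/seteqP; split => x; rewrite /= in_itv.
pose e : R := (4 * 2 ^+ k)^-1.
have k0 : 0 < (2 : R) ^+ k by rewrite exprn_gt0.
have e0 : 0 < e by rewrite invr_gt0 mulr_gt0.
have ke : 4 * 2 ^+ k * e = 1 by rewrite mulfV// mulf_neq0// gt_eqF.
have k4 : (4 : R) ^+ k = 2 ^+ k * 2 ^+ k.
  by rewrite -exprMn; congr (_ ^+ _); ring.
pose c p' : R := if p' then 1 else -1.
pose I a : set R := `[a - e, a + e]%classic.
have lebI a : leb (I a) = (2 * e)%:E.
  rewrite lebesgue_measure_itv /= lte_fin ifT; last by rewrite /I; move: e0; clear; move: e => e *; lra.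
  by rewrite -EFinD; congr EFin; ring.
have Px x : P x -> let a := if h then x.1 else x.2 in let b := if h then x.2 else x.1 in
    I (c p) a /\ I 0 b.
  rewrite /P /r2 k4 /tip_s /tip_t /tip_sign => H /=.
  have bound (y w : R) : 2 ^+ k * 2 ^+ k * (y * y + w * w) <= 1 -> -(4 * e) <= y <= 4 * e.
    move=> H1; rewrite -ler_norml -(ler_pM2l k0).
    rewrite (_ : 2 ^+ k * (4 * e) = 4 * 2 ^+ k * e) ?ke; last by rewrite mulrCA mulrA.
    rewrite -(@ler_pXn2r _ 2) ?nnegrE// ?mulr_ge0// ?(ltW k0)// expr1n.
    apply: le_trans H1; rewrite exprMn real_normK ?num_real// -expr2.
    by rewrite ler_wpM2l ?sqr_ge0// -!expr2 lerDl sqr_ge0.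
  have /andP[s1 s2] := bound _ _ H.
  rewrite addrC in H; have /andP[t1 t2] := bound _ _ H.
  move: s1 s2 t1 t2; rewrite /I /c /= !in_itv /=; move: e0; clear; move: e => e e0.
  case: h; case: p => *; split; apply/andP; split; lra.
have [A [B [mA mB PAB ABc]]] : exists A B : set R, [/\ @measurable _ Rm A, @measurable _ Rm B,
    forall x, P x -> A x.1 /\ B x.2 & (leb A * leb B)%E = (2 * e * (2 * e))%:E].
  case: h P mP Px => P mP Px; [exists (I (c p)), (I 0)|exists (I 0), (I (c p))];
    (split; [exact: measurable_itv|exact: measurable_itv| |by rewrite !lebI EFinM]);
    by move=> x /Px[].
have [r i] := Rintegral_bool_box mP mA mB PAB ABc.
split; first exact: (rintZ mO).
rewrite (RintZ mO _ r); apply: le_trans (ler_wpM2l (exprn_ge0 _ _) i) _ => //.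
rewrite k4 (_ : _ * _ = 4^-1 * (4 * 2 ^+ k * e) * (4 * 2 ^+ k * e)); last by field.
by rewrite ke !mulr1 invf_le1// ler1n.
Qed.

Lemma tipl_integral h p j : rint mu Om (tipl h p j) /\ \I (tipl h p j) <= j%:R.
Proof.
elim: j => [|j [r i]].
  split; first exact: (rint_cst mO fO).
  by rewrite /tipl /= (Rintegral_cst _ mO) mul0r.
have [r1 i1] := layer_term_integral h p (N - j.+1)%N.
split; first exact: (rintD mO).
by rewrite -[leRHS]natr1 (RintD mO r r1); exact: lerD.
Qed.

Lemma tipl_ge0 h p j x : 0 <= tipl h p j x.
Proof.
rewrite /tipl; elim: j => //= j ih.
by rewrite addr_ge0// mulr_ge0// exprn_ge0.
Qed.

Section Energy.
Variables (M : R) (alpha : R * R -> R).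
Hypothesis malpha : @measurable_fun _ _ PT R Om alpha.
Hypothesis alpha1 : forall x, Om x -> 1 <= alpha x.
Hypothesis alphaM : forall x, Om x -> alpha x <= M.
Hypothesis alpha_diamond : forall x, Om x -> 1 < `|x.1| + `|x.2| -> alpha x <= 1.

(** The cone matches the diamond: [|t| > s] means [|x| + |y| > 1], where the coefficient is at most
    1. So [M] only meets the small slope [1 / N]. *)
Lemma alpha_weight h p x : Om x ->
  alpha x * slope_weight (tip_s h p) (tip_t h) N x ^+ 2 <= M / N%:R ^+ 2 + 1.
Proof.
move=> Ox; have M0 : 0 <= M / N%:R ^+ 2.
  by rewrite divr_ge0 ?sqr_ge0// (le_trans _ (alphaM Ox))// (le_trans ler01)// alpha1.
rewrite /slope_weight; case: ifPn => [_|]; rewrite /cone.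
  rewrite exprVn; apply: (@le_trans _ _ (M / N%:R ^+ 2)); last by rewrite lerDl.
  by rewrite ler_wpM2r ?invr_ge0 ?sqr_ge0// alphaM.
rewrite -ltNge => H; rewrite expr1n mulr1; apply: le_trans (alpha_diamond Ox _) _.
  move: H; rewrite /tip_s /tip_t /tip_sign normrM [`|4|]ger0_norm//.
  have := ler_norm x.1; have := ler_norm x.2; have := ler_norm (- x.1); have := ler_norm (- x.2).
  rewrite !normrN; case: h; case: p; move: `|x.1| `|x.2| => u v *; lra.
by rewrite lerDr.
Qed.

Definition layer_sum x : R :=
  ((tipl true true N x + 1) + (tipl true false N x + 1)) +
  ((tipl false true N x + 1) + (tipl false false N x + 1)).

Lemma measure_OmegaR : fine (mu Om) = 4. Proof. by rewrite (measure_Omega R). Qed.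

Lemma layer_sum_integral : rint mu Om layer_sum /\ \I layer_sum <= 4 * N%:R + 16.
Proof.
have E h p : rint mu Om (fun x => tipl h p N x + 1) /\ \I (fun x => tipl h p N x + 1) <= N%:R + 4.
  have [r i] := tipl_integral h p N; have r1 := rint_cst mO fO 1.
  split; first exact: (rintD mO).
  rewrite (RintD mO r r1) lerD// Rintegral_cst//; last exact: mO.
  by rewrite mul1r measure_OmegaR.
have [r1 i1] := E true true; have [r2 i2] := E true false.
have [r3 i3] := E false true; have [r4 i4] := E false false.
have r12 := rintD mO r1 r2; have r34 := rintD mO r3 r4.
split; first exact: (rintD mO).
rewrite /layer_sum (RintD mO r12 r34) (RintD mO r1 r2) (RintD mO r3 r4).
apply: le_trans (lerD (lerD i1 i2) (lerD i3 i4)) _.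
by rewrite le_eqVlt; apply/orP; left; apply/eqP; ring.
Qed.

Lemma quad_tip_density x : Om x ->
  alpha x * (partial ord0 quad_tip x * partial ord0 quad_tip x +
             partial ord_max quad_tip x * partial ord_max quad_tip x) <=
  8 * slope_const S * (M / N%:R ^+ 2 + 1) * layer_sum x.
Proof.
move=> Ox; have a0 : 0 <= alpha x by rewrite (le_trans ler01)// alpha1.
have c0 : 0 <= slope_const S :> R by rewrite sqr_ge0.
have tip_le i h p : alpha x * partial i (tipf h p) x ^+ 2 <=
    slope_const S * (M / N%:R ^+ 2 + 1) * (tipl h p N x + 1).
  apply: le_trans (ler_wpM2l a0 (tipf_gradient h p i x)) _.
  rewrite (_ : alpha x * _ = slope_const S * (alpha x * slope_weight (tip_s h p) (tip_t h) N x ^+ 2) *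
    (tipl h p N x + 1)).
    rewrite ler_wpM2r ?addr_ge0 ?tipl_ge0// ler_wpM2l//; exact: alpha_weight.
  by move: (slope_const _) (slope_weight _ _ _ _) (tipl _ _ _ _) (alpha x) => *; ring.
have part i : alpha x * partial i quad_tip x ^+ 2 <=
    4 * slope_const S * (M / N%:R ^+ 2 + 1) * layer_sum x.
  apply: le_trans (ler_wpM2l a0 (quad_tip_gradient i x)) _.
  have := tip_le i true true; have := tip_le i true false.
  have := tip_le i false true; have := tip_le i false false; rewrite /layer_sum; clear.
  move: (partial i (tipf true true) x) (partial i (tipf true false) x).
  move: (partial i (tipf false true) x) (partial i (tipf false false) x) => u1 u2 u3 u4.
  rewrite -[4 * slope_const S * _]mulrA.
  move: (slope_const S * _) (alpha x) => B a.
  move: (tipl _ _ _ _) (tipl _ _ _ _) (tipl _ _ _ _) (tipl _ _ _ _) => l1 l2 l3 l4 h1 h2 h3 h4.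
  rewrite (_ : a * _ = 4 * ((a * u3 ^+ 2 + a * u4 ^+ 2) + (a * u1 ^+ 2 + a * u2 ^+ 2))); last by ring.
  rewrite -mulrA ler_wpM2l// [B * (_ + _)]mulrDr ![B * (_ + 1 + _)]mulrDr.
  by apply: lerD; apply: lerD.
rewrite -!expr2 mulrDr; apply: le_trans (lerD (part _) (part _)) _.
by rewrite le_eqVlt; apply/orP; left; apply/eqP; ring.
Qed.

Lemma quad_tip_energy :
  gform alpha quad_tip quad_tip <= 8 * slope_const S * (M / N%:R ^+ 2 + 1) * (4 * N%:R + 16).
Proof.
have [r i] := layer_sum_integral.
have M0 : 0 <= M / N%:R ^+ 2.
  have O0 : Om (0, 0) by split; rewrite /= ltrN10 ltr01.
  by rewrite divr_ge0 ?sqr_ge0// (le_trans _ (alphaM O0))// (le_trans ler01)// alpha1.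
have c0 : 0 <= 8 * slope_const S * (M / N%:R ^+ 2 + 1) by rewrite mulr_ge0 ?addr_ge0// mulr_ge0// sqr_ge0.
apply: le_trans (ler_wpM2l c0 i); rewrite -(RintZ mO _ r).
apply: (le_Rintegral mO).
- exact: (gform_rint malpha alpha1 alphaM Cc_quad_tip Cc_quad_tip).
- exact: (rintZ mO).
- exact: quad_tip_density.
Qed.

End Energy.
End FixedScale.

(** Here [q + 1 <= 2] and [4 * n + 16 <= 24 * s], and [384 = 8 * 2 * 24]. *)
Lemma tip_energy_constant (c q s n : R) : 0 <= c -> 0 <= q -> q <= 1 -> 1 <= s -> n <= 2 * s ->
  8 * c * (q + 1) * (4 * n + 16) <= 384 * c * s.
Proof.
move=> c0 q0 q1 s1 ns.
rewrite (_ : 384 * c * s = 8 * c * (2 * (24 * s))); last by ring.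
rewrite -mulrA ler_wpM2l ?mulr_ge0//.
apply: (@le_trans _ _ ((q + 1) * (24 * s))).
  by rewrite ler_wpM2l ?addr_ge0//; lra.
by rewrite ler_wpM2r; lra.
Qed.

Lemma test_function : exists2 C : R, 0 < C & forall (M : R) (alpha : R * R -> R),
  1 < M -> @measurable_fun _ _ PT R Om alpha ->
  (forall x, Om x -> 1 <= alpha x) -> (forall x, Om x -> alpha x <= M) ->
  (forall x, Om x -> 1 < `|x.1| + `|x.2| -> alpha x <= 1) ->
  exists phi, [/\ Cc_infty phi, forall x, 0 <= phi x,
    forall x, `|x.1| <= 4^-1 -> `|x.2| <= 4^-1 -> phi x = 1 &
    gform alpha phi phi <= C * Num.sqrt M].
Proof.
have [S S0 step'S] := @derive1_step_bounded R.
exists (384 * slope_const S); first by apply: mulr_gt0; [exact: ltr0Sn|exact/exprn_gt0/mulr_gt0].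
move=> M alpha M1 malpha a1 aM ad.
have s1 : 1 < Num.sqrt M by rewrite -sqrtr1 ltr_sqrt// (lt_trans ltr01).
(* This choice balances the two costs: [M / N^2 <= 1] and [N <= 2 * sqrt M]. *)
pose N := (Num.truncn (Num.sqrt M)).+1.
have Ngt : Num.sqrt M < N%:R by exact: truncnS_gt.
have Nle : N%:R <= 2 * Num.sqrt M.
  have := truncn_le (Num.sqrt M); rewrite (ltW (lt_trans ltr01 s1)) /N -natr1 => H.
  move: s1 H; move: (Num.sqrt M) (_ %:R) => u v *; lra.
have MN : M / N%:R ^+ 2 <= 1.
  rewrite ler_pdivrMr ?exprn_gt0 ?ltr0n// mul1r.
  rewrite -[leLHS]sqr_sqrtr ?(ltW (lt_trans ltr01 M1))//.
  by rewrite lerXn2r ?nnegrE// ltW.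
have N0 : (0 < N)%N by [].
exists (quad_tip N); split.
- exact: Cc_quad_tip.
- exact: quad_tip_ge0.
- by move=> *; exact: quad_tip1.
apply: le_trans (quad_tip_energy S0 step'S N0 malpha a1 aM ad) _.
have c0 : 0 <= slope_const S :> R by rewrite sqr_ge0.
have M0 : 0 <= M / N%:R ^+ 2.
  by rewrite divr_ge0 ?sqr_ge0// ltW// (lt_trans ltr01).
exact: (tip_energy_constant c0 M0 MN (ltW s1) Nle).
Qed.

End TestFunction.

(** * The load and the vertices of its support *)

Section CornerAndLoad.
Variable R : realType.
Implicit Types (x : R * R) (i : 'I_2) (phi v : R * R -> R).
Local Notation leb := (@lebesgue_measure R).
Local Notation mu := (@plane_measure R).
Local Notation Rm := (measurableTypeR R).
Local Notation PT := (measurableTypeR R * measurableTypeR R)%type.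
Local Notation Om := (@Omega R).
Local Notation I1 := (@I1 R).
Local Notation mO := (@measurable_Omega R).
Local Notation fO := (@finite_Omega R).
Local Notation sq := (sqint mu Om).
Local Notation "\I f" := (\int[mu]_(x in Om) f x) (at level 36, f at level 36).

Lemma measurable_coord1 : @measurable_fun _ _ PT R setT (fun x => x.1).
Proof. exact: (@measurable_fst _ _ Rm Rm). Qed.

Lemma measurable_coord2 : @measurable_fun _ _ PT R setT (fun x => x.2).
Proof. exact: (@measurable_snd _ _ Rm Rm). Qed.

Lemma measurable_ltset (f g : R * R -> R) : @measurable_fun _ _ PT R setT f ->
  @measurable_fun _ _ PT R setT g -> @measurable _ PT [set x | f x < g x].
Proof.
move=> mf mg; have := measurable_fun_ltr mf mg.
move=> /(_ (@measurableT _ PT) [set true] I); rewrite setTI.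
by rewrite (_ : _ @^-1` _ = [set x | f x < g x]).
Qed.

Lemma measurable_andset (P Q : pred (R * R)) : @measurable _ PT [set x | P x] ->
  @measurable _ PT [set x | Q x] -> @measurable _ PT [set x | P x && Q x].
Proof.
move=> mP mQ; rewrite (_ : [set x | _] = [set x | P x] `&` [set x | Q x]).
  exact: (@measurableI _ PT).
by apply/seteqP; split => x /=; [move/andP|case=> -> ->].
Qed.

Lemma measurable_boolO (P : pred (R * R)) : @measurable _ PT [set x | P x] ->
  @measurable_fun _ _ PT R Om (fun x => (P x)%:R).
Proof. by apply: measurable_fun_boolR; exact: mO. Qed.

Lemma restrict_measurable (f : R * R -> R) : @measurable_fun _ _ PT R setT f ->
  @measurable_fun _ _ PT R Om f.
Proof. by move=> mf; apply: measurable_funS mf => //; exact: mO. Qed.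

Lemma normr_bool (b : bool) : `|b%:R| <= 1 :> R.
Proof. by case: b; rewrite ?normr1 ?normr0. Qed.

Lemma Rintegral_bool_box_eq (P : pred (R * R)) (A B : set R) (c : R) :
  @measurable _ Rm A -> @measurable _ Rm B ->
  (forall x, Om x -> P x <-> A x.1 /\ B x.2) -> (forall x, A x.1 -> B x.2 -> Om x) ->
  (leb A * leb B)%E = c%:E -> \I (fun x => (P x)%:R) = c.
Proof.
move=> mA mB PAB ABO ABc.
have -> : \I (fun x => (P x)%:R) = \I (fun x => (P x)%:R * 1).
  by apply: eq_Rintegral => x _; rewrite mulr1.
rewrite Rintegral_boolM (_ : [set x | Om x /\ P x] = A `*` B); last first.
  apply/seteqP; split => x /= [a b]; first exact/PAB.
  by have Ox := ABO _ a b; split => //; apply/PAB.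
rewrite Rintegral_cst; last by apply: (@measurableX _ _ Rm Rm).
have E : fine (mu (A `*` B)) = c by rewrite (rect_measure mA mB) ABc.
by rewrite mul1r; exact: E.
Qed.

Lemma Rintegral_mul0 v : \I (fun x => 0 * v x) = 0.
Proof.
transitivity (\I (fun=> 0 : R)); first by apply: eq_Rintegral => x _; rewrite mul0r.
by rewrite (Rintegral_cst _ mO) mul0r.
Qed.

Lemma H10_identity1 i (k H : R * R -> R) v : sq k -> sq H ->
  (forall phi, Cc_infty phi -> \I (fun x => k x * phi x) = \I (fun x => H x * partial i phi x)) ->
  Sobolev_H10 v -> \I (fun x => k x * v x) = \I (fun x => H x * wpartial i v x).
Proof.
move=> sk sH id Hv; pose H2 j : R * R -> R := if j == i then H else fun=> 0.
have E (g : 'I_2 -> R * R -> R) : \I (fun x => H2 ord0 x * g ord0 x) +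
    \I (fun x => H2 (lift ord0 ord0) x * g (lift ord0 ord0) x) = \I (fun x => H x * g i x).
  rewrite /H2; have [->|->] : i = ord0 \/ i = lift ord0 ord0.
  - by case: (i) => -[|[|//]] ?; [left|right]; exact/val_inj.
  - by rewrite /= Rintegral_mul0 addr0.
  - by rewrite /= Rintegral_mul0 add0r.
rewrite -(E (fun j => wpartial j v)); apply: H10_identity => // [j|phi cphi].
  by rewrite /H2; case: ifP => _ //; exact: (sqint_cst mO fO).
by rewrite (E (fun j => partial j phi)) id.
Qed.

(* On a line in direction [i], [tc] is the fixed and [sc] the varying coordinate. *)
Definition tc i x := if i == ord0 then x.2 else x.1.
Definition sc i x := if i == ord0 then x.1 else x.2.

Lemma line_tc i t s : tc i (line i t s) = t /\ sc i (line i t s) = s.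
Proof. by rewrite /line /tc /sc; case: (i == ord0). Qed.

Lemma line_coords i x : line i (tc i x) (sc i x) = x.
Proof. by rewrite /line /tc /sc; case: x => a b; case: (i == ord0). Qed.

Lemma measurable_tc i : @measurable_fun _ _ PT R setT (tc i).
Proof. by rewrite /tc; case: (i == ord0); [exact: measurable_coord2|exact: measurable_coord1]. Qed.

Lemma measurable_sc i : @measurable_fun _ _ PT R setT (sc i).
Proof. by rewrite /sc; case: (i == ord0); [exact: measurable_coord1|exact: measurable_coord2]. Qed.

Lemma measurable_ramp (a b s : R * R -> R) : @measurable_fun _ _ PT R setT a ->
  @measurable_fun _ _ PT R setT b -> @measurable_fun _ _ PT R setT s ->
  @measurable_fun _ _ PT R setT (fun x => ramp (a x) (b x) (s x)).
Proof.
move=> ma mb ms; apply: measurable_minr; last exact: measurable_funB.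
by apply: measurable_maxr; [exact: measurable_funB|exact: measurable_cst].
Qed.

Lemma measurable_betw (f : R * R -> R) (a b : R) : @measurable_fun _ _ PT R setT f ->
  @measurable _ PT [set x | a < f x < b].
Proof.
move=> mf; apply: (measurable_andset (P := fun x => a < f x) (Q := fun x => f x < b)).
  exact: (measurable_ltset (measurable_cst a) mf).
exact: (measurable_ltset mf (measurable_cst b)).
Qed.

(** * Functions in H^1_0 cannot stay away from 0 near a boundary point *)

Section Corner.
Variables (i : 'I_2) (far : bool) (v : R * R -> R) (c r e : R).
Hypothesis Hv : Sobolev_H10 v.
Hypothesis c0 : 0 < c.
Hypothesis r1 : r ^+ 2 = 1.
Hypothesis e0 : 0 < e.
Hypothesis e8 : e <= 8^-1.

(** [far] selects the end [s = 1] or [s = -1] of the line. The squares with [h < t < 2 * h] and [s]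
    between [2 * h] and [3 * h] away from that end lie in the support of the load at each of its
    vertices. *)
Definition corner_start h : R := if far then 1 - 3 * h else -1 + 2 * h.

Hypothesis corner_value : forall h t s, 0 < h -> h <= e -> h < t < 2 * h ->
  corner_start h < s < corner_start h + h -> c <= r * v (line i t s).

Definition strip h x := h < tc i x < 2 * h.
Definition corner h x := strip h x && (corner_start h < sc i x < corner_start h + h).
(** The constant is chosen so that the weight vanishes on the side away from the boundary. Its
    support then lies in [corner_box], of area of order [h ^+ 2]. *)
Definition corner_ramp h x : R := (strip h x)%:R *
  ((if far then 0 else h) - ramp (corner_start h) (corner_start h + h) (sc i x)).
Definition corner_box h x := strip h x &&
  ((if far then 1 - 3 * h else -1) <= sc i x <= (if far then 1 else -1 + 3 * h)).

Lemma measurable_strip h : @measurable _ PT [set x | strip h x].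
Proof. exact: (measurable_betw _ _ (measurable_tc i)). Qed.

Lemma measurable_corner h : @measurable _ PT [set x | corner h x].
Proof.
apply: measurable_andset; first exact: measurable_strip.
exact: (measurable_betw _ _ (measurable_sc i)).
Qed.

Lemma measurable_corner_ramp h : @measurable_fun _ _ PT R Om (corner_ramp h).
Proof.
apply: measurable_funM; first exact: (measurable_boolO (measurable_strip h)).
apply: measurable_funB; first exact: measurable_cst.
apply: restrict_measurable; apply: measurable_ramp.
- exact: measurable_cst.
- exact: measurable_cst.
- exact: measurable_sc.
Qed.

Lemma measurable_corner_box h : @measurable _ PT [set x | corner_box h x].
Proof.
apply: measurable_andset; first exact: measurable_strip.
have -> : [set x | (if far then 1 - 3 * h else -1) <= sc i x <= (if far then 1 else -1 + 3 * h)] =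
    setT `&` sc i @^-1` `[(if far then 1 - 3 * h else -1), (if far then 1 else -1 + 3 * h)]%classic.
  by rewrite setTI; apply/seteqP; split => x; rewrite /= in_itv.
exact: (measurable_sc i (@measurableT _ PT) (measurable_itv _)).
Qed.

Lemma corner_ramp_bound h x : 0 < h -> Om x -> corner_ramp h x ^+ 2 <= h ^+ 2 * (corner_box h x)%:R.
Proof.
move=> h0 Ox; rewrite /corner_ramp /corner_box; case: (strip h x) => /=; last first.
  by rewrite mul0r expr0n mulr0.
rewrite mul1r; set s := sc i x.
have [s1 s2] : -1 < s /\ s < 1.
  by move: Ox; rewrite /s /sc => -[/andP[? ?] /andP[? ?]]; case: (i == ord0).
have ab : corner_start h <= corner_start h + h by rewrite lerDl ltW.
have -> : ((if far then 1 - 3 * h else -1) <= s <= (if far then 1 else -1 + 3 * h)) =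
    (if far then 1 - 3 * h <= s else s <= -1 + 3 * h).
  by case: far; rewrite ?(ltW s1) ?(ltW s2) ?andbT.
have [H|H] := boolP (if far then _ else _).
  rewrite mulr1; have := ramp_ge0 s ab; have := ramp_le (corner_start h) (corner_start h + h) s.
  rewrite addrAC subrr add0r; move: (ramp _ _ _) => z; case: far => *; nra.
rewrite mulr0; move: H; rewrite /corner_start in ab *; case: far ab => ab.
  rewrite -ltNge => H; rewrite ramp_left ?subr0 ?expr0n//; exact: ltW.
rewrite -ltNge => H; rewrite ramp_right//; last by lra.
by rewrite [X in _ - X]addrAC subrr add0r subrr expr0n.
Qed.

Lemma corner_identity h phi : 0 < h -> h <= e -> Cc_infty phi ->
  \I (fun x => (corner h x)%:R * phi x) = \I (fun x => corner_ramp h x * partial i phi x).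
Proof.
move=> h0 he; have h8 := le_trans he e8.
apply: (slice_identity (C := 1)).
- exact: (measurable_boolO (measurable_corner h)).
- exact: measurable_corner_ramp.
- by move=> x _; exact: normr_bool.
- move=> x Ox; rewrite -(@ler_pXn2r _ 2) ?nnegrE// real_normK ?num_real// expr1n.
  apply: le_trans (corner_ramp_bound h0 Ox) _; case: corner_box; last by rewrite mulr0 ler01.
  by rewrite mulr1 expr_le1 ?ltW//; lra.
move=> t It g Cg g0.
have [I|I] := boolP (h < t < 2 * h); last first.
  transitivity (\int[leb]_(s in I1) (0 : R)); last apply/esym; apply: eq_Rintegral => s _;
    rewrite /corner /corner_ramp /strip (line_tc i t s).1 (negbTE I) ?mul0r//.
have := line_ramp (if far then 0 else h) Cg g0 (a := corner_start h) (b := corner_start h + h).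
rewrite /corner_start => H.
transitivity (\int[leb]_(s in I1) ((corner_start h < s < corner_start h + h)%R%:R * g s)).
  by apply: eq_Rintegral => s _; rewrite /corner /strip (line_tc i t s).1 (line_tc i t s).2 I.
rewrite /corner_start H; first last.
- by case: far; lra.
- by case: far; lra.
- by rewrite lerDl ltW.
- by case: far; lra.
apply: eq_Rintegral => s _.
by rewrite /corner_ramp /strip (line_tc i t s).1 (line_tc i t s).2 I mul1r.
Qed.

(** All powers of [h] cancel, as the Dirichlet energy in the plane is scale invariant; the bound is
    therefore the same in every strip. *)
Lemma corner_scaling (c' h B I1' I2 : R) : 0 < h -> c' * h ^+ 2 <= r * I1' ->
  0 <= c' -> I1' ^+ 2 <= I2 * B -> 0 <= B -> I2 <= h ^+ 2 * (3 * h ^+ 2) -> c' ^+ 2 <= 3 * B.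
Proof.
move=> h0 lo c'0 up B0 I2h; have h4 : 0 < h ^+ 4 by rewrite exprn_gt0.
rewrite -(ler_pM2r h4); apply: (@le_trans _ _ (I2 * B)).
  apply: le_trans up; rewrite -[leRHS]mul1r -r1 -exprMn.
  have -> : c' ^+ 2 * h ^+ 4 = (c' * h ^+ 2) ^+ 2 by ring.
  have l0 : 0 <= c' * h ^+ 2 by rewrite mulr_ge0// sqr_ge0.
  by rewrite lerXn2r ?nnegrE//; apply: le_trans lo.
apply: le_trans (ler_wpM2r B0 I2h) _.
by rewrite le_eqVlt; apply/orP; left; apply/eqP; ring.
Qed.

Lemma leb_itv_oo (a b : R) : a <= b -> leb `]a, b[%classic = (b - a)%:E.
Proof.
move=> ab; rewrite lebesgue_measure_itv /= lte_fin; case: ltP => [_|ba].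
  by rewrite EFinD.
by rewrite (_ : b - a = 0)//; apply/eqP; rewrite subr_eq0 eq_le ab ba.
Qed.

Lemma leb_itv_cc (a b : R) : a <= b -> leb `[a, b]%classic = (b - a)%:E.
Proof.
move=> ab; rewrite lebesgue_measure_itv /= lte_fin; case: ltP => [_|ba].
  by rewrite EFinD.
by rewrite (_ : b - a = 0)//; apply/eqP; rewrite subr_eq0 eq_le ab ba.
Qed.

Lemma corner_area h : 0 < h -> h <= e -> \I (fun x => (corner h x)%:R) = h ^+ 2.
Proof.
move=> h0 he; have h8 := le_trans he e8.
pose A : set R := `]h, 2 * h[%classic.
pose B : set R := `]corner_start h, corner_start h + h[%classic.
have mA : @measurable _ Rm A by exact: measurable_itv.
have mB : @measurable _ Rm B by exact: measurable_itv.
have lA : leb A = h%:E by rewrite leb_itv_oo; [congr EFin|]; lra.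
have lB : leb B = h%:E.
  by rewrite leb_itv_oo ?lerDl ?ltW//; congr EFin; rewrite addrAC subrr add0r.
have iAB x : corner h x <-> A (tc i x) /\ B (sc i x).
  by rewrite /corner /strip /A /B /= !in_itv /=; split => [/andP[]|[-> ->]].
have [cs0 cs1] : -1 < corner_start h /\ corner_start h + h < 1.
  by rewrite /corner_start; case: far; split; lra.
have AO (a b : R) : A a -> B b -> [/\ -1 < a, a < 1, -1 < b & b < 1].
  rewrite /A /B /= !in_itv /= => /andP[a1 a2] /andP[b1 b2].
  by move: (corner_start h) cs0 cs1 b1 b2 => z *; split; lra.
move: iAB; rewrite /tc /sc; case: (i == ord0) => iAB.
- apply: (Rintegral_bool_box_eq mB mA).
  + by move=> x _; rewrite iAB; split => -[].
  + by move=> x b a; have [a1 a2 b1 b2] := AO _ _ a b; split; rewrite ?a1 ?a2 ?b1 ?b2.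
  + by rewrite [RHS]EFinM lA lB.
- apply: (Rintegral_bool_box_eq mA mB).
  + by move=> x _; rewrite iAB.
  + by move=> x a b; have [a1 a2 b1 b2] := AO _ _ a b; split; rewrite ?a1 ?a2 ?b1 ?b2.
  + by rewrite [RHS]EFinM lA lB.
Qed.

Lemma corner_box_area h : 0 < h -> \I (fun x => (corner_box h x)%:R) <= 3 * h ^+ 2.
Proof.
move=> h0.
pose A : set R := `]h, 2 * h[%classic.
pose a0 := if far then 1 - 3 * h else -1; pose b0 := if far then 1 else -1 + 3 * h.
pose B : set R := `[a0, b0]%classic.
have mA : @measurable _ Rm A by exact: measurable_itv.
have mB : @measurable _ Rm B by exact: measurable_itv.
have lA : leb A = h%:E by rewrite leb_itv_oo; [congr EFin|]; lra.
have lB : leb B = (3 * h)%:E.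
  by rewrite leb_itv_cc /a0 /b0; [congr EFin|]; case: far; lra.
have E3 : 3 * h ^+ 2 = h * (3 * h) by ring.
have iAB x : corner_box h x -> A (tc i x) /\ B (sc i x).
  by rewrite /corner_box /strip /A /B /a0 /b0 /= !in_itv /= => /andP[].
move: (measurable_corner_box h) iAB; rewrite /tc /sc; case: (i == ord0) => mP iAB.
- apply: (proj2 (Rintegral_bool_box mP mB mA _ _)) => [x /iAB[]//|].
  by rewrite E3 [RHS]EFinM lA lB muleC.
- apply: (proj2 (Rintegral_bool_box mP mA mB _ _)) => [x /iAB[]//|].
  by rewrite E3 [RHS]EFinM lA lB.
Qed.

Lemma corner_energy h : 0 < h -> h <= e ->
  c ^+ 2 <= 3 * \I (fun x => (strip h x)%:R * wpartial i v x ^+ 2).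
Proof.
move=> h0 he.
have mc := measurable_boolO (measurable_corner h).
have ms := measurable_boolO (measurable_strip h).
have mb := measurable_boolO (measurable_corner_box h).
have bool1 (P : pred (R * R)) x : Om x -> `|(P x)%:R| <= 1 :> R by move=> _; exact: normr_bool.
have sc_ : sq (fun x => (corner h x)%:R) := sqint_bounded mO fO mc (bool1 _).
have rb : rint mu Om (fun x => (corner_box h x)%:R) := rint_bounded mO fO mb (bool1 _).
have sH : sq (corner_ramp h).
  apply: (sqint_bounded mO fO (measurable_corner_ramp h) (C := h)) => x Ox.
  rewrite -(@ler_pXn2r _ 2) ?nnegrE ?(ltW h0)// real_normK ?num_real//.
  apply: le_trans (corner_ramp_bound h0 Ox) _; rewrite ler_piMr ?sqr_ge0//.
  by case: corner_box.
have sg := wpartial_sqint i (H10_H1 Hv).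
have sg1 : sq (fun x => (strip h x)%:R * wpartial i v x) := sqint_bM mO ms (bool1 _) sg.
have id := H10_identity1 sc_ sH (fun phi => @corner_identity h phi h0 he) Hv.
apply: (@corner_scaling _ h _ (\I (fun x => (corner h x)%:R * v x)) (\I (fun x => corner_ramp h x ^+ 2))).
- exact: h0.
- have rv : rint mu Om (fun x => (corner h x)%:R * v x).
    exact: (sqintM mO sc_ (H10_sqint Hv)).
  have rc : rint mu Om (fun x => (corner h x)%:R) := sqint_rint mO fO sc_.
  rewrite -(corner_area h0 he) -(RintZ mO _ rc) -(RintZ mO _ rv).
  apply: (le_Rintegral mO (rintZ mO _ rc) (rintZ mO _ rv)) => x _.
  have [|_] := boolP (corner h x); last by rewrite mul0r !mulr0.
  rewrite mulr1 mul1r => /andP[s1 s2].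
  by have := corner_value h0 he s1 s2; rewrite line_coords.
- exact: ltW.
- rewrite id; have -> : \I (fun x => corner_ramp h x * wpartial i v x) =
      \I (fun x => corner_ramp h x * ((strip h x)%:R * wpartial i v x)).
    apply: eq_Rintegral => x _; rewrite /corner_ramp.
    by case: (strip h x); rewrite ?mul1r ?mul0r.
  apply: le_trans (Cauchy_Schwarz mO sH sg1) _; rewrite le_eqVlt; apply/orP; left; apply/eqP.
  congr (_ * _); apply: eq_Rintegral => x _; rewrite exprMn.
  by case: (strip h x); rewrite ?expr1n ?mul1r// expr0n.
- by apply: Rintegral_ge0 => x _; rewrite mulr_ge0// sqr_ge0.
- apply: le_trans (ler_wpM2l (sqr_ge0 h) (corner_box_area h0)).
  rewrite -(RintZ mO _ rb).
  apply: (le_Rintegral mO (proj2 sH) (rintZ mO _ rb)) => x Ox.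
  exact: corner_ramp_bound.
Qed.

(* The strips [h < tc < 2 h] for [h = e / 2 ^ n] are disjoint and each carries at
   least [c ^+ 2 / 3] of the finite energy of [v]. *)
Lemma corner_absurd : False.
Proof.
have sg := wpartial_sqint i (H10_H1 Hv); have rg := proj2 sg.
pose h n : R := e / 2 ^+ n.
have h0 n : 0 < h n by rewrite divr_gt0// exprn_gt0.
have hS n : 2 * h n.+1 = h n.
  by rewrite /h exprS invfM mulrCA; congr (_ * _); rewrite mulrA mulfV ?mul1r.
have he n : h n <= e.
  by rewrite ler_pdivrMr ?exprn_gt0// ler_peMr ?(ltW e0)// exprn_ege1// ler1n.
(* [U n] contains the strips of [h 0] up to [h n.-1]. *)
pose U n x := 2 * h n < tc i x.
have bool1 (P : pred (R * R)) x : Om x -> `|(P x)%:R| <= 1 :> R by move=> _; exact: normr_bool.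
have mU n : @measurable _ PT [set x | U n x].
  by apply: measurable_ltset; [exact: measurable_cst|exact: measurable_tc].
have rU n : rint mu Om (fun x => (U n x)%:R * wpartial i v x ^+ 2).
  exact: (rint_bM mO (measurable_boolO (mU n)) (bool1 _) rg).
have rS n : rint mu Om (fun x => (strip (h n) x)%:R * wpartial i v x ^+ 2).
  exact: (rint_bM mO (measurable_boolO (measurable_strip _)) (bool1 _) rg).
have claim n : n%:R * c ^+ 2 <= 3 * \I (fun x => (U n x)%:R * wpartial i v x ^+ 2).
  elim: n => [|n ih].
    rewrite mul0r mulr_ge0//; apply: Rintegral_ge0 => x _.
    by rewrite mulr_ge0// sqr_ge0.
  rewrite -natr1 mulrDl mul1r; apply: le_trans (lerD ih (corner_energy (h0 n) (he n))) _.
  rewrite -mulrDr ler_wpM2l// -(RintD mO (rU n) (rS n)).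
  apply: (le_Rintegral mO (rintD mO (rU n) (rS n)) (rU n.+1)) => x _.
  rewrite -mulrDl ler_wpM2r ?sqr_ge0// /U /strip hS.
  have [H|H] := ltP (2 * h n) (tc i x); last first.
    by rewrite add0r; case: (h n < tc i x) => //=; case: (_ < _).
  rewrite [tc i x < _]ltNge (ltW H) andbF addr0.
  by rewrite (lt_trans _ H)// mulr_natl mulr2n ltrDl.
pose G := \I (fun x => wpartial i v x ^+ 2).
have bound n : n%:R * c ^+ 2 <= 3 * G.
  apply: le_trans (claim n) _; rewrite ler_wpM2l//.
  apply: (le_Rintegral mO (rU n) rg) => x _; case: (U n x); rewrite ?mul1r// mul0r.
  exact: sqr_ge0.
have c2 : 0 < c ^+ 2 by rewrite exprn_gt0.
have := bound (Num.truncn (3 * G / c ^+ 2)).+1.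
by rewrite -ler_pdivlMr// leNgt truncnS_gt.
Qed.

End Corner.

Definition load x := (0 < x.1) && (x.1 < 1 - `|x.2|).

Lemma measurable_load : @measurable _ PT [set x | load x].
Proof.
apply: measurable_andset.
  exact: measurable_gt_fst.
apply: (measurable_ltset measurable_coord1).
apply: measurable_funB; first exact: measurable_cst.
by apply: measurableT_comp => //; exact: measurable_coord2.
Qed.

Lemma load_sqint : sq (fun x => (load x)%:R).
Proof.
apply: (sqint_bounded mO fO (measurable_boolO measurable_load) (C := 1)) => x _.
exact: normr_bool.
Qed.

(** The weight vanishes to the right of the load and is constant between the left side and the load,
    so it only sees derivatives along segments in the phase [M] of the second problem. *)
Definition load_ramp x : R := 1 - `|x.2| - ramp 0 (1 - `|x.2|) x.1.

Lemma measurable_load_ramp : @measurable_fun _ _ PT R Om load_ramp.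
Proof.
apply: restrict_measurable.
have m : @measurable_fun _ _ PT R setT (fun x : R * R => 1 - `|x.2|).
  apply: measurable_funB; first exact: measurable_cst.
  by apply: measurableT_comp => //; exact: measurable_coord2.
apply: measurable_funB => //.
have m0 : @measurable_fun _ _ PT R setT (fun=> 0) by exact: measurable_cst.
exact: (measurable_ramp m0 m measurable_coord1).
Qed.

Lemma load_ramp_bound x : Om x -> `|load_ramp x| <= 1.
Proof.
move=> [_ /andP[y1 y2]]; have yb : `|x.2| < 1 by rewrite ltr_norml y1.
have b0 : 0 <= 1 - `|x.2| by rewrite subr_ge0 ltW.
rewrite /load_ramp ger0_norm.
  have := ramp_ge0 x.1 b0; have := normr_ge0 x.2; lra.
by rewrite subr_ge0; have := ramp_le 0 (1 - `|x.2|) x.1; rewrite subr0.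
Qed.

Lemma load_identity phi : Cc_infty phi ->
  \I (fun x => (load x)%:R * phi x) = \I (fun x => load_ramp x * partial ord0 phi x).
Proof.
apply: (slice_identity (C := 1)).
- exact: (measurable_boolO measurable_load).
- exact: measurable_load_ramp.
- by move=> x _; exact: normr_bool.
- exact: load_ramp_bound.
move=> t It g Cg g0; have tb : `|t| < 1.
  by move: It; rewrite /I1 /= in_itv /= => /andP[t1 t2]; rewrite ltr_norml t1.
have t0 := normr_ge0 t.
by apply: (line_ramp (1 - `|t|) Cg g0 (a := 0) (b := 1 - `|t|)); lra.
Qed.

(** Where the weight is nonzero the squared derivative is at most [M^-1] times the energy density.
    The factor 4 is the area of [Omega], on which the weight is bounded by 1. *)
Lemma load_upper (M : R) (alpha : R * R -> R) phi : 0 < M ->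
  @measurable_fun _ _ PT R Om alpha ->
  (forall x, Om x -> 1 <= alpha x) -> (forall x, Om x -> alpha x <= M) ->
  (forall x, Om x -> x.1 + `|x.2| < 1 -> alpha x = M) -> Cc_infty phi ->
  (\I (fun x => (load x)%:R * phi x)) ^+ 2 <= 4 / M * gform alpha phi phi.
Proof.
move=> M0 ma a1 aM aE cphi; rewrite load_identity//.
pose close_ (x : R * R) := x.1 + `|x.2| < 1.
have m1 : @measurable _ PT [set x | close_ x].
  apply: measurable_ltset; last exact: measurable_cst.
  apply: measurable_funD; first exact: measurable_coord1.
  by apply: measurableT_comp => //; exact: measurable_coord2.
have sg := Cc_sqint (Cc_partial ord0 cphi).
have sg1 : sq (fun x => (close_ x)%:R * partial ord0 phi x).
  apply: (sqint_bM mO (measurable_boolO m1) _ sg (C := 1)) => x _.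
  exact: normr_bool.
have sH : sq load_ramp := sqint_bounded mO fO measurable_load_ramp load_ramp_bound.
have -> : \I (fun x => load_ramp x * partial ord0 phi x) =
    \I (fun x => load_ramp x * ((close_ x)%:R * partial ord0 phi x)).
  apply: eq_Rintegral => x /set_mem Ox; rewrite /close_.
  have [n|f] := ltP (x.1 + `|x.2|) 1; first by rewrite mul1r.
  rewrite mul0r mulr0 /load_ramp ramp_right ?subr0 ?subrr ?mul0r//.
    by move: Ox => [_ /andP[y1 y2]]; rewrite subr_ge0 ltW// ltr_norml y1.
  by rewrite lerBlDr.
apply: le_trans (Cauchy_Schwarz mO sH sg1) _.
have H4 : \I (fun x => load_ramp x ^+ 2) <= 4.
  rewrite -(measure_OmegaR R) -[leRHS]mul1r -(Rintegral_cst _ mO).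
  apply: (le_Rintegral mO (proj2 sH) (rint_cst mO fO 1)) => x Ox.
  have := load_ramp_bound Ox; rewrite -real_normK ?num_real//.
  by move=> h; rewrite expr_le1.
rewrite -mulrA; apply: ler_pM => //.
- by apply: Rintegral_ge0 => x _; exact: sqr_ge0.
- by apply: Rintegral_ge0 => x _; exact: sqr_ge0.
rewrite -(RintZ mO _ (gform_rint ma a1 aM cphi cphi)).
apply: (le_Rintegral mO (proj2 sg1)).
  exact: (rintZ mO _ (gform_rint ma a1 aM cphi cphi)).
move=> x Ox; rewrite exprMn -!expr2.
have g0 := sqr_ge0 (partial ord0 phi x); have g1 := sqr_ge0 (partial ord_max phi x).
rewrite /close_; have [n|f] := ltP (x.1 + `|x.2|) 1.
  by rewrite (aE _ Ox n) mulrA mulVf ?gt_eqF// expr1n !mul1r lerDl sqr_ge0.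
have -> : false%:R ^+ 2 * partial ord0 phi x ^+ 2 = 0 by rewrite expr0n mul0r.
apply: mulr_ge0; first by rewrite invr_ge0 ltW.
by apply: mulr_ge0; [rewrite (le_trans ler01)// a1|rewrite addr_ge0 ?sqr_ge0].
Qed.

(** If [L] were nonzero, [v] would have the sign of [L] and absolute value at least [|L| / 2] on all
    small corner squares, against [corner_absurd]. *)
Lemma vertex_value i far v (L p q : R) : Sobolev_H10 v ->
  (forall h t s, 0 < h -> h <= 8^-1 -> h < t < 2 * h ->
    corner_start far h < s < corner_start far h + h ->
    v (line i t s) = L + p * t + q * (s - (if far then 1 else -1))) -> L = 0.
Proof.
move=> Hv val; apply/eqP; apply: contraT => L0.
have nL : 0 < `|L| by rewrite normr_gt0.
(* As [|t| <= 2 * h] and the offset of [s] is at most [3 * h], the value differs from [L] by at most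
   [d * h]. *)
pose d : R := `|p| * 2 + `|q| * 3.
have d0 : 0 <= d by rewrite addr_ge0// mulr_ge0.
have d2 : 0 < 2 * (d + 1) by rewrite mulr_gt0// ltr_wpDl.
pose e : R := Num.min 8^-1 (`|L| / (2 * (d + 1))).
have e0 : 0 < e by rewrite lt_min invr_gt0 ltr0n/= divr_gt0.
have e8 : e <= 8^-1 by rewrite ge_min lexx.
have ed : e * (2 * (d + 1)) <= `|L| by rewrite -ler_pdivlMr// ge_min lexx orbT.
have c0 : 0 < `|L| / 2 by rewrite divr_gt0.
have r1 : Num.sg L ^+ 2 = 1 by rewrite sqr_sg L0.
suff : False by [].
apply: (@corner_absurd i far v (`|L| / 2) (Num.sg L) e Hv c0 r1 e0 e8) => h t s h0 he ht hs.
rewrite (val h)//; last exact: le_trans e8.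
set w := s - _; have wb : `|w| <= 3 * h.
  move: hs; rewrite /w /corner_start => /andP[s1 s2]; rewrite ler_norml.
  by apply/andP; split; move: s1 s2; case: (far); lra.
have tb : `|t| <= 2 * h.
  by move: ht => /andP[t1 t2]; rewrite ger0_norm; lra.
have sgb : `|Num.sg L| = 1 by rewrite normr_sg L0.
have B : `|Num.sg L * (p * t + q * w)| <= d * h.
  rewrite normrM sgb mul1r; apply: le_trans (ler_normD _ _) _.
  by rewrite !normrM /d mulrDl -!mulrA lerD// ler_wpM2l.
have dh : d * h <= `|L| / 2.
  have : d * h <= d * e by rewrite ler_wpM2l.
  by move: ed e0; move: `|L| => l; lra.
move: B; rewrite ler_norml => /andP[B _].
rewrite -addrA mulrDr -normrEsg.
by move: (Num.sg L * _) B dh => y; move: `|L| => l; lra.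
Qed.

(* The three vertices of the support of [load] lie on the boundary of [Omega]. *)
Lemma affine_load v (c0 c1 c2 : R) : Sobolev_H10 v ->
  (forall x, load x -> v x = c0 + c1 * x.1 + c2 * x.2) ->
  \I (fun x => (load x)%:R * v x) = 0.
Proof.
move=> Hv val.
have in_load (a b : R) : 0 < a -> a < 1 - b -> a < 1 + b -> load (a, b).
  by move=> a0 a1 a2; rewrite /load /= a0 ltrBrDl -ltrBrDr ltr_norml; apply/andP; split; lra.
have top : c0 + c2 = 0.
  apply: (@vertex_value (lift ord0 ord0) true v _ c1 c2 Hv) => h t s h0 h8 /andP[t1 t2].
  rewrite /corner_start => /andP[s1 s2]; rewrite /line /= val /=; first by ring.
  by apply: in_load; lra.
have bottom : c0 - c2 = 0.
  apply: (@vertex_value (lift ord0 ord0) false v _ c1 c2 Hv) => h t s h0 h8 /andP[t1 t2].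
  rewrite /corner_start => /andP[s1 s2]; rewrite /line /= val /=; first by ring.
  by apply: in_load; lra.
have right : c0 + c1 = 0.
  apply: (@vertex_value ord0 true v _ c2 c1 Hv) => h t s h0 h8 /andP[t1 t2].
  rewrite /corner_start => /andP[s1 s2]; rewrite /line /= val /=; first by ring.
  by apply: in_load; lra.
have [E0 E1 E2] : [/\ c0 = 0, c1 = 0 & c2 = 0] by split; lra.
transitivity (\I (fun=> 0 : R)).
  apply: eq_Rintegral => x _; have [/val ->|_] := boolP (load x); last by rewrite mul0r.
  by rewrite E0 E1 E2 !mul0r !addr0 mulr0.
by rewrite (Rintegral_cst _ mO) mul0r.
Qed.

End CornerAndLoad.

(** * Triangles *)

Section Triangles.
Variable R : realType.
Implicit Types (a b c x y : R * R) (A B K : set (R * R)) (g : R * R * R).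

Definition closed_triangle a b c : set (R * R) :=
  [set x | exists r s t : R, [/\ 0 <= r, 0 <= s, 0 <= t, r + s + t = 1 &
    x = r *: a + s *: b + t *: c]].

(** A triple of coefficients represents an affine function. Separating lines are given by explicit
    triples, and their conditions at vertices are left to linear arithmetic. *)
Definition affine g x : R := g.1.1 + g.1.2 * x.1 + g.2 * x.2.

Lemma affine_comb g a b c (r s t : R) : r + s + t = 1 ->
  affine g (r *: a + s *: b + t *: c) = r * affine g a + s * affine g b + t * affine g c.
Proof.
move=> rst; rewrite /affine /= /GRing.scale /= -[g.1.1 in LHS]mul1r -rst.
by ring.
Qed.

Lemma affine_continuous g : continuous (affine g).
Proof.
move=> x; rewrite /affine; apply: cvgD; first apply: cvgD.
- exact: cvg_cst.
- by apply: cvgM; [exact: cvg_cst|exact: cvg_fst].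
- by apply: cvgM; [exact: cvg_cst|exact: cvg_snd].
Qed.

Definition det3 a b c : R :=
  (b.1 - a.1) * (c.2 - a.2) - (b.2 - a.2) * (c.1 - a.1).

(* The barycentric coordinate at the vertex opposite to the edge [a b], up to the
   factor [det3]. *)
Definition edge_form a b : R * R * R := (a.1 * b.2 - a.2 * b.1, a.2 - b.2, b.1 - a.1).

Lemma edge_formE a b x : affine (edge_form a b) x = det3 a b x.
Proof. by rewrite /affine /edge_form /det3 /=; ring. Qed.

Lemma barycentric a b c x : noncollinear a b c ->
  x = (det3 b c x / det3 a b c) *: a + (det3 c a x / det3 a b c) *: b +
      (det3 a b x / det3 a b c) *: c.
Proof.
rewrite /noncollinear => D0.
case: a b c x D0 => [a1 a2] [b1 b2] [c1 c2] [x1 x2] /= D0.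
by congr pair; rewrite /= /GRing.scale /= /det3 /=; field.
Qed.

Lemma barycentric_sum a b c x : noncollinear a b c ->
  det3 b c x / det3 a b c + det3 c a x / det3 a b c + det3 a b x / det3 a b c = 1.
Proof.
rewrite /noncollinear => D0.
case: a b c x D0 => [a1 a2] [b1 b2] [c1 c2] [x1 x2] /= D0.
by rewrite /det3 /=; field.
Qed.

Lemma closed_edge_form (a b : R * R) (k : R) : closed [set x | 0 <= det3 a b x / k].
Proof.
have cf : continuous (fun x => det3 a b x / k).
  move=> x; apply: cvgM; last exact: cvg_cst.
  have E : det3 a b = affine (edge_form a b) by apply/funext => z; rewrite edge_formE.
  by rewrite E; exact: affine_continuous.
exact: (preimage_closed (fun x _ => cf x) (@closed_ge R 0)).
Qed.

Lemma closed_triangle_forms a b c : noncollinear a b c -> closed_triangle a b c =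
  [set x | 0 <= det3 b c x / det3 a b c] `&` [set x | 0 <= det3 c a x / det3 a b c] `&`
  [set x | 0 <= det3 a b x / det3 a b c].
Proof.
move=> D; apply/seteqP; split => x /=; last first.
  move=> [[r0 s0] t0]; do 3![eexists]; split; [exact: r0|exact: s0|exact: t0| |].
    exact: barycentric_sum.
  exact: barycentric.
move=> [r [s [t [r0 s0 t0 rst ->]]]]; rewrite -!edge_formE !affine_comb// !edge_formE.
move: D r0 s0 t0; rewrite /noncollinear.
case: a b c => [a1 a2] [b1 b2] [c1 c2] /= D r0 s0 t0; rewrite /det3 /=.
split; [split|].
- by rewrite (_ : _ / _ = r)//; field.
- by rewrite (_ : _ / _ = s)//; field.
- by rewrite (_ : _ / _ = t)//; field.
Qed.

Lemma closed_closed_triangle a b c : noncollinear a b c -> closed (closed_triangle a b c).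
Proof.
move=> D; rewrite closed_triangle_forms//.
by apply: closedI; [apply: closedI|]; exact: closed_edge_form.
Qed.

Lemma closure_triangle a b c : noncollinear a b c ->
  closure (open_triangle a b c) = closed_triangle a b c.
Proof.
move=> D; apply/seteqP; split.
  rewrite [X in _ `<=` X](proj1 (closure_id _) (closed_closed_triangle D)).
  apply: closure_subset => x [r [s [t [r0 s0 t0 rst ->]]]].
  by exists r, s, t; split => //; exact: ltW.
move=> x [r [s [t [r0 s0 t0 rst xE]]]] B Bx.
(* The point moves from [x] at [e = 0] towards the centroid and lies in the open triangle for small
   positive [e]. *)
pose y (e : R) : R * R := ((1 - e) * r + e / 3) *: a + ((1 - e) * s + e / 3) *: b +
  ((1 - e) * t + e / 3) *: c.
have cy : {for 0, continuous y}.
  have cl (k : R) : (fun e : R => (1 - e) * k + e / 3) @ 0 --> (1 - 0) * k + 0 / 3.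
    apply: cvgD; apply: cvgM; [|exact: cvg_cst|exact: cvg_id|exact: cvg_cst].
    by apply: cvgB; [exact: cvg_cst|exact: cvg_id].
  by apply: cvgD; [apply: cvgD|]; apply: cvgZr_tmp; exact: cl.
have y0 : y 0 = x.
  by rewrite /y xE !mul0r !addr0 subr0 !mul1r.
have : nbhs (0 : R) (y @^-1` B) by apply: cy; rewrite y0.
move=> /nbhs_ballP[d /= d0 dB]; pose e := Num.min (d / 2) 2^-1.
have e0 : 0 < e by rewrite lt_min divr_gt0//= invr_gt0.
have e1 : e <= 2^-1 by rewrite ge_min lexx orbT.
have ed : e < d.
  have : e <= d / 2 by rewrite ge_min lexx.
  by lra.
exists (y e); split; last first.
  by apply: dB; rewrite /ball /= sub0r normrN gtr0_norm.
have pos (k : R) : 0 <= k -> 0 < (1 - e) * k + e / 3.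
  by move=> k0; apply: ltr_wpDl; [rewrite mulr_ge0//; lra|rewrite divr_gt0].
do 3![eexists]; split; [exact: (pos r)|exact: (pos s)|exact: (pos t)| |reflexivity].
have -> : (1 - e) * r + e / 3 + ((1 - e) * s + e / 3) + ((1 - e) * t + e / 3) =
  (1 - e) * (r + s + t) + e by field.
by rewrite rst; ring.
Qed.

Lemma open_triangle_rot a b c : open_triangle a b c = open_triangle b c a.
Proof.
apply/seteqP; split => x [r [s [t [r0 s0 t0 rst ->]]]].
  by exists s, t, r; split => //; [lra|rewrite -addrA addrC].
by exists t, r, s; split => //; [lra|rewrite addrC addrA].
Qed.

Lemma open_triangle_swap a b c : open_triangle a b c = open_triangle b a c.
Proof.
by apply/seteqP; split => x [r [s [t [r0 s0 t0 rst ->]]]]; exists s, r, t;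
  (split => //; [lra|congr (_ + _); exact: addrC]).
Qed.

Lemma triangle_rot K a b c : triangle_on K a b c -> triangle_on K b c a.
Proof.
move=> [D ->]; split; last exact: open_triangle_rot.
by move: D; rewrite /noncollinear; apply: contraNN => /eqP H; apply/eqP; rewrite -H; ring.
Qed.

Lemma triangle_swap K a b c : triangle_on K a b c -> triangle_on K b a c.
Proof.
move=> [D ->]; split; last exact: open_triangle_swap.
move: D; rewrite /noncollinear; apply: contraNN => /eqP H; apply/eqP.
by rewrite -[RHS]oppr0 -H; ring.
Qed.

Lemma triangle_closure K a b c : triangle_on K a b c -> closure K = closed_triangle a b c.
Proof. by move=> [D ->]; exact: closure_triangle. Qed.

Lemma triangle_vertex1 K a b c : triangle_on K a b c -> closure K a.
Proof.
move=> H; rewrite (triangle_closure H); exists 1, 0, 0; split => //.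
- by rewrite !addr0.
- by rewrite scale1r !scale0r !addr0.
Qed.

Definition conforming A B : Prop :=
  [\/ closure A `&` closure B = set0,
      (exists a, [/\ is_vertex A a, is_vertex B a & closure A `&` closure B = [set a]]) |
      (exists E, [/\ is_edge A E, is_edge B E & closure A `&` closure B = E])].

(** At most one common point, hence no common edge. This rules out adjacency without a list of the
    edges. *)
Definition small_overlap A B : Prop := forall x y,
  closure A x -> closure B x -> closure A y -> closure B y -> x = y.

Lemma conforming_sym A B : conforming A B -> conforming B A.
Proof.
rewrite /conforming setIC => -[H|[a [H1 H2 H3]]|[E [H1 H2 H3]]].
- exact: Or31.
- by apply: Or32; exists a.
- by apply: Or33; exists E.
Qed.

Lemma small_overlap_sym A B : small_overlap A B -> small_overlap B A.
Proof. by move=> H x y *; exact: H. Qed.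

Section Separation.
Variables (A B : set (R * R)) (g : R * R * R) (a b c a' b' c' : R * R).
Hypothesis TA : triangle_on A a b c.
Hypothesis TB : triangle_on B a' b' c'.

Lemma separated_disjoint :
  affine g a <= 0 -> affine g b <= 0 -> affine g c <= 0 ->
  0 < affine g a' -> 0 < affine g b' -> 0 < affine g c' ->
  conforming A B /\ small_overlap A B.
Proof.
move=> ga gb gc ga' gb' gc'.
have H x : closure A x -> closure B x -> False.
  rewrite (triangle_closure TA) (triangle_closure TB).
  move=> [r [s [t [r0 s0 t0 rst ->]]]] [r' [s' [t' [r'0 s'0 t'0 rst' E]]]].
  have := affine_comb g a' b' c' rst'; rewrite -E affine_comb//.
  have rA : r * affine g a <= 0 by rewrite mulr_ge0_le0.
  have sB : s * affine g b <= 0 by rewrite mulr_ge0_le0.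
  have tC : t * affine g c <= 0 by rewrite mulr_ge0_le0.
  have rA' : 0 <= r' * affine g a' by rewrite mulr_ge0// ltW.
  have sB' : 0 <= s' * affine g b' by rewrite mulr_ge0// ltW.
  have tC' : 0 <= t' * affine g c' by rewrite mulr_ge0// ltW.
  have [r'p|r'n] := ltP 0 r'; first by have := mulr_gt0 r'p ga'; lra.
  have [s'p|s'n] := ltP 0 s'; first by have := mulr_gt0 s'p gb'; lra.
  have t'p : 0 < t' by lra.
  by have := mulr_gt0 t'p gc'; lra.
split; last by move=> x y h1 h2; case: (H x h1 h2).
by apply: Or31; apply/seteqP; split => // x [h1 h2]; case: (H x h1 h2).
Qed.

(** The line passes through the common vertex, listed first in both triangles. It may contain
    further points of [A] but none of [B]. *)
Lemma separated_vertex : a' = a ->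
  affine g a = 0 -> affine g b <= 0 -> affine g c <= 0 ->
  0 < affine g b' -> 0 < affine g c' ->
  conforming A B /\ small_overlap A B.
Proof.
move=> aa ga gb gc gb' gc'.
have H x : closure A x -> closure B x -> x = a.
  rewrite (triangle_closure TA) (triangle_closure TB).
  move=> [r [s [t [r0 s0 t0 rst ->]]]] [r' [s' [t' [r'0 s'0 t'0 rst' E]]]].
  have := affine_comb g a' b' c' rst'; rewrite -E affine_comb// aa ga !mulr0 !add0r.
  have sB : s * affine g b <= 0 by rewrite mulr_ge0_le0.
  have tC : t * affine g c <= 0 by rewrite mulr_ge0_le0.
  have sB' : 0 <= s' * affine g b' by rewrite mulr_ge0// ltW.
  have tC' : 0 <= t' * affine g c' by rewrite mulr_ge0// ltW.
  move=> E0.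
  have s'E : s' = 0.
    apply/eqP; rewrite eq_le s'0 andbT leNgt; apply/negP => s'p.
    by have := mulr_gt0 s'p gb'; lra.
  have t'E : t' = 0.
    apply/eqP; rewrite eq_le t'0 andbT leNgt; apply/negP => t'p.
    by have := mulr_gt0 t'p gc'; lra.
  have r'E : r' = 1 by lra.
  by rewrite E aa s'E t'E r'E scale1r !scale0r !addr0.
split; last by move=> x y h1 h2 h3 h4; rewrite (H x)// (H y).
apply: Or32; exists a; split; first by exists b, c.
  by exists b', c'; rewrite -aa.
apply/seteqP; split => [x [h1 h2]|x ->]; first exact: H.
by split; [exact: triangle_vertex1 TA|rewrite -aa; exact: triangle_vertex1 TB].
Qed.

(** The line carries the common edge; it is enough that the third vertex of [A] lies strictly on its
    side. *)
Lemma separated_edge : a' = a -> b' = b ->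
  affine g a = 0 -> affine g b = 0 -> affine g c < 0 -> 0 <= affine g c' ->
  conforming A B.
Proof.
move=> aa bb ga gb gc gc'; apply: Or33; exists (closed_segment a b); split.
- by exists a, b, c.
- by exists a, b, c'; rewrite -aa -bb.
rewrite (triangle_closure TA) (triangle_closure TB) aa bb.
apply/seteqP; split => [x [[r [s [t [r0 s0 t0 rst ->]]]]]|x [r [s [r0 s0 rs ->]]]].
  move=> [r' [s' [t' [r'0 s'0 t'0 rst' E]]]].
  have := affine_comb g a b c' rst'; rewrite -E affine_comb// ga gb !mulr0 !add0r.
  have tC' : 0 <= t' * affine g c' by rewrite mulr_ge0.
  move=> E0; have tE : t = 0.
    apply/eqP; rewrite eq_le t0 andbT leNgt; apply/negP => tp.
    have tg : t * affine g c < 0 by rewrite pmulr_rlt0.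
    by move: tC'; rewrite -E0 leNgt tg.
  exists r, s; split => //; first by rewrite -rst tE addr0.
  by rewrite tE scale0r addr0.
by split; exists r, s, 0; split; rewrite ?addr0 ?scale0r ?addr0.
Qed.

End Separation.

Lemma edge_not_small A B E : is_edge A E -> is_edge B E -> ~ small_overlap A B.
Proof.
move=> [a [b [c [TA ->]]]] [a' [b' [c' [TB E2]]]] sm.
have sub K u v w : triangle_on K u v w -> closed_segment u v `<=` closure K.
  move=> TK x [r [s [r0 s0 rs ->]]]; rewrite (triangle_closure TK).
  by exists r, s, 0; split; rewrite ?addr0 ?scale0r ?addr0.
have sa : closed_segment a b a.
  by exists 1, 0; split; rewrite ?addr0// scale1r scale0r addr0.
have sb : closed_segment a b b.
  by exists 0, 1; split; rewrite ?add0r// scale1r scale0r add0r.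
have ab : a = b.
  apply: sm; [exact: (sub _ _ _ _ TA)|by apply: (sub _ _ _ _ TB); rewrite -E2|
    exact: (sub _ _ _ _ TA)|by apply: (sub _ _ _ _ TB); rewrite -E2].
by case: TA; rewrite /noncollinear ab !subrr !mul0r subrr eqxx.
Qed.

Lemma self_not_small A : is_triangle A -> ~ small_overlap A A.
Proof.
move=> [a [b [c T]]]; apply: (@edge_not_small _ _ (closed_segment a b)); by exists a, b, c.
Qed.

End Triangles.

(** * The mesh *)

Section Mesh.
Variable R : realType.
Variable n : nat.
Hypothesis n2 : (1 < n)%N.
Implicit Types (x : R * R) (b : bool) (i j : 'I_n).

(* [Core] is the right half of the diamond [|x| + |y| <= 1], [Outer b] the corners
   to its right.  To its left, [Apex] and the fans around the poles [(0, +-1)] cut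
   off the two triangles [Fan b ord_max] at the tip [(-1, 0)]. *)
Inductive cell := Core | Apex | Outer of bool | Fan of bool & 'I_n.
Implicit Types c d : cell.

Definition abscissa (k : nat) : R := k%:R / n%:R.
Definition pole_sign b : R := if b then 1 else -1.
Definition pole b : R * R := (0, pole_sign b).
Definition node (k : nat) : R * R := (- abscissa k, 0).
(** The nodes run from [node 1] to [node n = (-1, 0)]. Triangle [i] of a fan starts at [node i.+1],
    so the last one starts at the tip and ends at a corner of the square. *)
Definition fan_end b (k : nat) : R * R :=
  if k.+1 == n then (-1, pole_sign b) else node k.+2.

Definition elem c : set (R * R) := match c with
  | Core => open_triangle (pole false) (pole true) (1, 0)
  | Apex => open_triangle (pole false) (pole true) (node 1)
  | Outer b => open_triangle (pole b) (1, pole_sign b) (1, 0)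
  | Fan b i => open_triangle (pole b) (node i.+1) (fan_end b i)
  end.

(** A substitute for the graph distance to the right part of the mesh: it changes by at most one
    between adjacent elements. *)
Definition depth c : nat := if c is Fan _ i then i.+1 else 0.

Let n0 : 0 < n%:R :> R. Proof. by rewrite ltr0n (ltn_trans _ n2). Qed.

Lemma abscissa_lt (j k : nat) : (j < k)%N -> abscissa j < abscissa k.
Proof. by move=> jk; rewrite ltr_pM2r ?invr_gt0// ltr_nat. Qed.

Lemma abscissa_gt0 k : 0 < abscissa k.+1.
Proof. by rewrite divr_gt0// ltr0n. Qed.

Lemma abscissa_n : abscissa n = 1.
Proof. by rewrite /abscissa divff// gt_eqF. Qed.

Lemma abscissaS k : n%:R * abscissa k.+1 = n%:R * abscissa k + 1.
Proof. by rewrite /abscissa !mulrA ![n%:R * _]mulrC !mulfK ?gt_eqF// natr1. Qed.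

Variant fan_end_spec b (k : nat) : R * R -> Prop :=
  | FanInner of (k.+1 < n)%N : fan_end_spec b k (node k.+2)
  | FanLast of k.+1 = n & abscissa k.+1 = 1 : fan_end_spec b k (-1, pole_sign b).

Lemma fan_endP b i : fan_end_spec b i (fan_end b i).
Proof.
rewrite /fan_end; case: eqP => [E|/eqP ne].
  by apply: FanLast => //; rewrite E abscissa_n.
by apply: FanInner; rewrite ltn_neqAle ne ltn_ord.
Qed.

Lemma core_triangle : triangle_on (elem Core) (pole false) (pole true) (1, 0).
Proof. by split => //; rewrite /noncollinear /=; apply/eqP; lra. Qed.

Lemma apex_triangle : triangle_on (elem Apex) (pole false) (pole true) (node 1).
Proof.
by split => //; rewrite /noncollinear /=; apply/eqP; have := abscissa_gt0 0; lra.
Qed.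

Lemma outer_triangle b : triangle_on (elem (Outer b)) (pole b) (1, pole_sign b) (1, 0).
Proof. by split => //; rewrite /noncollinear /=; apply/eqP; case: b => /=; lra. Qed.

Lemma fan_triangle b i : triangle_on (elem (Fan b i)) (pole b) (node i.+1) (fan_end b i).
Proof.
split => //; rewrite /noncollinear /=; apply/eqP; have := abscissa_lt (ltnSn i.+1).
by case: fan_endP => [_|_ ->] /=; case: b => /=; lra.
Qed.

Lemma elem_triangle c : is_triangle (elem c).
Proof.
case: c => [||b|b i]; do 3!eexists; [exact: core_triangle|exact: apex_triangle|
  exact: outer_triangle|exact: fan_triangle].
Qed.

(** Conformity and the control of adjacency rest on the same separating lines, so each pair of cells
    is treated once for both. *)
Definition compatible c d : Prop := conforming (elem c) (elem d) /\
  (small_overlap (elem c) (elem d) \/ ((depth c <= (depth d).+1) && (depth d <= (depth c).+1))%N).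

Lemma compatible_sym c d : compatible c d -> compatible d c.
Proof.
move=> [/conforming_sym ? [/small_overlap_sym ?|]]; split => //; [by left|].
by rewrite andbC; right.
Qed.

Lemma compatible_small c d :
  conforming (elem c) (elem d) /\ small_overlap (elem c) (elem d) -> compatible c d.
Proof. by case; split => //; left. Qed.

Lemma core_apex : compatible Core Apex.
Proof.
apply: compatible_sym; split; last by right.
apply: (@separated_edge _ _ _ (0, 1, 0) _ _ _ _ _ _ apex_triangle core_triangle);
  rewrite // /affine /=; have := abscissa_gt0 0; lra.
Qed.

Lemma core_at b : triangle_on (elem Core) (pole b) (1, 0) (pole (~~ b)).
Proof.
by case: b; [exact: triangle_rot core_triangle|
  exact/triangle_rot/triangle_swap/core_triangle].
Qed.

Lemma apex_at b : triangle_on (elem Apex) (pole b) (node 1) (pole (~~ b)).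
Proof.
by case: b; [exact: triangle_rot apex_triangle|
  exact/triangle_rot/triangle_swap/apex_triangle].
Qed.

Lemma apex_at_poles b : triangle_on (elem Apex) (pole b) (pole (~~ b)) (node 1).
Proof. exact/triangle_swap/triangle_rot/triangle_rot/apex_at. Qed.

Lemma outer_at_east b : triangle_on (elem (Outer b)) (1, 0) (pole b) (1, pole_sign b).
Proof. exact/triangle_rot/triangle_rot/outer_triangle. Qed.

Lemma fan_at_node b i : triangle_on (elem (Fan b i)) (node i.+1) (fan_end b i) (pole b).
Proof. exact/triangle_rot/fan_triangle. Qed.

Lemma fan_at_end b i : triangle_on (elem (Fan b i)) (pole b) (fan_end b i) (node i.+1).
Proof. exact/triangle_swap/triangle_rot/triangle_rot/fan_triangle. Qed.

Lemma core_outer b : compatible Core (Outer b).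
Proof.
split; last by right.
apply: (@separated_edge _ _ _ (-1, 1, pole_sign b) _ _ _ _ _ _ (core_at b)
  (triangle_swap (outer_at_east b)));
  rewrite // /affine /=; case: b => /=; lra.
Qed.

Lemma core_fan b i : compatible Core (Fan b i).
Proof.
apply: compatible_small; apply: (@separated_vertex _ _ _ (0, -1, 0) _ _ _ _ _ _ (core_at b) (fan_triangle b i));
  rewrite // /affine /=; have := abscissa_gt0 i; try by lra.
have := abscissa_gt0 i.+1.
by case: fan_endP => [_|_ _] /=; lra.
Qed.

Lemma apex_outer b : compatible Apex (Outer b).
Proof.
apply: compatible_small; apply: (@separated_vertex _ _ _ (0, 1, 0) _ _ _ _ _ _ (apex_at b) (outer_triangle b));
  rewrite // /affine /=; have := abscissa_gt0 0; lra.
Qed.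

Lemma apex_fan b i : compatible Apex (Fan b i).
Proof.
(* The line through [pole b] and [node 1]. *)
pose g : R * R * R := (- abscissa 1, -1, abscissa 1 * pole_sign b).
have end_gt0 : 0 < affine g (fan_end b i).
  have := abscissa_gt0 0; have i1 := @abscissa_lt 1 i.+2 isT.
  by rewrite /affine /=; case: fan_endP => [_|_ _] /=; case: (b) => /=; lra.
have [i0|i0] := posnP i.
  split; last by right; rewrite /= i0.
  apply: (@separated_edge _ _ _ g _ _ _ _ _ _ (apex_at b) (fan_triangle b i)) => //.
  - by rewrite i0.
  - by rewrite /affine /=; case: (b) => /=; lra.
  - by rewrite /affine /=; case: (b) => /=; lra.
  - by have := abscissa_gt0 0; rewrite /affine /=; case: (b) => /=; lra.
  - exact: ltW.
apply: compatible_small.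
apply: (@separated_vertex _ _ _ g _ _ _ _ _ _ (apex_at_poles b) (fan_triangle b i)) => //;
  have := abscissa_gt0 0; have := @abscissa_lt 1 i.+1 i0;
  rewrite /affine /=; case: (b) => /=; lra.
Qed.

Lemma fan_fan_same b i j : (i < j)%N -> compatible (Fan b i) (Fan b j).
Proof.
move=> ij; have in_ : (i.+1 < n)%N by exact: leq_ltn_trans ij (ltn_ord j).
have fe : fan_end b i = node i.+2 by rewrite /fan_end ltn_eqF.
have xi := @abscissa_lt i.+1 j.+1 ij; have xj := abscissa_gt0 j.
pose g : R * R * R := (abscissa j.+1, 1, - abscissa j.+1 * pole_sign b).
have gp : affine g (pole b) = 0 by rewrite /affine /=; case: (b) => /=; lra.
have gi : 0 < affine g (node i.+1) by rewrite /affine /=; lra.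
have gj : affine g (node j.+1) = 0 by rewrite /affine /=; lra.
have ge : affine g (fan_end b j) < 0.
  have := abscissa_lt (ltnSn j.+1); rewrite /affine /=.
  by case: fan_endP => [_|_ ->] /=; case: (b) => /=; lra.
have [ij1|ij1] := eqVneq (j : nat) i.+1; last first.
  have lt2 : (i.+1 < j)%N by rewrite ltn_neqAle eq_sym ij1.
  apply: compatible_sym; apply: compatible_small.
  apply: (@separated_vertex _ _ _ g _ _ _ _ _ _ (fan_triangle b j) (fan_triangle b i)) => //.
  - by rewrite gj.
  - exact: ltW.
  - by have := @abscissa_lt i.+2 j.+1 lt2; rewrite fe /affine /=; lra.
apply: compatible_sym; split; last by right; rewrite /= ij1 leqnn /= !ltnS; do 2!apply: leqW.
apply: (@separated_edge _ _ _ g _ _ _ _ _ _ (fan_triangle b j) (fan_at_end b i)) => //.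
- by rewrite fe ij1.
- exact: ltW.
Qed.

Lemma fan_fan_mirror i : compatible (Fan false i) (Fan true i).
Proof.
have xi := abscissa_gt0 i; have [lt|eq] := ltnP i.+1 n.
  have fe b : fan_end b i = node i.+2 by rewrite /fan_end ltn_eqF.
  split; last by right; rewrite /= leqnSn.
  apply: (@separated_edge _ _ _ (0, 0, 1) _ _ _ _ _ _ (fan_at_node false i) (fan_at_node true i)) => //;
  by rewrite ?fe /affine //=; lra.
have {}eq : i.+1 == n by rewrite eqn_leq eq ltn_ord.
apply: compatible_small.
apply: (@separated_vertex _ _ _ (0, 0, 1) _ _ _ _ _ _ (fan_at_node false i) (fan_at_node true i)) => //;
  by rewrite /affine /fan_end ?eq /=; lra.
Qed.

Lemma fan_fan_opposite b i j : (i < j)%N -> compatible (Fan b i) (Fan (~~ b) j).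
Proof.
move=> ij; have in_ : (i.+1 < n)%N by exact: leq_ltn_trans ij (ltn_ord j).
have fe : fan_end b i = node i.+2 by rewrite /fan_end ltn_eqF.
have xi := @abscissa_lt i.+1 j.+1 ij; have xj := abscissa_gt0 j.
have x1 : abscissa j.+1 <= 1.
  rewrite -abscissa_n; have := ltn_ord j; rewrite leq_eqVlt => /orP[/eqP->//|lt].
  exact/ltW/abscissa_lt.
(* A line through [node j.+1], tilted so that the two poles lie on different sides. *)
pose g : R * R * R := (abscissa j.+1, 1, 2 * pole_sign b).
have gp : 0 < affine g (pole b) by rewrite /affine /=; case: (b) => /=; lra.
have gp' : affine g (pole (~~ b)) <= 0 by rewrite /affine /=; case: (b) => /=; lra.
have gi : 0 < affine g (node i.+1) by rewrite /affine /=; lra.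
have gj : affine g (node j.+1) = 0 by rewrite /affine /=; lra.
have ge : affine g (fan_end (~~ b) j) <= 0.
  have := abscissa_lt (ltnSn j.+1); rewrite /affine /=.
  by case: fan_endP => [_|_ _] /=; case: (b) => /=; lra.
apply: compatible_sym; apply: compatible_small.
have [ij1|ij1] := eqVneq (j : nat) i.+1; last first.
  have lt2 : (i.+1 < j)%N by rewrite ltn_neqAle eq_sym ij1.
  apply: (@separated_disjoint _ _ _ g _ _ _ _ _ _ (fan_triangle (~~ b) j) (fan_triangle b i)) => //.
  - by rewrite gj.
  - by have := @abscissa_lt i.+2 j.+1 lt2; rewrite fe /affine /=; lra.
apply: (@separated_vertex _ _ _ g _ _ _ _ _ _ (fan_at_node (~~ b) j) (triangle_rot (fan_at_node b i))) => //.
by rewrite fe ij1.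
Qed.

Lemma outer_outer : compatible (Outer false) (Outer true).
Proof.
apply: compatible_small.
by apply: (@separated_vertex _ _ _ (0, 0, 1) _ _ _ _ _ _ (outer_at_east false) (outer_at_east true));
  rewrite // /affine /=; lra.
Qed.

Lemma fan_outer b b' i : compatible (Fan b i) (Outer b').
Proof.
have xi := abscissa_gt0 i; have xj := abscissa_gt0 i.+1; apply: compatible_small.
have [<-{b'}|bb] := eqVneq b b'.
  apply: (@separated_vertex _ _ _ (0, 1, 0) _ _ _ _ _ _ (fan_triangle b i) (outer_triangle b)) => //;
  rewrite /affine /=; try by lra.
  by case: fan_endP => [_|_ _] /=; lra.
have {bb}-> : b' = ~~ b by case: b b' bb => -[].
apply: (@separated_disjoint _ _ _ (0, 1, pole_sign (~~ b)) _ _ _ _ _ _ (fan_triangle b i) (outer_triangle (~~ b)));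
  rewrite /affine /=; try by case: (b) => /=; lra.
by case: fan_endP => [_|_ _] /=; case: (b) => /=; lra.
Qed.

Lemma cells_compatible c d : c <> d -> compatible c d.
Proof.
case: c => [||b|b i]; case: d => [||b'|b' j] // cd.
- exact: core_apex.
- exact: core_outer.
- exact: core_fan.
- exact/compatible_sym/core_apex.
- exact: apex_outer.
- exact: apex_fan.
- exact/compatible_sym/core_outer.
- exact/compatible_sym/apex_outer.
- by case: b b' cd => -[] // _; [exact/compatible_sym/outer_outer|exact: outer_outer].
- exact/compatible_sym/fan_outer.
- exact/compatible_sym/core_fan.
- exact/compatible_sym/apex_fan.
- exact: fan_outer.
have [ij|ji|ij] := ltngtP i j.
- case: b b' {cd} => -[]; [exact: fan_fan_same|exact: (@fan_fan_opposite true)|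
    exact: (@fan_fan_opposite false)|exact: fan_fan_same].
- case: b b' {cd} => -[]; apply: compatible_sym; [exact: fan_fan_same|
    exact: (@fan_fan_opposite false)|exact: (@fan_fan_opposite true)|exact: fan_fan_same].
- have {ij}E : i = j by exact/val_inj.
  by case: b b' cd; rewrite E => -[] // _; [exact/compatible_sym/fan_fan_mirror|exact: fan_fan_mirror].
Qed.

Definition mesh : set (set (R * R)) := range elem.

Lemma finite_mesh : finite_set mesh.
Proof.
have -> : mesh = [set elem Core; elem Apex] `|` range (fun b => elem (Outer b)) `|`
    range (fun p : bool * 'I_n => elem (Fan p.1 p.2)).
  apply/seteqP; split => [_ [[||b|b i] _ <-]|_ [[[->|->]|[b _ <-]]|[p _ <-]]].
  - by left; left; left.
  - by left; left; right.
  - by left; right; exists b.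
  - by right; exists (b, i).
  - by exists Core.
  - by exists Apex.
  - by exists (Outer b).
  - by exists (Fan p.1 p.2).
rewrite !finite_setU; split; first split; first by split; exact: finite_set1.
- exact/finite_image/finite_finset.
- exact/finite_image/finite_finset.
Qed.

Lemma abscissa_le1 k : (k <= n)%N -> abscissa k <= 1.
Proof. by move=> kn; rewrite ler_pdivrMr// mul1r ler_nat. Qed.

Lemma closed_halfplane g : closed [set x : R * R | 0 <= affine g x].
Proof.
exact: (preimage_closed (fun x _ => affine_continuous (x := x)) (@closed_ge R 0)).
Qed.

Lemma closure_Omega_bounds x : closure Omega x -> `|x.1| <= 1 /\ `|x.2| <= 1.
Proof.
have sub g : Omega `<=` [set x | 0 <= affine g x] -> closure Omega x -> 0 <= affine g x.
  move=> H; rewrite -[affine g x]/(affine g x) => cl.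
  have := closure_subset H cl; rewrite -(proj1 (closure_id _) (@closed_halfplane g)).
  by [].
move=> cl; split; rewrite ler_norml; apply/andP; split.
- suff : 0 <= affine (1, 1, 0) x by rewrite /affine /=; lra.
  by apply: (sub _ _ cl) => z [/andP[? ?] _]; rewrite /= /affine /=; lra.
- suff : 0 <= affine (1, -1, 0) x by rewrite /affine /=; lra.
  by apply: (sub _ _ cl) => z [/andP[? ?] _]; rewrite /= /affine /=; lra.
- suff : 0 <= affine (1, 0, 1) x by rewrite /affine /=; lra.
  by apply: (sub _ _ cl) => z [_ /andP[? ?]]; rewrite /= /affine /=; lra.
- suff : 0 <= affine (1, 0, -1) x by rewrite /affine /=; lra.
  by apply: (sub _ _ cl) => z [_ /andP[? ?]]; rewrite /= /affine /=; lra.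
Qed.

Lemma elem_Omega c : elem c `<=` Omega.
Proof.
case: c => [||b|b i] x [r [s [t [r0 s0 t0 rst ->]]]]; rewrite /Omega /= /GRing.scale /=.
- by split; apply/andP; split; lra.
- have x0 := abscissa_gt0 0; have x1 := abscissa_le1 (ltnW n2).
  have tx := ler_wpM2l (ltW t0) x1; have tx0 := mulr_gt0 t0 x0.
  by split; apply/andP; split; lra.
- by case: b => /=; split; apply/andP; split; lra.
have x0 := abscissa_gt0 i; have x1 := abscissa_le1 (ltn_ord i).
have sx := ler_wpM2l (ltW s0) x1; have sx0 := mulr_gt0 s0 x0.
case: fan_endP => [lt|_ E] /=; last first.
  by rewrite E; case: b => /=; split; apply/andP; split; lra.
have y0 := abscissa_gt0 i.+1; have y1 := abscissa_le1 lt.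
have tx := ler_wpM2l (ltW t0) y1; have tx0 := mulr_gt0 t0 y0.
by case: b => /=; split; apply/andP; split; lra.
Qed.

(** A discrete intermediate value argument: either [h] changes sign between two consecutive nodes,
    or it stays nonnegative up to the last one. *)
Lemma fan_interval (h : nat -> R) : 0 <= h 1 ->
  exists2 i : 'I_n, 0 <= h i.+1 & i.+1 = n \/ h i.+2 <= 0.
Proof.
move=> h1; have claim m : (m < n)%N ->
    (exists2 i : 'I_n, 0 <= h i.+1 & i.+1 = n \/ h i.+2 <= 0) \/ 0 <= h m.+1.
  elim: m => [|m ih] mn; first by right.
  have [|hm] := ih (ltnW mn); first by left.
  have [h0|/ltW h0] := leP 0 (h m.+2); first by right.
  by left; exists (Ordinal (ltnW mn)) => //; right.
have nE : n.-1.+1 = n by rewrite prednK// (ltn_trans _ n2).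
have lt : (n.-1 < n)%N by rewrite nE.
have [//|hn] := claim n.-1 lt.
by exists (Ordinal lt) => //; left.
Qed.

Lemma mesh_cover x : `|x.1| <= 1 -> `|x.2| <= 1 -> exists c, closure (elem c) x.
Proof.
case: x => x y /= /ler_normlP[x1 x2] y1.
have [b yE] : exists b, y = pole_sign b * `|y|.
  by exists (0 <= y); rewrite /pole_sign; case: leP => y0;
    [rewrite ger0_norm ?mul1r|rewrite ltr0_norm// mulN1r opprK].
have y0 := normr_ge0 y; move: `|y| y1 y0 yE => z z1 z0 yE.
have yz : -z <= y <= z by rewrite yE; case: (b) => /=; apply/andP; split; lra.
move: yz => /andP[yz1 yz2].
have [x0|x0] := leP 0 x.
  have [xz|xz] := leP (x + z) 1.
    exists Core; rewrite (triangle_closure core_triangle).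
    exists ((1 - x - y) / 2), ((1 - x + y) / 2), x; split; [lra|lra|lra|lra|].
    by congr pair; rewrite /= /GRing.scale /=; lra.
  exists (Outer b); rewrite (triangle_closure (outer_triangle b)).
  exists (1 - x), (x + z - 1), (1 - z); split; [lra|lra|lra|lra|].
  by congr pair; rewrite /= /GRing.scale /= ?yE; case: (b) => /=; lra.
(* [h k] is nonnegative if the point is on or to the left of the segment from its pole to [node k].
   Between two consecutive nodes, [h i.+1] and [- h i.+2] are barycentric coordinates. *)
pose h k := n%:R * (- x - abscissa k * (1 - z)).
have hE k : h k.+1 = h k - (1 - z).
  have S := abscissaS k; rewrite /h.
  transitivity (n%:R * - x - n%:R * abscissa k.+1 * (1 - z)); first by ring.
  by rewrite S; ring.
have [h1|h1] := leP 0 (h 1%N); last first.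
  exists Apex; rewrite (triangle_closure apex_triangle).
  have nx : n%:R * abscissa 1 = 1 by rewrite /abscissa mulrC divfK// gt_eqF.
  have H : n%:R * - x < 1 - z.
    by move: h1; rewrite /h mulrBr mulrA nx mul1r subr_lt0.
  have nx0 : 0 <= n%:R * - x by rewrite mulr_ge0//; lra.
  exists ((1 - n%:R * - x - y) / 2), ((1 - n%:R * - x + y) / 2), (n%:R * - x); split; [lra|lra|exact: nx0|lra|].
  congr pair; rewrite /= /GRing.scale /=; last by lra.
  by rewrite !mulr0 !add0r mulrN mulrAC nx mul1r opprK.
have [i hi hi2] := fan_interval h1.
exists (Fan b i); rewrite (triangle_closure (fan_triangle b i)).
case: fan_endP => [lt|E1 E2].
  have {hi2}hi2 : h i.+2 <= 0 by case: hi2 => // E; rewrite E ltnn in lt.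
  exists z, (- h i.+2), (h i.+1); split; [exact: z0|lra|exact: hi|by rewrite [h i.+2]hE; lra|].
  congr pair; rewrite /= /GRing.scale /=; last by rewrite yE; case: (b) => /=; lra.
  have S := abscissaS i.+1; rewrite [h i.+2]hE /h.
  move: S; rewrite mulr0 add0r; move: (abscissa i.+1) (abscissa i.+2) (n%:R) => u v m S.
  have mv : m * (v - u) = 1 by rewrite mulrBr S; ring.
  rewrite [RHS](_ : _ = - (- x - u * (1 - z)) * (m * (v - u)) - (1 - z) * u); last by ring.
  by rewrite mv; ring.
have hn : 0 <= - x - (1 - z) by move: hi; rewrite /h E2 mul1r pmulr_rge0.
exists (1 + x), (1 - z), (z - 1 - x); split; [lra|lra|lra|lra|].
by congr pair; rewrite /= /GRing.scale /= ?E2 ?yE; case: (b) => /=; lra.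
Qed.

Lemma mesh_conforming : conforming_triangulation mesh.
Proof.
split.
- exact: finite_mesh.
- by move=> _ [c _ <-]; exact: elem_triangle.
- apply/seteqP; split => [x [_ [c _ <-]]|x /closure_Omega_bounds[x1 x2]].
    by apply: closure_subset; exact: elem_Omega.
  by have [c cx] := mesh_cover x1 x2; exists (elem c) => //; exists c.
move=> _ _ [c _ <-] [d _ <-] cd; have [|//] := @cells_compatible c d.
by move=> E; apply: cd; rewrite E.
Qed.

Lemma depth_step c d : elem c = elem d \/ Defs.adjacent mesh (elem c) (elem d) ->
  (depth c <= (depth d).+1)%N /\ (depth d <= (depth c).+1)%N.
Proof.
move=> H; have ns : ~ small_overlap (elem c) (elem d).
  case: H => [->|[_ _ _ [E [h1 h2]]]]; last exact: edge_not_small h1 h2.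
  exact/self_not_small/elem_triangle.
have [->|cd] := pselect (c = d); first by rewrite leqnSn.
by have [_ [//|/andP[]]] := cells_compatible cd.
Qed.

(** The bound is one larger than the length of the path because injectivity of [elem] is not at
    hand: for the empty path, equality of elements only gives depths that differ by at most 1. *)
Lemma path_depth c d p : mesh_path mesh (elem c) p (elem d) ->
  (depth c <= depth d + (size p).+1)%N /\ (depth d <= depth c + (size p).+1)%N.
Proof.
elim: p c => [|A p ih] c [/= pth la].
  by have := @depth_step c d (or_introl la); rewrite !addn1.
move: pth => /andP[/asboolP adj pth].
have [_ [e _ eA] _ _] := adj; rewrite -eA in adj pth la.
have [h1 h2] := depth_step (or_intror adj); have [h3 h4] := ih e (conj pth la).
split; first by apply: leq_trans h1 _; rewrite [in leqRHS]addnS ltnS.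
by apply: leq_trans h4 _; rewrite -[in leqRHS]addSnnS leq_add2r.
Qed.

(** [mesh_dist] is an infimum that may be infinite; as path lengths are integers, an upper bound [L]
    is attained by a path. *)
Lemma dist_path A B (L : nat) : (mesh_dist mesh A B <= L%:R%:E)%E ->
  exists2 p, mesh_path mesh A p B & (size p <= L)%N.
Proof.
move=> le; apply: contrapT => H.
have : ((L.+1)%:R%:E <= mesh_dist mesh A B)%E.
  apply: le_ereal_inf_tmp => _ [p pth <-]; rewrite lee_fin ler_nat ltnNge; apply/negP => sp.
  by apply: H; exists p.
by move=> /le_trans/(_ le); rewrite lee_fin ler_nat ltnn.
Qed.

Lemma dist_depth c d (L : nat) : (mesh_dist mesh (elem c) (elem d) <= L%:R%:E)%E ->
  (depth c <= depth d + L.+1)%N /\ (depth d <= depth c + L.+1)%N.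
Proof.
move=> /dist_path[p /path_depth[h1 h2] pL].
by split; [apply: leq_trans h1 _|apply: leq_trans h2 _]; rewrite leq_add2l.
Qed.

Lemma pole_sign_norm b : `|pole_sign b| = 1.
Proof. by case: b; rewrite /= ?normrN normr1. Qed.

Definition in_diamond c := match c with
  | Core | Apex => true | Outer _ => false | Fan _ i => (i.+1 < n)%N end.

Lemma closure_elem_diamond c x : closure (elem c) x -> in_diamond c ->
  `|x.1| + `|x.2| <= 1.
Proof.
case: c => [||//|b i].
- rewrite (triangle_closure core_triangle) => -[r [s [t [r0 s0 t0 rst ->]]]] _.
  rewrite /= /GRing.scale /=; rewrite ger0_norm; last by lra.
  by rewrite -lerBrDl ler_norml; apply/andP; split; lra.
- rewrite (triangle_closure apex_triangle) => -[r [s [t [r0 s0 t0 rst ->]]]] _.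
  have x0 := abscissa_gt0 0; have x1 := abscissa_le1 (ltnW n2).
  have tx := ler_wpM2l t0 x1; have tx0 := mulr_ge0 t0 (ltW x0).
  rewrite /= /GRing.scale /=; rewrite ler0_norm; last by lra.
  by rewrite -lerBrDl ler_norml; apply/andP; split; lra.
rewrite (triangle_closure (fan_triangle b i)) /= => -[r [s [t [r0 s0 t0 rst ->]]]] lt.
have fe : fan_end b i = node i.+2 by rewrite /fan_end ltn_eqF.
have x0 := abscissa_gt0 i; have x1 := abscissa_le1 (ltn_ord i).
have sx := ler_wpM2l s0 x1; have sx0 := mulr_ge0 s0 (ltW x0).
have y0 := abscissa_gt0 i.+1; have y1 := abscissa_le1 lt.
have tx := ler_wpM2l t0 y1; have tx0 := mulr_ge0 t0 (ltW y0).
rewrite fe /= /GRing.scale /= !mulr0 !addr0 add0r normrM pole_sign_norm (ger0_norm r0) ler0_norm; lra.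
Qed.

Lemma elem_outside c x : elem c x -> ~~ in_diamond c -> 1 < `|x.1| + `|x.2|.
Proof.
case: c => [||b|b i] //= [r [s [t [r0 s0 t0 rst ->]]]].
  move=> _; rewrite /= /GRing.scale /= !mulr0 !add0r !mulr1 addr0 -mulrDl normrM pole_sign_norm.
  by rewrite !ger0_norm; lra.
case: fan_endP => [->//|_ E] _; rewrite /= /GRing.scale /= E.
rewrite (_ : r * pole_sign b + s * 0 + t * pole_sign b = (r + t) * pole_sign b); last by ring.
rewrite (normrM (r + t)) pole_sign_norm mulr1.
have -> : `|r * 0 + s * -1 + t * -1| = s + t by rewrite ler0_norm; lra.
by rewrite ger0_norm; lra.
Qed.

Lemma closure_outer b x : closure (elem (Outer b)) x -> 0 <= x.1 /\ 1 <= x.1 + `|x.2|.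
Proof.
rewrite (triangle_closure (outer_triangle b)) => -[r [s [t [r0 s0 t0 rst ->]]]].
rewrite /= /GRing.scale /= !mulr0 !add0r !mulr1 addr0 -mulrDl normrM pole_sign_norm.
by rewrite [`|r + s|]ger0_norm; [split|]; lra.
Qed.

Lemma closure_left c x : closure (elem c) x ->
  match c with Apex | Fan _ _ => x.1 <= 0 | _ => True end.
Proof.
case: c => [//||//|b i].
- rewrite (triangle_closure apex_triangle) => -[r [s [t [r0 s0 t0 rst ->]]]].
  have := mulr_ge0 t0 (ltW (abscissa_gt0 0)); rewrite /= /GRing.scale /=; lra.
rewrite (triangle_closure (fan_triangle b i)) => -[r [s [t [r0 s0 t0 rst ->]]]].
have := mulr_ge0 s0 (ltW (abscissa_gt0 i)); have := mulr_ge0 t0 (ltW (abscissa_gt0 i.+1)).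
by case: fan_endP => [_|_ _]; rewrite /= /GRing.scale /=; lra.
Qed.

Lemma load_core x : load x -> elem Core x.
Proof.
case: x => x y; rewrite /load /= => /andP[x0 xy].
have /andP[y1 y2] : - (1 - x) < y < 1 - x by rewrite -ltr_norml; lra.
exists ((1 - x - y) / 2), ((1 - x + y) / 2), x; split; [lra|lra|lra|lra|].
by congr pair; rewrite /= /GRing.scale /=; lra.
Qed.

Lemma core_load x : elem Core x -> load x.
Proof.
move=> [r [s [t [r0 s0 t0 rst ->]]]]; rewrite /load /= /GRing.scale /=; apply/andP.
by split; last (rewrite ltrBrDl -ltrBrDr ltr_norml; apply/andP; split); lra.
Qed.

Lemma not_load c x : closure (elem c) x -> c <> Core -> load x = false.
Proof.
move=> cx cC; apply/negbTE; rewrite /load negb_and -!leNgt; apply/orP.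
case: c cx cC => [//||b|b i] cx _.
- by left; exact: closure_left cx.
- by right; have [_ h] := closure_outer cx; lra.
- by left; exact: closure_left cx.
Qed.

End Mesh.

(** * The two coefficients *)

Lemma ler_fsum (R : numDomainType) (I : choiceType) (A : set I) (f g : I -> R) :
  finite_set A -> (forall i, A i -> f i <= g i) ->
  \sum_(i \in A) f i <= \sum_(i \in A) g i.
Proof.
move=> fA fg; rewrite !fsbig_finite//= big_seq [leRHS]big_seq.
by apply: ler_sum => i; rewrite in_fset_set// => /set_mem/fg.
Qed.

Lemma fsum_term_le (R : numDomainType) (I : choiceType) (A : set I) (f : I -> R) i :
  finite_set A -> (forall i, A i -> 0 <= f i) -> A i -> f i <= \sum_(i \in A) f i.
Proof.
move=> fA f0 Ai; rewrite (fsbigD1 i)//= lerDl; apply: fsumr_ge0 => j [Aj _]; exact: f0.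
Qed.

Section Counterexample.
Variable R : realType.
Implicit Types (x : R * R) (u v f : R * R -> R).
Local Notation leb := (@lebesgue_measure R).
Local Notation mu := (@plane_measure R).
Local Notation Rm := (measurableTypeR R).
Local Notation PT := (measurableTypeR R * measurableTypeR R)%type.
Local Notation Om := (@Omega R).
Local Notation mO := (@measurable_Omega R).
Local Notation fO := (@finite_Omega R).
Local Notation sq := (sqint mu Om).
Local Notation "\I f" := (\int[mu]_(x in Om) f x) (at level 36, f at level 36).

Definition two_phase (P : pred (R * R)) (M : R) x : R := 1 + (M - 1) * (P x)%:R.

Lemma two_phase_in (P : pred (R * R)) M x : P x -> two_phase P M x = M.
Proof. by rewrite /two_phase => ->; rewrite mulr1 addrC subrK. Qed.

Lemma two_phase_out (P : pred (R * R)) M x : ~~ P x -> two_phase P M x = 1.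
Proof. by rewrite /two_phase => /negbTE ->; rewrite mulr0 addr0. Qed.

Section TwoPhase.
Variables (P : pred (R * R)) (M : R).
Hypothesis mP : @measurable _ PT [set x | P x].
Hypothesis M1 : 1 < M.

Lemma measurable_two_phase : @measurable_fun _ _ PT R Om (two_phase P M).
Proof.
apply: measurable_funD; first exact: measurable_cst.
by apply: measurable_funM; [exact: measurable_cst|exact: measurable_boolO].
Qed.

Lemma two_phase_ge1 x : Om x -> 1 <= two_phase P M x.
Proof.
move=> _; have [Px|Px] := boolP (P x); first by rewrite two_phase_in// ltW.
by rewrite two_phase_out.
Qed.

Lemma two_phase_leM x : Om x -> two_phase P M x <= M.
Proof.
move=> _; have [Px|Px] := boolP (P x); first by rewrite two_phase_in.
by rewrite two_phase_out// ltW.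
Qed.

End TwoPhase.

Lemma weighted_eq0 (a p q r s : R) : p = 0 -> r = 0 -> a * (p * q + r * s) = 0.
Proof. by move=> -> ->; rewrite !mul0r addr0 mulr0. Qed.

Lemma a_form0 (P : pred (R * R)) M v : @measurable _ PT [set x | P x] -> 1 < M ->
  Sobolev_H1 v -> a_form (two_phase P M) (fun=> 0) v = 0.
Proof.
move=> mP M1 Hv; have c0 := @Cc0 R.
rewrite (a_formE (measurable_two_phase M mP) (two_phase_ge1 _ M1) (two_phase_leM _ M1)
  (Cc_H1 c0) Hv (fun i => Cc_sqint (Cc_partial i c0)) (fun i => wpartial_sqint i Hv)
  (fun i => Cc_wpartial_ae i c0) (fun i => H1_refl_ae i v)).
rewrite /wint (_ : \int[mu]_(x in Om) _ = \I (fun=> 0)); first by rewrite (Rintegral_cst _ mO) mul0r.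
apply: eq_Rintegral => x _; have E i : partial i (fun=> 0 : R) x = 0 by exact: partial_cst.
exact: (weighted_eq0 _ _ _ (E ord0) (E (lift ord0 ord0))).
Qed.

Lemma measurable_leset (f g : R * R -> R) : @measurable_fun _ _ PT R setT f ->
  @measurable_fun _ _ PT R setT g -> @measurable _ PT [set x | f x <= g x].
Proof.
move=> mf mg; have := measurable_fun_ler mf mg.
move=> /(_ (@measurableT _ PT) [set true] I); rewrite setTI.
by rewrite (_ : _ @^-1` _ = [set x | f x <= g x]).
Qed.

Definition diamond x := `|x.1| + `|x.2| <= 1.
Definition wedge x := x.1 + `|x.2| <= 1.

Lemma measurable_abs2 : @measurable_fun _ _ PT R setT (fun x => `|x.2|).
Proof. by apply: measurableT_comp => //; exact: measurable_coord2. Qed.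

Lemma measurable_diamond : @measurable _ PT [set x | diamond x].
Proof.
apply: measurable_leset; last exact: measurable_cst.
apply: measurable_funD; last exact: measurable_abs2.
by apply: measurableT_comp => //; exact: measurable_coord1.
Qed.

Lemma measurable_wedge : @measurable _ PT [set x | wedge x].
Proof.
apply: measurable_leset; last exact: measurable_cst.
by apply: measurable_funD; [exact: measurable_coord1|exact: measurable_abs2].
Qed.

Lemma diamond_wedge x : diamond x -> wedge x.
Proof. by rewrite /diamond /wedge => /(le_trans _); apply; rewrite lerD2r ler_norm. Qed.

Definition load_fun : R * R -> R := fun x => (load x)%:R.

Lemma load_fun_L2 : L2_Omega load_fun.
Proof. exact/L2_sqintP/load_sqint. Qed.

(** The rectangle []0, 4^-1[] times []-4^-1, 4^-1[] has area [8^-1], lies in the support of the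
    load, and [phi] is 1 on it. *)
Lemma load_mass phi : Cc_infty phi -> (forall x, 0 <= phi x) ->
  (forall x, `|x.1| <= 4^-1 -> `|x.2| <= 4^-1 -> phi x = 1) ->
  8^-1 <= \I (fun x => load_fun x * phi x).
Proof.
move=> cphi p0 p1.
pose A : set R := `]0, 4^-1[%classic; pose B : set R := `]-4^-1, 4^-1[%classic.
pose P x := (0 < x.1 < 4^-1) && (-4^-1 < x.2 < 4^-1).
have mA : @measurable _ Rm A by exact: measurable_itv.
have mB : @measurable _ Rm B by exact: measurable_itv.
have PAB x : P x <-> A x.1 /\ B x.2.
  by rewrite /P /A /B /= !in_itv /=; split => [/andP[-> ->]|[-> ->]].
have mP : @measurable _ PT [set x | P x].
  rewrite (_ : [set x | P x] = A `*` B); first exact: (@measurableX _ _ Rm Rm).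
  by apply/seteqP; split => x /PAB.
have area : (leb A * leb B)%E = 8^-1%:E.
  rewrite leb_itv_oo; last by lra.
  by rewrite leb_itv_oo; [rewrite -EFinM; congr EFin; field|lra].
have <- : \I (fun x => (P x)%:R) = 8^-1.
  apply: (Rintegral_bool_box_eq mA mB) area => [x _|x]; first exact: PAB.
  rewrite /A /B /= !in_itv /= => /andP[a1 a2] /andP[b1 b2].
  by split; apply/andP; split; lra.
have rP : rint mu Om (fun x => (P x)%:R).
  by apply: (rint_bounded mO fO (measurable_boolO mP) (C := 1)) => x _; exact: normr_bool.
have rl : rint mu Om (fun x => load_fun x * phi x).
  exact: (sqintM mO (load_sqint R) (Cc_sqint cphi)).
apply: (le_Rintegral mO rP rl) => x _; have [/andP[/andP[a1 a2] /andP[b1 b2]]|_] := boolP (P x).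
  have ax : `|x.1| <= 4^-1 by rewrite ler_norml; apply/andP; split; lra.
  have bx : `|x.2| <= 4^-1 by rewrite ler_norml; apply/andP; split; lra.
  by rewrite p1// mulr1 /load_fun /load a1 (_ : x.1 < _)//; lra.
by rewrite mulr_ge0// /load_fun.
Qed.

Section FixedPatch.
Variable L : nat.
(** Two steps of range [L], each with the slack 1 of [dist_depth], lead from [Core] to depth at most
    [2 L + 2]; only the last fan triangles have depth [n]. *)
Let n := (2 * L).+3.
Let n2 : (1 < n)%N. Proof. by []. Qed.
Local Notation T := (@mesh R n).
Local Notation cell := (cell n).
Local Notation elem := (@elem R n).

Lemma diamond_pair M : 1 < M -> admissible_pair M T (two_phase diamond M).
Proof.
move=> M1; have inside c x : elem c x -> in_diamond c -> diamond x.
  by move=> cx; apply: (closure_elem_diamond n2); exact: subset_closure.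
have outside c x : elem c x -> ~~ in_diamond c -> ~~ diamond x.
  by move=> cx h; rewrite -ltNge; exact: (elem_outside n2) cx h.
have val c : takes_value (elem c) (two_phase diamond M) (if in_diamond c then M else 1).
  move=> x cx; case: ifPn => [/(inside _ _ cx)|/(outside _ _ cx)].
    exact: two_phase_in.
  exact: two_phase_out.
split => //.
- split; first exact: mesh_conforming.
  split; first exact: measurable_two_phase measurable_diamond.
  by move=> _ [c _ <-]; exists (if in_diamond c then M else 1) => x; exact: val.
- by move=> _ [c _ <-]; have := val c; case: ifP => _; [right|left].
- by exists (elem (Outer n true)); [exists (Outer n true)|exact: (val (Outer n true))].
- by exists (elem (Core n)); [exists (Core n)|exact: (val (Core n))].
Qed.


Lemma wedge_pair M : 1 < M -> admissible_pair M T (two_phase wedge M).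
Proof.
move=> M1; pose left_of (c : cell) := if c is Outer _ then false else true.
have val c : takes_value (elem c) (two_phase wedge M) (if left_of c then M else 1).
  move=> x cx; have clx := subset_closure cx; case: c cx clx => [||b|b i] cx clx /=.
  - by apply/two_phase_in/diamond_wedge/(closure_elem_diamond n2 clx).
  - by apply/two_phase_in/diamond_wedge/(closure_elem_diamond n2 clx).
  - apply: two_phase_out; rewrite /wedge -ltNge.
    have [x0 _] := closure_outer clx.
    by have := elem_outside n2 cx isT; rewrite ger0_norm.
  - apply: two_phase_in; rewrite /wedge.
    have /= x0 := closure_left n2 clx.
    have [_ /andP[y1 y2]] := elem_Omega n2 cx.
    have : `|x.2| < 1 by rewrite ltr_norml y1.
    by lra.
split => //.
- split; first exact: mesh_conforming.
  split; first exact: measurable_two_phase measurable_wedge.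
  by move=> _ [c _ <-]; exists (if left_of c then M else 1) => x; exact: val.
- by move=> _ [c _ <-]; have := val c; case: ifP => _; [right|left].
- by exists (elem (Outer n true)); [exists (Outer n true)|exact: (val (Outer n true))].
- by exists (elem (Core n)); [exists (Core n)|exact: (val (Core n))].
Qed.

(** Lets the consistency condition remove the oscillation terms for both coefficients. *)
Lemma load_P0 : P0 T load_fun.
Proof.
split; first exact: (measurable_boolO (@measurable_load R)).
move=> _ [c _ <-]; have [->|cC] := pselect (c = Core n).
  by exists 1 => x /(core_load) cx; rewrite /load_fun cx.
by exists 0 => x /subset_closure cx; rewrite /load_fun (not_load n2 cx).
Qed.

Lemma load_orthogonal v : V_h T v -> \I (fun x => load_fun x * v x) = 0.
Proof.
move=> [Hv aff]; have Tc : T (elem (Core n)) by exists (Core n).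
have [c0 [c1 [c2 val]]] := aff _ Tc.
apply: (affine_load Hv) => x /(load_core n) xc; exact: val.
Qed.

Lemma zero_fem (P : pred (R * R)) M f : @measurable _ PT [set x | P x] -> 1 < M ->
  (forall v, V_h T v -> \I (fun x => f x * v x) = 0) ->
  fem_solution T (two_phase P M) f (fun=> 0).
Proof.
move=> mP M1 fv; split.
  split; first exact: Cc_H10 (@Cc0 R).
  by move=> K _; exists 0, 0, 0 => x _; rewrite !mul0r !addr0.
move=> v Vv; rewrite /L2dot fv// a_form0//; exact: H10_H1 Vv.1.
Qed.

Lemma omega_patchP K x : omega_patch T L K x ->
  exists c : cell, (mesh_dist T (elem c) K <= L%:R%:E)%E /\ closure (elem c) x.
Proof.
by move=> /interior_subset[_ [[c _ <-] dc] cx]; exists c.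
Qed.

(* The two coefficients differ only on the last fan triangles, and those are not
   within distance [L] of a patch that reaches [Core]. *)
Lemma near_patch M (d : cell) x : (mesh_dist T (elem (Core n)) (elem d) <= L%:R%:E)%E ->
  omega_patch T L (elem d) x -> two_phase diamond M x = two_phase wedge M x.
Proof.
move=> /(dist_depth n2)[_ /= dd] /omega_patchP[c [/(dist_depth n2)[dc _] cx]].
have cn : (depth c < n)%N.
  apply: leq_ltn_trans dc _; apply: (@leq_ltn_trans (0 + L.+1 + L.+1)%N).
    by rewrite leq_add2r.
  by rewrite /n add0n addSn addnS mul2n addnn.
have [dx|o] : diamond x \/ 0 <= x.1.
  case: c {dc} cx cn => [||b|b i] cx cn.
  - by left; exact: (closure_elem_diamond n2 cx).
  - by left; exact: (closure_elem_diamond n2 cx).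
  - by right; have [] := closure_outer cx.
  - by left; exact: (closure_elem_diamond n2 cx).
- by rewrite !two_phase_in//; exact: diamond_wedge.
- by rewrite /two_phase /diamond /wedge ger0_norm.
Qed.

Lemma far_patch (d : cell) x : ~ (mesh_dist T (elem (Core n)) (elem d) <= L%:R%:E)%E ->
  omega_patch T L (elem d) x -> load_fun x = 0 :> R.
Proof.
move=> far /omega_patchP[c [dc cx]]; rewrite /load_fun (not_load n2 cx)//.
by move=> E; apply: far; rewrite -E.
Qed.

(** * Comparison of the two problems through the estimator *)

Section Estimates.
Variables (eta : estimator R) (osc : oscillation R) (Crel Ceff : R -> R) (M : R).
Hypothesis local : locally_computable L eta.
Hypothesis consistent : oscillation_consistent osc.
Hypothesis Crel0 : 0 < Crel M.
Hypothesis rel : reliable eta osc Crel.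
Hypothesis eff : efficient eta osc Ceff.
Hypothesis M1 : 1 < M.

Definition hard_problem := Problem T (two_phase diamond M) load_fun (fun=> 0).
Definition easy_problem := Problem T (two_phase wedge M) load_fun (fun=> 0).
(** It has the coefficient and the discrete solution of [hard_problem], so it is locally
    indistinguishable from it away from the load. *)
Definition zero_problem := Problem T (two_phase diamond M) (fun=> 0) (fun=> 0).

Lemma zero_L2 : L2_Omega (fun=> 0 : R).
Proof. exact: Cc_L2 (@Cc0 R). Qed.

Lemma zero_P0 : P0 T (fun=> 0 : R).
Proof. by split; [exact: measurable_cst|move=> K _; exists 0]. Qed.

Lemma hard_admissible : admissible M hard_problem.
Proof.
split; [exact: diamond_pair|exact: load_fun_L2|].
exact: zero_fem measurable_diamond M1 load_orthogonal.
Qed.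

Lemma easy_admissible : admissible M easy_problem.
Proof.
split; [exact: wedge_pair|exact: load_fun_L2|].
exact: zero_fem measurable_wedge M1 load_orthogonal.
Qed.

Lemma zero_admissible : admissible M zero_problem.
Proof.
split; [exact: diamond_pair|exact: zero_L2|].
by apply: zero_fem measurable_diamond M1 _ => v _; exact: Rintegral_mul0.
Qed.

Lemma sub_zero u : u \- (fun=> 0) = u.
Proof. by apply/funext => x; rewrite /= subr0. Qed.

Lemma osc_load alpha : admissible_pair M T alpha -> osc T alpha load_fun = 0.
Proof. by move=> h; apply: (consistent h load_fun_L2 load_P0). Qed.

(** The exact solution of this problem has energy 0 and the oscillation vanishes, so efficiency
    forces every single indicator to be 0. *)
Lemma zero_estimator K : T K -> eta zero_problem K = 0.
Proof.
move=> TK; have sf0 : sq (fun=> 0) by exact: sqint_cst mO fO 0.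
have ma := measurable_two_phase M measurable_diamond.
have a1 := two_phase_ge1 diamond M1; have aM := two_phase_leM diamond M1.
have [u hu] := exact_exists ma a1 aM sf0.
have en : a_form (two_phase diamond M) u u <= 0.
  apply: (exact_upper ma a1 aM (lexx 0) hu) => phi cphi.
  by rewrite mul0r Rintegral_mul0 expr0n.
have := eff zero_admissible hu; rewrite /= sub_zero /energy_norm.
rewrite (consistent (diamond_pair M1) zero_L2 zero_P0) addr0.
have -> : Num.sqrt (a_form (two_phase diamond M) u u) = 0 by apply/eqP; rewrite sqrtr_eq0.
rewrite mulr0 => tot.
have tot0 : \sum_(K \in T) eta zero_problem K ^+ 2 <= 0.
  rewrite -sqrtr_eq0 eq_le tot; exact: sqrtr_ge0.
have := le_trans (fsum_term_le (finite_mesh R n) (fun K _ => sqr_ge0 (eta zero_problem K)) TK) tot0.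
by move=> h; apply/eqP; rewrite -(sqrf_eq0) eq_le h sqr_ge0.
Qed.

Lemma estimator_le : total_estimator eta hard_problem <= total_estimator eta easy_problem.
Proof.
apply: ler_wsqrtr; apply: ler_fsum; first exact: finite_mesh.
move=> _ [d _ <-]; have TK : T (elem d) by exists d.
(* The patches that reach [Core] see the data of the easy problem, all others see those of the zero
   problem. *)
have [close|far] := pselect (mesh_dist T (elem (Core n)) (elem d) <= L%:R%:E)%E.
  rewrite (local hard_admissible easy_admissible)//=; apply: aeW => x //= px.
  by exact: near_patch close px.
rewrite (local hard_admissible zero_admissible)//=.
- by rewrite zero_estimator// expr0n sqr_ge0.
- exact: aeW.
- by apply: aeW => x px; exact: far_patch far px.
- exact: aeW.
Qed.

Lemma error_comparison u w :
  exact_solution (two_phase diamond M) load_fun u ->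
  exact_solution (two_phase wedge M) load_fun w ->
  energy_norm (two_phase diamond M) u <=
  Crel M * Ceff M * energy_norm (two_phase wedge M) w.
Proof.
move=> hu hw; have := rel hard_admissible hu; have := eff easy_admissible hw.
rewrite /= !sub_zero (osc_load (wedge_pair M1)) (osc_load (diamond_pair M1)) !addr0.
move=> he hr; apply: le_trans hr _; rewrite -mulrA ler_wpM2l ?(ltW Crel0)//.
exact: le_trans estimator_le he.
Qed.

End Estimates.
End FixedPatch.

Lemma a_form_ge0 (P : pred (R * R)) M u : 1 < M -> 0 <= a_form (two_phase P M) u u.
Proof.
move=> M1; apply: Rintegral_ge0 => x Ox; rewrite mulr_ge0//.
  by rewrite (le_trans ler01)// two_phase_ge1.
by rewrite sumr_ge0// => i _; rewrite -expr2 sqr_ge0.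
Qed.

Lemma easy_error M w : 1 < M -> exact_solution (two_phase wedge M) load_fun w ->
  a_form (two_phase wedge M) w w <= 4 / M.
Proof.
move=> M1 hw; have M0 := lt_trans ltr01 M1.
have ma := measurable_two_phase M measurable_wedge.
have a1 := two_phase_ge1 wedge M1; have aM := two_phase_leM wedge M1.
apply: (exact_upper ma a1 aM _ hw); first by rewrite divr_ge0// ltW.
move=> phi cphi; apply: (load_upper M0 ma a1 aM _ cphi) => x _ h.
by apply: two_phase_in; rewrite /wedge ltW.
Qed.

(** The constant [64^-1] is the square of the lower bound in [load_mass], and [C * Num.sqrt M]
    bounds the energy of the test function. *)
Lemma hard_error : exists2 C : R, 0 < C & forall M u, 1 < M ->
  exact_solution (two_phase diamond M) load_fun u ->
  64^-1 <= a_form (two_phase diamond M) u u * (C * Num.sqrt M).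
Proof.
have [C C0 test] := test_function R; exists C => // M u M1 hu.
have ma := measurable_two_phase M measurable_diamond.
have a1 := two_phase_ge1 diamond M1; have aM := two_phase_leM diamond M1.
have ad x : Om x -> 1 < `|x.1| + `|x.2| -> two_phase diamond M x <= 1.
  by move=> _ h; rewrite two_phase_out// /diamond -ltNge.
have [phi [cphi p0 p1 en]] := test M _ M1 ma a1 aM ad.
have lo := exact_lower ma a1 aM hu cphi.
have u0 := a_form_ge0 diamond u M1.
apply: le_trans (ler_wpM2l u0 en); apply: le_trans lo.
have := load_mass cphi p0 p1; rewrite -[X in _ -> _ <= X ^+ 2]/(\I (fun x => load_fun x * phi x)).
move: (\I _) => I I8; rewrite (_ : 64^-1 = 8^-1 ^+ 2); last by field.
by rewrite lerXn2r ?nnegrE// (le_trans _ I8).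
Qed.

End Counterexample.

(** The lower bound on [E] is of order [M^(-1/2)] and the upper bound on [F] of order [M^-1]; their
    quotient gives [q^2 >= sqrt M / (256 C)]. *)
Lemma contrast_bound (R : realType) (C M E F q cA : R) : 0 < C -> 1 < M -> 0 < cA -> 0 <= q ->
  64^-1 <= E * (C * Num.sqrt M) -> 0 <= E -> F <= 4 / M -> 
  Num.sqrt E <= q * Num.sqrt F ->
  (cA * Num.sqrt (256 * C / cA ^+ 2))^-1 * M `^ 4^-1 <= q.
Proof.
move=> C0 M1 cA0 q0 hE E0 hF hq; have M0 := lt_trans ltr01 M1.
set s := M `^ 4^-1; have s0 : 0 < s by rewrite powR_gt0.
have s2 : s ^+ 2 = Num.sqrt M.
  by rewrite -powR12_sqrt ?ltW// -powR_mulrn ?ltW// -powRrM; congr (_ `^ _); field.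
have s4 : s ^+ 4 = M by rewrite (exprM s 2 2) s2 sqr_sqrtr// ltW.
have cAE : cA * Num.sqrt (256 * C / cA ^+ 2) = 16 * Num.sqrt C.
  have -> : 256 * C / cA ^+ 2 = (16 / cA) ^+ 2 * C by field; rewrite gt_eqF.
  rewrite sqrtrM ?sqr_ge0// sqrtr_sqr ger0_norm ?divr_ge0 ?(ltW cA0)//.
  by rewrite mulrA mulrCA mulfV ?mulr1// gt_eqF.
rewrite cAE mulrC ler_pdivrMr; last by rewrite mulr_gt0// sqrtr_gt0.
rewrite -(@ler_pXn2r _ 2) ?nnegrE ?mulr_ge0 ?sqrtr_ge0 ?(ltW s0)//.
have hE2 : E <= q ^+ 2 * (4 / M).
  rewrite -(sqr_sqrtr E0); apply: (@le_trans _ _ ((q * Num.sqrt F) ^+ 2)).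
    by rewrite lerXn2r ?nnegrE ?sqrtr_ge0// mulr_ge0// sqrtr_ge0.
  (* No sign of [F] is known here; for negative [F] the square root is 0 by convention. *)
  rewrite exprMn ler_wpM2l ?sqr_ge0//; have [F0|/ltW F0] := leP 0 F; first by rewrite sqr_sqrtr.
  by rewrite (ler0_sqrtr F0) expr0n divr_ge0// ltW.
rewrite !exprMn (sqr_sqrtr (ltW C0)) s2.
have S0 : 0 < Num.sqrt M by rewrite sqrtr_gt0.
have : 64^-1 <= q ^+ 2 * (4 / M) * (C * Num.sqrt M).
  by apply: le_trans hE _; rewrite ler_wpM2r// mulr_ge0 ?(ltW C0) ?(ltW S0).
have ME : M = Num.sqrt M ^+ 2 by rewrite sqr_sqrtr// ltW.
rewrite [in 4 / M]ME; move: (Num.sqrt M) S0 (q ^+ 2) => t t0 Q.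
rewrite (_ : Q * (4 / t ^+ 2) * (C * t) = 4 * Q * C / t); last by field; rewrite gt_eqF.
rewrite ler_pdivlMr// => h; rewrite (_ : Q * (16 ^+ 2 * C) = 64 * (4 * Q * C)); last by ring.
by lra.
Qed.

Theorem theorem4p2 (R : realType) (L : nat) (r0 r1 r2 : R)
    (hr0 : 0 < r0) (hr01 : r0 < r1) (hr12 : r1 < r2) (hr2 : r2 < 1) :
  let C_A : R := Num.sqrt (639%:R / 5%:R) * r0^-1 in
  exists M0 C_B : R, 0 < M0 /\ 0 < C_B /\
    forall (eta : estimator R) (osc : oscillation R) (Crel Ceff : R -> R),
      estimator_nonneg eta ->
      locally_computable L eta ->
      oscillation_functional osc ->
      oscillation_consistent osc ->
      (forall M, 1 < M -> 0 < Crel M) ->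
      (forall M, 1 < M -> 0 < Ceff M) ->
      reliable eta osc Crel ->
      efficient eta osc Ceff ->
      forall M, 1 < M -> M0 <= M ->
        (C_A * Num.sqrt C_B)^-1 * M `^ (4%:R^-1) <= Crel M * Ceff M.
Proof.
move=> C_A; have [C C0 hard] := hard_error R.
have cA0 : 0 < C_A by
  apply: mulr_gt0; [rewrite sqrtr_gt0; exact: divr_gt0 (ltr0Sn _ 638) (ltr0Sn _ 4)|rewrite invr_gt0].
(* Division by [C_A ^+ 2] makes [C_A * Num.sqrt C_B] equal to [16 * Num.sqrt C], and the estimate
   holds for every contrast above 1. *)
exists 1, (256 * C / C_A ^+ 2); split; first exact: ltr01.
split; first by apply: divr_gt0; [exact: mulr_gt0 (ltr0Sn _ 255) C0|exact: exprn_gt0].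
move=> eta osc Crel Ceff eta0 loc _ cons Crel0 Ceff0 rel eff M M1 _.
have [u hu] := exact_exists (measurable_two_phase M (@measurable_diamond R))
  (two_phase_ge1 _ M1) (two_phase_leM _ M1) (load_sqint R).
have [w hw] := exact_exists (measurable_two_phase M (@measurable_wedge R))
  (two_phase_ge1 _ M1) (two_phase_leM _ M1) (load_sqint R).
apply: (contrast_bound C0 M1 cA0 _ (hard M u M1 hu) (a_form_ge0 _ _ M1) (easy_error M1 hw)).
  by rewrite mulr_ge0// ltW ?Crel0 ?Ceff0.
exact: (error_comparison loc cons (Crel0 M M1) rel eff M1 hu hw).
Qed.
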